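(* Let $0<\rho\le1$, $\omega(z)=\langle z\rangle^{2\rho}$ and let $a\in\widehat{\mathcal A}{}^{(\omega)}_{\mathrm{Sh},\rho}(\mathbf C^{2d})$ be such that $a(w,w)\ge-C_0$ for all $w\in\mathbf C^d$, for some constant $C_0\ge0$. Then $$\mathrm{Re}\big((\mathrm{Op}_{\mathfrak V}(a)F,F)_{A^2}\big)\ge-C\|F\|_{A^2}^2,\qquad F\in\mathcal A_{\mathscr S}(\mathbf C^d),$$ and $$\big|\mathrm{Im}\big((\mathrm{Op}_{\mathfrak V}(a)F,F)_{A^2}\big)\big|\le C\|F\|_{A^2}^2,\qquad F\in\mathcal A_{\mathscr S}(\mathbf C^d),$$ for some constant $C\ge0$.
   Context: Notation: $\langle z\rangle=(1+|z|^2)^{1/2}$; $(z,w)=\sum_jz_j\overline{w_j}$; $d\lambda$ is Lebesgue measure on $\mathbf C^d$; $\partial_z,\overline\partial_w$ are Wirtinger derivatives with multi-index powers; $\lesssim$ means inequality up to a constant independent of $z,w$ (possibly depending on multi-indices and $N$). The hypothesis $a(w,w)\ge-C_0$ includes that $a(w,w)$ is real. $\widehat{\mathcal A}{}^{(\omega)}_{\mathrm{Sh},\rho}(\mathbf C^{2d})$ is the set of functions $a(z,w)$ on $\mathbf C^{2d}$ such that $(z,w)\mapsto a(z,\overline w)$ is entire and, for all $\alpha,\beta\in\mathbf N^d$ and $N\ge0$, $|\partial_z^\alpha\overline\partial_w^\beta a(z,w)|\lesssim e^{\frac12|z-w|^2}\omega(\sqrt2\,\overline z)\langle z+w\rangle^{-\rho|\alpha+\beta|}\langle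 z-w\rangle^{-N}$. The Wick operator is $\mathrm{Op}_{\mathfrak V}(a)F(z)=\pi^{-d}\int_{\mathbf C^d}a(z,w)F(w)e^{(z-w,w)}\,d\lambda(w)$. $(F,G)_{A^2}=\pi^{-d}\int_{\mathbf C^d}F(z)\overline{G(z)}e^{-|z|^2}d\lambda(z)$ and $\|F\|_{A^2}^2=(F,F)_{A^2}$. $\mathcal A_{\mathscr S}(\mathbf C^d)$ is the space of entire $F$ on $\mathbf C^d$ with $\sup_z|F(z)|e^{-\frac12|z|^2}\langle z\rangle^r<\infty$ for every $r>0$ (the Bargmann image of the Schwartz space). *)

(* Defs.v *)
From HB Require Import structures.
From mathcomp Require Import all_boot all_order all_algebra.
From mathcomp Require Import complex.
From mathcomp Require Import all_classical all_reals all_analysis.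

Set Implicit Arguments.
Unset Strict Implicit.
Unset Printing Implicit Defensive.

Import Order.TTheory GRing.Theory Num.Theory.
Import numFieldNormedType.Exports.

Local Open Scope classical_set_scope.
Local Open Scope complex_scope.
Local Open Scope ring_scope.

(* R[i] as a normed space over itself, so that [differentiable] below is
   complex differentiability. *)
HB.instance Definition _ (R : rcfType) := NormedModule.copy R[i] R[i]^o.

(* The library's sigma-finite instance of \x only covers subprobabilities. *)
Section prod_measure.
Context {d1 d2 : measure_display} {T1 : measurableType d1}
  {T2 : measurableType d2} {R : realType}.
Variables (m1 : {sigma_finite_measure set T1 -> \bar R})
  (m2 : {sigma_finite_measure set T2 -> \bar R}).

Definition prod_measure : set (T1 * T2) -> \bar R := (m1 \x m2)%E.

HB.instance Definition _ := Measure.on prod_measure.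

Lemma prod_measure_sigma_finite : sigma_finite setT prod_measure.
Proof.
have /sigma_finiteP[F [TF ndF Foo]] := sigma_finiteT m1.
have /sigma_finiteP[G [TG ndG Goo]] := sigma_finiteT m2.
exists (fun n => F n `*` G n).
  rewrite -setXTT TF TG predeqE => -[x y]; split.
    move=> [/= [n _ Fnx] [k _ Gky]]; exists (maxn n k) => //; split.
    - by move: x Fnx; exact/subsetPset/ndF/leq_maxl.
    - by move: y Gky; exact/subsetPset/ndG/leq_maxr.
  by move=> [n _ []/= ? ?]; split; exists n.
move=> k; have [? ?] := Foo k; have [? ?] := Goo k.
split; first exact: measurableX.
by rewrite /prod_measure product_measure1E// lte_mul_pinfty// ge0_fin_numE.
Qed.

HB.instance Definition _ := Measure_isSigmaFinite.Build _ _ _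
  prod_measure prod_measure_sigma_finite.

End prod_measure.

(* mu ^ n on n.-tuple T, defined by recursion on n. *)
Section tuple_measure.
Context {d : measure_display} {T : measurableType d} {R : realType}.
Variable mu : {sigma_finite_measure set T -> \bar R}.

Definition pair_cons n (x : T * n.-tuple T) : n.+1.-tuple T :=
  [tuple of x.1 :: x.2].

Lemma measurable_pair_cons n : measurable_fun setT (@pair_cons n).
Proof. exact: measurable_cons. Qed.

Section step.
Variables (n : nat) (nu : {sigma_finite_measure set (n.-tuple T) -> \bar R}).

Definition cons_measure : set (n.+1.-tuple T) -> \bar R :=
  pushforward (prod_measure mu nu) (@pair_cons n).

HB.instance Definition _ := Measure.copy cons_measure
  (measure_function_pushforward__canonical__measure_function_Measure
    (prod_measure mu nu) (@measurable_pair_cons n)).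

Lemma cons_measure_sigma_finite : sigma_finite setT cons_measure.
Proof.
have [F TF Foo] := sigma_finiteT (prod_measure mu nu).
pose uncons (t : n.+1.-tuple T) : T * n.-tuple T := (thead t, [tuple of behead t]).
have consK : cancel (@pair_cons n) uncons.
  by move=> [x t]; rewrite /uncons /pair_cons; congr pair; apply: val_inj.
have munc : measurable_fun setT uncons.
  apply/measurable_fun_pairP; split; last exact: measurable_behead.
  exact: (measurable_tnth (ord0 : 'I_n.+1)).
exists (fun i => uncons @^-1` F i).
  by rewrite -preimage_bigcup -TF preimage_setT.
move=> i; have [mF Fi] := Foo i; split.
  by rewrite -[X in measurable X]setTI; exact: munc.
rewrite /cons_measure /pushforward -comp_preimage.
by rewrite (_ : uncons \o _ = id)//; apply/funext => x; exact: consK.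
Qed.

HB.instance Definition _ := Measure_isSigmaFinite.Build _ _ _
  cons_measure cons_measure_sigma_finite.

End step.

Fixpoint tuple_measure n : {sigma_finite_measure set (n.-tuple T) -> \bar R} :=
  if n is m.+1 then cons_measure (tuple_measure m) else \d_[tuple].

End tuple_measure.

Section fock.
Context {R : realType} {d : nat}.
Local Notation C := R[i].
Local Notation Cd := 'rV[C]_d.
Implicit Types (z w : Cd) (F G : Cd -> C).

(* C is identified with R * R. *)
Definition lebesgueC :
    {sigma_finite_measure set (measurableTypeR R * measurableTypeR R)%type -> \bar R} :=
  prod_measure lebesgue_measure lebesgue_measure.

Definition lebesgueCd := tuple_measure lebesgueC d.

Definition vec_of_tuple (t : d.-tuple (measurableTypeR R * measurableTypeR R)%type) : Cd :=
  \row_j ((tnth t j).1 +i* (tnth t j).2).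

Definition integralCd F : C :=
  (\int[lebesgueCd]_t complex.Re (F (vec_of_tuple t)))
  +i* (\int[lebesgueCd]_t complex.Im (F (vec_of_tuple t))).

Definition imag : C := 0 +i* 1.

Definition cexp (c : C) : C :=
  (expR (complex.Re c) * cos (complex.Im c))
  +i* (expR (complex.Re c) * sin (complex.Im c)).

Definition conjv z : Cd := map_mx conjc z.

Definition herm z w : C := \sum_j z 0 j * conjc (w 0 j).

Definition sqnorm z : R := \sum_j Normc.normc (z 0 j) ^+ 2.

Definition japanese z : R := Num.sqrt (1 + sqnorm z).

(* Derivative of F at z along the real line z + R v. *)
Definition rderive (v : Cd) F z : C :=
  (derive1 (fun t : R => complex.Re (F (z + t%:C *: v))) 0)
  +i* (derive1 (fun t : R => complex.Im (F (z + t%:C *: v))) 0).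

(* The Wirtinger derivatives (d/dx_j -+ i d/dy_j) / 2. *)
Definition wirtinger (j : 'I_d) F z : C :=
  (rderive (delta_mx 0 j) F z - imag * rderive (imag *: delta_mx 0 j) F z) / 2.

Definition wirtinger_bar (j : 'I_d) F z : C :=
  (rderive (delta_mx 0 j) F z + imag * rderive (imag *: delta_mx 0 j) F z) / 2.

(* D^al, composed in the order of the indices; the operators commute on the
   smooth functions considered. *)
Definition multi (D : 'I_d -> (Cd -> C) -> (Cd -> C)) (al : 'I_d -> nat) F :=
  foldr (fun j G => iter (al j) (D j) G) F (enum 'I_d).

Definition mixed_derivative (al be : 'I_d -> nat) (a : Cd -> Cd -> C) z w : C :=
  multi wirtinger al (fun z' => multi wirtinger_bar be (a z') w) z.

Definition entire F := forall z, differentiable F z.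

Definition entire2 (b : Cd * Cd -> C) := forall p, differentiable b p.

Definition shubin_wick_symbol (omega : Cd -> R) (rho : R) (a : Cd -> Cd -> C) :=
  entire2 (fun p => a p.1 (conjv p.2)) /\
  forall (al be : 'I_d -> nat) (N : R), 0 <= N ->
    exists K : R, forall z w,
      Normc.normc (mixed_derivative al be a z w) <=
      K * (expR (sqnorm (z - w) / 2)
           * omega ((Num.sqrt 2)%:C *: conjv z)
           * japanese (z + w) `^ (- (rho * (\sum_j (al j + be j))%:R))
           * japanese (z - w) `^ (- N)).

Definition wick_op (a : Cd -> Cd -> C) F z : C :=
  (pi%:C ^+ d)^-1 *
  integralCd (fun w => a z w * F w * cexp (herm (z - w) w)).

Definition A2_inner F G : C :=
  (pi%:C ^+ d)^-1 *
  integralCd (fun z => F z * conjc (G z) * (expR (- sqnorm z))%:C).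

(* (F, F) is real and nonnegative, hence [Re] and [Num.sqrt] lose nothing. *)
Definition A2_norm F : R := Num.sqrt (complex.Re (A2_inner F F)).

Definition A_schwartz F :=
  entire F /\
  forall r : R, 0 < r -> exists K : R, forall z,
    Normc.normc (F z) * expR (- (sqnorm z / 2)) * japanese z `^ r <= K.

End fock.

(* Main.v *)
(* Write J for the form (Op(a)F, F), up to a constant the double integral of
   a(z,w) K(z,w) with K(z,w) = F(w) conj(F(z)) e^{(z,w)-|z|^2-|w|^2}. By the
   reproducing formula for entire functions, replacing a(z,w) by any of a(w,w),
   a(z,z), a(w,z) gives one and the same integral, the anti-Wick form of
   a(w,w), which is real and bounded below by -C_0. So J differs from it by the
   double integral of the second difference a(z,w) - a(w,w) - a(z,z) + a(w,z)
   times K. That difference is controlled by the derivatives d_j dbar_k a at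
   points (z',w') with |z'-w'| <= |z-w|; there the weights <z>^{2 rho} and
   <z+w>^{-2 rho} cancel, by Peetre's inequality, up to <z'-w'>^2. As
   |K(z,w)| = f(z) f(w) e^{-|z-w|^2/2} with f = |F| e^{-|.|^2/2}, Schur's test
   bounds the double integral by a multiple of the squared norm of F.

   The mean value property behind the reproducing formula comes from Goursat's
   bisection in the coordinate log z, and Gaussian means over C^d follow by
   averaging over the rotations u |-> e^{it} u. *)
Require Import Defs.
From HB Require Import structures.
From mathcomp Require Import all_boot all_order all_algebra.
From mathcomp Require Import complex.
From mathcomp Require Import all_classical all_reals all_analysis.
From mathcomp Require Import measurable_realfun.
From mathcomp Require Import ring lra.
Set Implicit Arguments.
Unset Strict Implicit.
Unset Printing Implicit Defensive.
Import Order.TTheory GRing.Theory Num.Theory.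
Import numFieldNormedType.Exports.
Local Open Scope classical_set_scope.
Local Open Scope complex_scope.
Local Open Scope ring_scope.

Local Notation nrm := Normc.normc.
Local Notation Re := complex.Re.
Local Notation Im := complex.Im.

(** * Complex numbers and continuity *)

(** The growth e^{|z-w|^2/2} allowed to a symbol uses up the whole Gaussian e^{-|z-w|^2/2} of the
    kernel, so off the diagonal only the powers of <z-w> make the remainder summable, and the
    remaining weight in z has to be bounded. A single difference a(z,w) - a(w,w) yields one
    derivative, which gains only <z+w>^{-rho} against <z>^{2 rho}; a gain of <z+w>^{-2 rho} takes
    one difference in each variable. This is the role of a(w,z): it completes a(z,w), a(w,w), a(z,z)
    to the four corners of a square, it is still holomorphic in the variable integrated by the
    reproducing formula, and the signs 1 + 1 - 1 leave exactly one anti-Wick form. In that square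
    the first argument runs from w to z while the second runs from z to w. The two arguments of an
    intermediate point are therefore never further apart than z and w. They may be much closer,
    where the powers of <z'-w'> decay less, but there the exponential is smaller too, and this makes
    up for the loss. *)

Section complex_basics.
Variable R : realType.
Implicit Types x y z : R[i].

Lemma normE z : `|z| = (nrm z)%:C. Proof. by []. Qed.
Lemma nrm_ge0 z : 0 <= nrm z. Proof. by rewrite -lecR -normE normr_ge0. Qed.
Lemma nrmD x y : nrm (x + y) <= nrm x + nrm y.
Proof. exact: le_normcD. Qed.
Lemma nrmN z : nrm (- z) = nrm z. Proof. exact: normcN. Qed.
Lemma nrmM x y : nrm (x * y) = nrm x * nrm y.
Proof. by case: x y => a b [c e]; rewrite Normc.normcM. Qed.
Lemma nrmV z : nrm z^-1 = (nrm z)^-1.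
Proof. exact: Normc.normcV. Qed.
Lemma nrm0 : nrm (0 : R[i]) = 0. Proof. exact: Normc.normc0. Qed.
Lemma nrm1 : nrm (1 : R[i]) = 1. Proof. exact: Normc.normc1. Qed.
Lemma nrmJ z : nrm (conjc z) = nrm z.
Proof. by case: z => a b /=; rewrite sqrrN. Qed.
Lemma nrm_real (r : R) : nrm r%:C = `|r|.
Proof. by rewrite /= expr0n /= addr0 sqrtr_sqr. Qed.
Lemma nrmB x y : nrm (x - y) = nrm (y - x). Proof. by rewrite -nrmN opprB. Qed.
Lemma nrm_sqr z : nrm z ^+ 2 = Re z ^+ 2 + Im z ^+ 2.
Proof. by case: z => a b /=; rewrite sqr_sqrtr// addr_ge0// sqr_ge0. Qed.
Lemma Re_le z : `|Re z| <= nrm z.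
Proof. by rewrite -ler_sqr ?nnegrE ?nrm_ge0// nrm_sqr real_normK ?num_real// lerDl sqr_ge0. Qed.
Lemma Im_le z : `|Im z| <= nrm z.
Proof. by rewrite -ler_sqr ?nnegrE ?nrm_ge0// nrm_sqr real_normK ?num_real// lerDr sqr_ge0. Qed.
Lemma nrm_le z : nrm z <= `|Re z| + `|Im z|.
Proof.
rewrite -ler_sqr ?nnegrE ?nrm_ge0 ?addr_ge0// nrm_sqr sqrrD !real_normK ?num_real//.
by rewrite lerD2r lerDl mulrn_wge0// mulr_ge0.
Qed.
Lemma nrm_eq0 z : (nrm z == 0) = (z == 0).
Proof. by apply/eqP/eqP => [/Normc.eq0_normc//|->]; exact: nrm0. Qed.
Lemma nrm_gt0 z : (0 < nrm z) = (z != 0).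
Proof. by rewrite lt_def nrm_ge0 andbT nrm_eq0. Qed.
Lemma cReD x y : Re (x + y) = Re x + Re y. Proof. by case: x y => ? ? []. Qed.
Lemma cImD x y : Im (x + y) = Im x + Im y. Proof. by case: x y => ? ? []. Qed.
Lemma cReN x : Re (- x) = - Re x. Proof. by case: x. Qed.
Lemma cImN x : Im (- x) = - Im x. Proof. by case: x. Qed.
Lemma cReB x y : Re (x - y) = Re x - Re y. Proof. by rewrite cReD cReN. Qed.
Lemma cImB x y : Im (x - y) = Im x - Im y. Proof. by rewrite cImD cImN. Qed.
Lemma cReM x y : Re (x * y) = Re x * Re y - Im x * Im y. Proof. by case: x y => ? ? []. Qed.
Lemma cImM x y : Im (x * y) = Re x * Im y + Im x * Re y. Proof. by case: x y => ? ? []. Qed.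
Lemma cReJ z : Re (conjc z) = Re z. Proof. by case: z. Qed.
Lemma cImJ z : Im (conjc z) = - Im z. Proof. by case: z. Qed.
Lemma cplx_eq x y : Re x = Re y -> Im x = Im y -> x = y.
Proof. by case: x y => ? ? [? ?] /= -> ->. Qed.

Lemma nbhsCP z (A : set R[i]) : nbhs z A <-> exists2 e : R, 0 < e & forall y, nrm (y - z) < e -> A y.
Proof.
split.
  move=> /nbhs_ballP[e /= e0 eA]; exists (Re e).
    by move: e0; rewrite ltcE => /andP[_].
  move=> y yz; apply: eA; rewrite -ball_normE /= normE nrmB.
  move: e0; rewrite !ltcE /= => /andP[/eqP-> _]; rewrite eqxx//.
move=> [e e0 eA]; apply/nbhs_ballP; exists e%:C => /=; first by rewrite ltcR.
by move=> y; rewrite -ball_normE /= normE ltcR nrmB => /eA.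
Qed.

Lemma continuous_Re : continuous (@Re R : R[i] -> R).
Proof.
move=> z A /nbhs_ballP[e /= e0 eA]; apply/nbhsCP; exists e => // y yz.
apply: eA; rewrite -ball_normE /= -cReB; apply: le_lt_trans (Re_le _) _.
by rewrite nrmB.
Qed.
Lemma continuous_Im : continuous (@Im R : R[i] -> R).
Proof.
move=> z A /nbhs_ballP[e /= e0 eA]; apply/nbhsCP; exists e => // y yz.
apply: eA; rewrite -ball_normE /= -cImB; apply: le_lt_trans (Im_le _) _.
by rewrite nrmB.
Qed.
Lemma nrm_dist x y : `|nrm x - nrm y| <= nrm (x - y).
Proof.
rewrite ler_norml; apply/andP; split.
  by rewrite lerNl opprB lerBlDr nrmB -[leLHS](congr1 (@nrm R) (subrK x y)) nrmD.
by rewrite lerBlDr -[leLHS](congr1 (@nrm R) (subrK y x)) nrmD.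
Qed.
Lemma continuous_nrm : continuous (@nrm R : R[i] -> R).
Proof.
move=> z A /nbhs_ballP[e /= e0 eA]; apply/nbhsCP; exists e => // y yz.
apply: eA; rewrite -ball_normE /=; apply: le_lt_trans (nrm_dist _ _) _.
by rewrite nrmB.
Qed.
Lemma continuous_conjc : continuous (@conjc R : R[i] -> R[i]).
Proof.
move=> z A /nbhsCP[e /= e0 eA]; apply/nbhsCP; exists e => // y yz.
by apply: eA; rewrite -rmorphB nrmJ.
Qed.

Lemma continuous_mkC (T : topologicalType) (f g : T -> R) (t : T) :
  {for t, continuous f} -> {for t, continuous g} ->
  {for t, continuous (fun t => f t +i* g t : R[i])}.
Proof.
move=> cf cg A /nbhsCP[e e0 eA].
have e20 : 0 < e / 2 by rewrite divr_gt0.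
have /= H1 := cf _ (nbhsx_ballx (f t) (e / 2) e20).
have /= H2 := cg _ (nbhsx_ballx (g t) (e / 2) e20).
near=> s; apply: eA.
apply: le_lt_trans (nrm_le _) _; rewrite cReB cImB /= [ltRHS]splitr ltrD//.
  by rewrite distrC; near: s.
by rewrite distrC; near: s.
Unshelve. all: by end_near. Qed.

Lemma continuous_real : continuous (fun x : R => x%:C).
Proof. by move=> x; apply: continuous_mkC; [exact: cvg_id|exact: cvg_cst]. Qed.

Lemma nbhs_rVP d (z : 'rV[R[i]]_d) (A : set 'rV[R[i]]_d) : nbhs z A <->
  exists2 e : R, 0 < e & forall y : 'rV_d, (forall j, nrm (y 0 j - z 0 j) < e) -> A y.
Proof.
split.
  move=> /nbhs_ballP[e /= e0 eA]; exists (Re e).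
    by move: e0; rewrite ltcE => /andP[_].
  move=> y yz; apply: eA; split=> // i j; rewrite ord1 -ball_normE /= normE nrmB.
  by move: e0; rewrite !ltcE /= => /andP[/eqP-> _]; rewrite eqxx/=.
move=> [e e0 eA]; apply/nbhs_ballP; exists e%:C => /=; first by rewrite ltcR.
move=> y yz; apply: eA => j.
by case: yz => _ /(_ 0 j); rewrite -ball_normE /= normE ltcR nrmB.
Qed.

(* A record rather than a definition, to keep unification from unfolding it. *)
Record ccont (T : topologicalType) (f : T -> R[i]) (t : T) : Prop :=
  CCont { ccontP : {for t, continuous f} }.

Section continuity.
Variable T : topologicalType.
Implicit Types (f g : T -> R[i]) (t : T).
Lemma ccontD f g t : ccont f t -> ccont g t -> ccont (fun t => f t + g t) t.
Proof. exact (fun cf cg => CCont (@continuousD R[i] R[i]^o T f g t (ccontP cf) (ccontP cg))). Qed.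
Lemma ccontN f t : ccont f t -> ccont (fun t => - f t) t.
Proof. exact (fun cf => CCont (@continuousN R[i] R[i]^o T f t (ccontP cf))). Qed.
Lemma ccontM f g t : ccont f t -> ccont g t -> ccont (fun t => f t * g t) t.
Proof. exact (fun cf cg => CCont (@continuousM R[i] T f g t (ccontP cf) (ccontP cg))). Qed.
Lemma ccontV f t : f t != 0 -> ccont f t -> ccont (fun t => (f t)^-1) t.
Proof. exact (fun nz cf => CCont (@continuousV R[i] T f t nz (ccontP cf))). Qed.
Lemma ccont_cst (c : R[i]) t : ccont (fun _ : T => c) t.
Proof. by split; exact: cvg_cst. Qed.
Lemma ccont_comp (U : topologicalType) (g : U -> R[i]) (f : T -> U) t :
  {for t, continuous f} -> ccont g (f t) -> ccont (fun t => g (f t)) t.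
Proof. by move=> cf [cg]; split; exact: continuous_comp. Qed.
Lemma ccont_compC (g : R[i] -> R[i]) f t :
  ccont f t -> ccont g (f t) -> ccont (fun t => g (f t)) t.
Proof. by move=> [cf]; exact: ccont_comp. Qed.
End continuity.

Lemma ccont_id (z : R[i]) : ccont (fun t => t) z.
Proof. by split; exact: cvg_id. Qed.

End complex_basics.

(** * Complex differentiability *)

Section cderiv.
Variable R : realType.
Local Notation C := R[i].
Implicit Types (f g : C -> C) (x D : C).

(* Caratheodory form of complex differentiability: the difference quotient
   extends continuously to [0], with value the derivative. *)
Definition cderiv f x D := exists phi : C -> C,
  [/\ ccont phi 0, phi 0 = D & forall h, f (x + h) = f x + phi h * h].

Lemma continuous_forCP (phi : C -> C) x : ccont phi x <->
  forall e : R, 0 < e -> exists2 dl : R, 0 < dl & forall h, nrm h < dl -> nrm (phi (x + h) - phi x) < e.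
Proof.
split=> [/ccontP cphi e e0|H]; last split=> A /nbhsCP[e e0 eA].
  have /nbhsCP[dl dl0 H] : nbhs x (phi @^-1` [set y | nrm (y - phi x) < e]).
    by apply: cphi; apply/nbhsCP; exists e.
  by exists dl => // h hd; apply: H; rewrite addrC addKr.
have [dl dl0 {}H] := H _ e0; apply/nbhsCP; exists dl => // y yx; apply: eA.
by have := H _ yx; rewrite [x + _]addrC subrK.
Qed.

Lemma cderiv_epsP f x D : cderiv f x D <->
  forall e : R, 0 < e -> exists2 dl : R, 0 < dl &
    forall h, nrm h < dl -> nrm (f (x + h) - f x - D * h) <= e * nrm h.
Proof.
split=> [[phi [cphi phi0 E]] e e0|H].
  move/continuous_forCP : cphi => /(_ _ e0)[dl dl0 H]; exists dl => // h /H.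
  rewrite add0r phi0 => /ltW hd; rewrite E [f x + _]addrC addrK -mulrBl nrmM.
  by rewrite ler_wpM2r// nrm_ge0.
exists (fun h => if h == 0 then D else (f (x + h) - f x) / h); split.
- apply/continuous_forCP => e e0; have e20 : 0 < e / 2 by rewrite divr_gt0.
  have [dl dl0 {}H] := H _ e20; exists dl => // h /H; rewrite add0r eqxx.
  case: eqP => [_ _|/eqP h0]; first by rewrite subrr nrm0.
  have -> : (f (x + h) - f x) / h - D = (f (x + h) - f x - D * h) / h.
    by rewrite [in RHS]mulrBl mulfK.
  rewrite nrmM nrmV ltr_pdivrMr ?nrm_gt0// => /le_lt_trans; apply.
  by rewrite ltr_pM2r ?nrm_gt0// ltr_pdivrMr// ltr_pMr// ltr1n.
- by rewrite eqxx.
- by move=> h; case: eqP => [->|/eqP h0]; rewrite ?addr0 ?mulr0 ?addr0// divfK// [RHS]addrC subrK.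
Qed.

Lemma cderiv_continuous f x D : cderiv f x D -> ccont f x.
Proof.
move=> [phi [cphi phi0 E]]; split=> A fA.
have : ccont (fun h => f x + phi h * h) 0.
  by apply: ccontD; [exact: ccont_cst|apply: ccontM => //; exact: ccont_id].
move=> /ccontP/(_ A); rewrite mulr0 addr0 => /(_ fA) /nbhsCP[e e0 H].
apply/nbhsCP; exists e => // y yx.
have := H (y - x); rewrite subr0 => /(_ yx) /=; by rewrite -E [x + _]addrC subrK.
Qed.

Lemma cderiv_shift_cont (f : C -> C) x : ccont f x ->
  ccont (fun h => f (x + h)) 0.
Proof.
move=> cf; apply: (@ccont_compC _ _ f (fun h => x + h) 0); last first.
  by rewrite addr0.
by apply: ccontD; [exact: ccont_cst|exact: ccont_id].
Qed.

Lemma cderiv_cst c x : cderiv (fun=> c) x 0.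
Proof. by exists (fun=> 0); split=> [|//|h]; [exact: ccont_cst|rewrite mul0r addr0]. Qed.
Lemma cderiv_id x : cderiv id x 1.
Proof. by exists (fun=> 1); split=> [|//|h]; [exact: ccont_cst|rewrite mul1r]. Qed.
Lemma cderivD f g x D E : cderiv f x D -> cderiv g x E ->
  cderiv (fun z => f z + g z) x (D + E).
Proof.
move=> [p [cp p0 fE]] [q [cq q0 gE]]; exists (fun h => p h + q h); split.
- exact: ccontD.
- by rewrite p0 q0.
- by move=> h; rewrite fE gE; ring.
Qed.
Lemma cderivM f g x D E : cderiv f x D -> cderiv g x E ->
  cderiv (fun z => f z * g z) x (D * g x + f x * E).
Proof.
move=> cf cg; have := cderiv_continuous cg; case: cf cg => [p [cp p0 fE]] [q [cq q0 gE]] ccg.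
exists (fun h => p h * g (x + h) + f x * q h); split.
- apply: ccontD; apply: ccontM => //; last exact: ccont_cst.
  exact: cderiv_shift_cont.
- by rewrite p0 q0 addr0.
- by move=> h; rewrite fE gE; ring.
Qed.
Lemma cderiv_comp f g x D E : cderiv f x D -> cderiv g (f x) E ->
  cderiv (fun z => g (f z)) x (E * D).
Proof.
move=> [p [cp p0 fE]] [q [cq q0 gE]]; exists (fun h => q (p h * h) * p h); split.
- apply: ccontM => //; apply: (@ccont_compC _ _ q (fun h => p h * h) 0); last by rewrite mulr0.
  by apply: ccontM => //; exact: ccont_id.
- by rewrite mulr0 q0 p0.
- by move=> h; rewrite fE gE mulrA.
Qed.
Lemma cderiv_affine a b x : cderiv (fun z => a + b * z) x b.
Proof.
have := cderivD (cderiv_cst a x) (cderivM (cderiv_cst b x) (cderiv_id x)).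
by rewrite mul0r !add0r mulr1.
Qed.
Lemma cderiv_ext f g x D : (forall z, f z = g z) -> cderiv f x D -> cderiv g x D.
Proof. by move=> /funext ->. Qed.

(** Restriction to a complex line: this is how entire functions on [C^d] and symbols on [C^d x C^d]
    reach the one-variable theory. *)
Lemma differentiable_cderiv (V : normedModType C) (F : V -> C) z v :
  differentiable F z -> cderiv (fun t => F (z + t *: v)) 0 ('D_v F z).
Proof.
move=> /(@diff_derivable _ _ _ F z v) dF; apply/cderiv_epsP => e e0.
have := dF; move=> /cvg_ex[l Hl].
have -> : 'D_v F z = l by apply/cvg_lim.
have /Hl : nbhs l [set y | nrm (y - l) < e] by apply/nbhsCP; exists e.
move=> /nbhsCP[dl dl0 H]; exists dl => // h hd; rewrite scale0r addr0 add0r.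
have [->|h0] := eqVneq h 0; first by rewrite scale0r addr0 subrr mulr0 subr0 nrm0 mulr0.
have := H h; rewrite subr0 => /(_ hd h0) /ltW /= K.
have -> : F (z + h *: v) - F z - l * h = h * (h^-1 *: (F (h *: v + z) - F z) - l).
  by rewrite mulrBr [h * (_ *: _)]mulrA divff// mul1r [h *: v + z]addrC [h * l]mulrC.
by rewrite nrmM mulrC ler_wpM2r// nrm_ge0.
Qed.

Lemma is_derive_epsP (f : R -> R) (x D : R) : is_derive x 1 f D <->
  forall e, 0 < e -> exists2 dl : R, 0 < dl &
    forall h, `|h| < dl -> `|f (x + h) - f x - D * h| <= e * `|h|.
Proof.
have E h : h != 0 -> f (x + h) - f x - D * h = h * (h^-1 *: (f (h *: 1 + x) - f x) - D).
  by move=> h0; rewrite mulrBr [h * (_ *: _)]mulrA divff// mul1r [h *: 1]mulr1 [h + x]addrC [h * D]mulrC.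
split=> [[dF <-] e e0|H].
  have := dF; move=> /cvg_ex[l Hl].
  have ? : 'D_1 f x = l by apply/cvg_lim.
  have /Hl /nbhs_ballP[dl /= dl0 H] : nbhs l (ball l e) by exact: nbhsx_ballx.
  exists dl => // h hd.
  have [->|h0] := eqVneq h 0; first by rewrite addr0 subrr mulr0 subr0 !normr0 mulr0.
  have := H h; rewrite -ball_normE /= sub0r normrN => /(_ hd h0).
  rewrite /= distrC => /ltW K.
  have -> : f (x + h) - f x - 'D_1 f x * h = h * (h^-1 *: (f (h *: 1 + x) - f x) - l).
    by rewrite mulrBr [h * (_ *: _)]mulrA divff// mul1r [h *: 1]mulr1 [h + x]addrC [h * l]mulrC; congr (_ - _ * _).
  by rewrite normrM mulrC ler_wpM2r.
have cv : (fun h => h^-1 *: (f (h *: 1 + x) - f x)) @ (0 : R)^' --> D.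
  apply/cvgrPdist_le => e e0.
  have [dl dl0 {}H] := H _ e0; apply/nbhs_ballP; exists dl => //= h.
  rewrite -ball_normE /= sub0r normrN => hd h0.
  have := H _ hd; rewrite E// normrM mulrC distrC ler_pM2r// normr_gt0//.
by split; [apply/cvg_ex; exists D|exact/cvg_lim].
Qed.

Lemma cderiv_line f x v D (t : R) : cderiv f (x + t%:C * v) D ->
  is_derive t 1 (fun t => Re (f (x + t%:C * v))) (Re (D * v)) /\
  is_derive t 1 (fun t => Im (f (x + t%:C * v))) (Im (D * v)).
Proof.
move/cderiv_epsP => H.
have K e : 0 < e -> exists2 dl : R, 0 < dl & forall h : R, `|h| < dl ->
   nrm (f (x + (t + h)%:C * v) - f (x + t%:C * v) - D * v * h%:C) <= e * `|h|.
  (* The [+ 1] covers the direction [v = 0]. *)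
  move=> e0; have v0 : 0 < nrm v + 1 by rewrite ltr_wpDl ?nrm_ge0.
  have [|dl dl0 {}H] := H (e / (nrm v + 1)); first by rewrite divr_gt0.
  exists (dl / (nrm v + 1)) => [|h]; first by rewrite divr_gt0.
  rewrite ltr_pdivlMr// => hd; have := H (h%:C * v).
  rewrite nrmM nrm_real => /(_ _)/le_trans.
  have -> : x + (t + h)%:C * v = x + t%:C * v + h%:C * v by rewrite rmorphD /= mulrDl addrA.
  have -> : D * v * h%:C = D * (h%:C * v) by ring.
  apply.
    by apply: le_lt_trans hd; rewrite ler_wpM2l// lerDl.
  have -> : e / (nrm v + 1) * (`|h| * nrm v) = (e * `|h|) * (nrm v / (nrm v + 1)) by ring.
  rewrite -[leRHS]mulr1 ler_wpM2l//; first by rewrite mulr_ge0// ltW.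
  by rewrite ler_pdivrMr// mul1r lerDl.
have ReZ z (h : R) : Re (z * h%:C) = Re z * h by rewrite cReM /= mulr0 subr0.
have ImZ z (h : R) : Im (z * h%:C) = Im z * h by rewrite cImM /= mulr0 add0r.
split; apply/is_derive_epsP => e /K[dl dl0 {}K]; exists dl => // h /K hd; apply: le_trans hd.
  by rewrite -ReZ -!cReB Re_le.
by rewrite -ImZ -!cImB Im_le.
Qed.

Lemma cexpD x y : cexp (x + y) = cexp x * cexp y.
Proof.
case: x y => a b [c e]; apply: cplx_eq; rewrite ?cReM ?cImM /=.
  by rewrite expRD cosD; ring.
by rewrite expRD sinD; ring.
Qed.
Lemma cexp0 : cexp 0 = 1 :> C.
Proof. by apply: cplx_eq; rewrite /= ?expR0 ?cos0 ?sin0 ?mulr1 ?mulr0. Qed.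
Lemma nrm_cexp x : nrm (cexp x) = expR (Re x).
Proof.
apply/eqP; rewrite -(@eqrXn2 _ 2) ?nnegrE ?nrm_ge0 ?expR_ge0// nrm_sqr /= !exprMn -mulrDr.
by rewrite cos2Dsin2 mulr1.
Qed.
Lemma cexp_neq0 x : cexp x != 0 :> C.
Proof. by rewrite -nrm_gt0 nrm_cexp expR_gt0. Qed.

(** With h = x + iy, the real part of e^h - 1 - h is (e^x - 1 - x) + e^x (cos y - 1) and the
    imaginary part is e^x (sin y - y) + (e^x - 1) y, so the real expansions of [expR], [cos] and
    [sin] at 0 suffice. *)
Lemma cderiv_cexp0 : cderiv (@cexp R) 0 1.
Proof.
apply/cderiv_epsP => e0 e00.
(* The 9 is the sum of the errors 4 and 5 of the real and imaginary parts below; [e <= 1] keeps |x|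
   <= 1, hence e^x <= 3. *)
have [e [e_gt0 e1 ee0]] : exists e : R, [/\ 0 < e, e <= 1 & 9 * e <= e0].
  exists (Num.min (e0 / 9) 1); rewrite lt_min divr_gt0//= ge_min lexx orbT; split=> //.
  by rewrite mulrC -ler_pdivlMr// ge_min lexx.
have /is_derive_epsP/(_ _ e_gt0)[d1 d10 H1] := is_derive_expR (0 : R).
have /is_derive_epsP/(_ _ e_gt0)[d2 d20 H2] := is_derive_cos (0 : R).
have /is_derive_epsP/(_ _ e_gt0)[d3 d30 H3] := is_derive_sin (0 : R).
exists (Num.min e (Num.min d1 (Num.min d2 d3))); first by rewrite !lt_min e_gt0 d10 d20 d30.
move=> h; rewrite !lt_min => /and4P[he h1 h2 h3].
have hx := Re_le h; have hy := Im_le h.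
have := H1 _ (le_lt_trans hx h1); have := H2 _ (le_lt_trans hy h2); have := H3 _ (le_lt_trans hy h3).
rewrite !add0r expR0 sin0 cos0 oppr0 mul0r !mul1r !subr0 => K3 K2 K1.
set x := Re h in hx K1 *; set y := Im h in hy K2 K3 *.
have x1 : `|x| <= 1 by apply: le_trans hx _; apply: le_trans (ltW he) _.
have xe : `|x| <= e by apply: le_trans hx _; apply: ltW.
have n0 := nrm_ge0 h.
have E1 : `|expR x - 1| <= 2 * `|x|.
  have -> : expR x - 1 = (expR x - 1 - x) + x by ring.
  apply: le_trans (ler_normD _ _) _; have := normr_ge0 x; nra.
have E3 : `|expR x| <= 3.
  have -> : expR x = (expR x - 1) + 1 by ring.
  by apply: le_trans (ler_normD _ _) _; rewrite normr1; lra.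
rewrite cexp0; apply: le_trans (nrm_le _) _.
have -> : Re (cexp h - 1 - h) = (expR x - 1 - x) + expR x * (cos y - 1).
  by rewrite !cReB /=; ring.
have -> : Im (cexp h - 1 - h) = expR x * (sin y - y) + (expR x - 1) * y.
  by rewrite !cImB /=; ring.
apply: (@le_trans _ _ (9 * e * nrm h)); last by rewrite ler_wpM2r.
have A1 : `|expR x - 1 - x + expR x * (cos y - 1)| <= 4 * e * nrm h.
  apply: le_trans (ler_normD _ _) _; rewrite normrM.
  have : `|expR x| * `|cos y - 1| <= 3 * (e * `|y|) by apply: ler_pM.
  have := ler_wpM2l (ltW e_gt0) hx; have := ler_wpM2l (ltW e_gt0) hy; lra.
have A2 : `|expR x * (sin y - y) + (expR x - 1) * y| <= 5 * e * nrm h.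
  apply: le_trans (ler_normD _ _) _; rewrite !normrM.
  have : `|expR x| * `|sin y - y| <= 3 * (e * `|y|).
    by apply: ler_pM => //; move: K3; rewrite addr0.
  have : `|expR x - 1| * `|y| <= 2 * e * nrm h.
    by apply: le_trans (ler_wpM2r (normr_ge0 y) E1) _; have := ler_wpM2l (normr_ge0 x) hy; have := ler_wpM2r n0 xe; lra.
  have := ler_wpM2l (ltW e_gt0) hy; lra.
by lra.
Qed.

Lemma cderiv_cexp x : cderiv (@cexp R) x (cexp x).
Proof.
have [p [cp p0 E]] := cderiv_cexp0; exists (fun h => cexp x * p h); split.
- by apply: ccontM => //; exact: ccont_cst.
- by rewrite p0 mulr1.
- by move=> h; rewrite cexpD; have := E h; rewrite add0r => ->; rewrite cexp0; ring.
Qed.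

End cderiv.

(** * The mean value property and Cauchy estimates *)

Section mvt.
Variable R : realType.
Implicit Types f df : R -> R.

Lemma mvt_ex f df (a b : R) : a <= b ->
  (forall x, a <= x <= b -> is_derive x 1 f (df x)) ->
  exists2 c, a <= c <= b & f b - f a = df c * (b - a).
Proof.
move=> ab H; have [c|x|c cab E] := @MVT_segment R f df a b ab _ _.
- by rewrite in_itv /= => /andP[ac cb]; apply: H; rewrite !ltW.
- apply: continuous_in_subspaceT => {}x; rewrite inE /= in_itv /= => /H dx.
  exact/differentiable_continuous/derivable1_diffP.
- by exists c => //; move: cab; rewrite in_itv.
Qed.

Lemma mvt_le f df (a b M : R) : a <= b ->
  (forall x, a <= x <= b -> is_derive x 1 f (df x)) ->
  (forall x, a <= x <= b -> `|df x| <= M) -> `|f b - f a| <= M * (b - a).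
Proof.
move=> ab H HM; have [c cab ->] := mvt_ex ab H.
by rewrite normrM [`|b - a|]ger0_norm ?subr_ge0// ler_wpM2r ?subr_ge0// HM.
Qed.
End mvt.

(* Goursat's bisection for the form [q dx + p dy]: [P x] and [Q y] are
   primitives of [p x] and [q ^~ y], so [bnd] is the integral over the boundary
   of a rectangle. For a holomorphic [u + i v] one takes [p = u] and [q = v]. *)
Section green.
Variables (R : realType) (p q P Q : R -> R -> R) (m : R).
(** [m] is the base point of the primitives: they are differentiated only beyond it. *)
Hypothesis dP : forall x t, m < t -> is_derive t 1 (P x) (p x t).
Hypothesis dQ : forall y t, m < t -> is_derive t 1 (Q y) (q t y).

Let bnd x0 x1 y0 y1 := (P x1 y1 - P x1 y0) - (P x0 y1 - P x0 y0)
  - (Q y1 x1 - Q y1 x0) + (Q y0 x1 - Q y0 x0).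

(** First-order form of p_x = q_y at the point (a, b), which for p = u and q = v is one of the
    Cauchy-Riemann equations. No derivative of [p] or [q] is named, and no continuity of derivatives
    is asked. *)
Hypothesis pq : forall a b e, 0 < e -> exists2 dl, 0 < dl & forall x y h,
  0 < h < dl -> x <= a <= x + h -> y <= b <= y + h -> forall t, 0 <= t <= h ->
  `|(p (x + h) (y + t) - p x (y + t)) - (q (x + t) (y + h) - q (x + t) y)| <= e * h.

(** Letting one parameter [t] run along all four sides at once makes the boundary integral the
    increment of a single function, whose derivative is the expression bounded in [pq]. *)
Let bnd_small a b e : 0 < e -> exists2 dl, 0 < dl & forall x y h, m < x -> m < y ->
  0 < h < dl -> x <= a <= x + h -> y <= b <= y + h ->
  `|bnd x (x + h) y (y + h)| <= e * h ^+ 2.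
Proof.
move=> e0; have [dl dl0 H] := pq a b e0; exists dl => // x y h mx my hd xa yb.
have /andP[/ltW h0 _] := hd.
pose f t := P (x + h) (y + t) - P x (y + t) - Q (y + h) (x + t) + Q y (x + t).
pose df t := (p (x + h) (y + t) - p x (y + t)) - (q (x + t) (y + h) - q (x + t) y).
have dsh (F : R -> R) (D z t : R) : is_derive (z + t) 1 F D -> is_derive t 1 (fun t => F (z + t)) D.
  move/is_derive_epsP => K; apply/is_derive_epsP => e1 /K[d1 d10 {}K].
  by exists d1 => // k kd; rewrite addrA; exact: K.
have -> : bnd x (x + h) y (y + h) = f h - f 0 by rewrite /bnd /f !addr0; ring.
rewrite expr2 mulrA -{3}[h]subr0; apply: (@mvt_le _ f df) => // t ht; last exact: H.
have d1 := dsh _ _ _ _ (dP (x + h) (ltr_wpDr (proj1 (andP ht)) my)).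
have d2 := dsh _ _ _ _ (dP x (ltr_wpDr (proj1 (andP ht)) my)).
have d3 := dsh _ _ _ _ (dQ (y + h) (ltr_wpDr (proj1 (andP ht)) mx)).
have d4 := dsh _ _ _ _ (dQ y (ltr_wpDr (proj1 (andP ht)) mx)).
rewrite /f; apply: is_derive_eq; rewrite /df; ring.
Qed.

Lemma green_square x y h : m < x -> m < y -> 0 < h -> bnd x (x + h) y (y + h) = 0.
Proof.
move=> mx my h0; apply/eqP; rewrite -normr_eq0; apply/negPn/negP => B0.
pose B (s : R * R) h := `|bnd s.1 (s.1 + h) s.2 (s.2 + h)|.
(* [bnd] is additive over the four quarters, so one of them carries at least a quarter of [B]. *)
have step (s : R * R) k : exists s' : R * R, 0 < k -> [/\ s.1 <= s'.1, s.2 <= s'.2,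
    s'.1 + k / 2 <= s.1 + k, s'.2 + k / 2 <= s.2 + k & B s k <= 4 * B s' (k / 2)].
  case: s => u v.
  have E : bnd u (u + k) v (v + k) = bnd u (u + k / 2) v (v + k / 2)
     + bnd (u + k / 2) (u + k) v (v + k / 2) + bnd u (u + k / 2) (v + k / 2) (v + k)
     + bnd (u + k / 2) (u + k) (v + k / 2) (v + k) by rewrite /bnd; ring.
  have E2 w : w + k = w + k / 2 + k / 2 by field.
  have : B (u, v) k <= B (u, v) (k / 2) + B (u + k / 2, v) (k / 2)
     + B (u, v + k / 2) (k / 2) + B (u + k / 2, v + k / 2) (k / 2).
    rewrite /B /= -!E2 E; apply: le_trans (ler_normD _ _) _; rewrite lerD2r.
    by apply: le_trans (ler_normD _ _) _; rewrite lerD2r ler_normD.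
  case: (leP (B (u, v) k) (4 * B (u, v) (k / 2))) => [? _|H1].
    by exists (u, v) => k0; split=> //=; lra.
  case: (leP (B (u, v) k) (4 * B (u + k / 2, v) (k / 2))) => [? _|H2].
    by exists (u + k / 2, v) => k0; split=> //=; lra.
  case: (leP (B (u, v) k) (4 * B (u, v + k / 2) (k / 2))) => [? _|H3].
    by exists (u, v + k / 2) => k0; split=> //=; lra.
  case: (leP (B (u, v) k) (4 * B (u + k / 2, v + k / 2) (k / 2))) => [? _|H4].
    by exists (u + k / 2, v + k / 2) => k0; split=> //=; lra.
  by move=> ?; exfalso; lra.
have {step} /choice[g gP] : forall sk : (R * R) * R, exists s' : R * R, 0 < sk.2 ->
  [/\ sk.1.1 <= s'.1, sk.1.2 <= s'.2,
    s'.1 + sk.2 / 2 <= sk.1.1 + sk.2, s'.2 + sk.2 / 2 <= sk.1.2 + sk.2 &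
    B sk.1 sk.2 <= 4 * B s' (sk.2 / 2)].
  by move=> [s k]; exact: step.
pose hn n : R := h / 2 ^+ n.
pose s := fix s n := if n is k.+1 then g (s k, hn k) else (x, y).
have hn0 n : 0 < hn n by rewrite divr_gt0// exprn_gt0.
have hnS n : hn n.+1 = hn n / 2 by rewrite /hn exprSr invfM mulrA.
have sS n : [/\ (s n).1 <= (s n.+1).1, (s n).2 <= (s n.+1).2,
    (s n.+1).1 + hn n.+1 <= (s n).1 + hn n, (s n.+1).2 + hn n.+1 <= (s n).2 + hn n &
    B (s n) (hn n) <= 4 * B (s n.+1) (hn n.+1)].
  by have := gP (s n, hn n) (hn0 n); rewrite hnS.
have mono n k : [/\ (s n).1 <= (s (n + k)%N).1, (s n).2 <= (s (n + k)%N).2,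
    (s (n + k)%N).1 + hn (n + k)%N <= (s n).1 + hn n &
    (s (n + k)%N).2 + hn (n + k)%N <= (s n).2 + hn n].
  elim: k => [|k [a1 a2 a3 a4]]; first by rewrite addn0.
  rewrite addnS; have [b1 b2 b3 b4 _] := sS (n + k)%N; split.
  - exact: le_trans b1.
  - exact: le_trans b2.
  - exact: le_trans a3.
  - exact: le_trans a4.
(* Every lower corner lies below every upper corner, so the suprema [a] and [b] taken later lie in
   all the squares. *)
have nest n k : (s n).1 <= (s k).1 + hn k /\ (s n).2 <= (s k).2 + hn k.
  case: (leqP n k) => [/subnKC <-|/ltnW/subnKC <-].
    have [b1 b2 b3 b4] := mono n (k - n)%N.
    by split; [apply: le_trans b1 _|apply: le_trans b2 _]; rewrite lerDl ltW.
  have [b1 b2 b3 b4] := mono k (n - k)%N.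
  by split; [apply: le_trans b3|apply: le_trans b4]; rewrite lerDl ltW.
have Bn n : B (x, y) h <= 4 ^+ n * B (s n) (hn n).
  elim: n => [|n IH]; first by rewrite expr0 mul1r /hn expr0 divr1.
  apply: le_trans IH _; rewrite exprSr -mulrA ler_wpM2l ?exprn_ge0//.
  by case: (sS n).
pose a := sup (range (fun n => (s n).1)); pose b := sup (range (fun n => (s n).2)).
have Ha n : (s n).1 <= a <= (s n).1 + hn n.
  apply/andP; split.
    apply: ub_le_sup; last by exists n.
    by exists ((s 0%N).1 + hn 0%N) => _ [k _ <-]; case: (nest k 0%N).
  apply: ge_sup; first by exists (s 0%N).1; exists 0%N.
  by move=> _ [k _ <-]; case: (nest k n).
have Hb n : (s n).2 <= b <= (s n).2 + hn n.
  apply/andP; split.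
    apply: ub_le_sup; last by exists n.
    by exists ((s 0%N).2 + hn 0%N) => _ [k _ <-]; case: (nest k 0%N).
  apply: ge_sup; first by exists (s 0%N).2; exists 0%N.
  by move=> _ [k _ <-]; case: (nest k n).
have Bgt0 : 0 < B (x, y) h by rewrite lt_def B0 /= normr_ge0.
(* The selected squares keep at least the ratio [B (x, y) h / h ^+ 2] of boundary integral to area;
   half of that ratio contradicts [bnd_small] at (a, b). *)
have e0 : 0 < B (x, y) h / h ^+ 2 / 2 by rewrite !divr_gt0// exprn_gt0.
have [dl dl0 H] := bnd_small a b e0.
have [n hnd] : exists n, hn n < dl.
  have [n nP] : exists n : nat, h / dl < n%:R.
    by exists (Num.truncn (h / dl)).+1; rewrite truncnS_gt.
  exists n; rewrite /hn ltr_pdivrMr ?exprn_gt0// mulrC -ltr_pdivrMr//.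
  apply: lt_le_trans nP _; rewrite -natrX ler_nat ltnW//; exact: ltn_expl.
have := H (s n).1 (s n).2 (hn n).
have [m1 m2 _ _] := mono 0%N n; rewrite add0n in m1 m2.
move=> /(_ (lt_le_trans mx m1) (lt_le_trans my m2)); rewrite hn0 hnd => /(_ isT (Ha n) (Hb n)) K.
have := Bn n; rewrite leNgt => /negP; apply.
have : B (s n) (hn n) <= B (x, y) h / h ^+ 2 / 2 * hn n ^+ 2 by [].
have p4 : 0 < 4 ^+ n :> R by rewrite exprn_gt0.
move=> /(ler_wpM2l (ltW p4))/le_lt_trans; apply.
have -> : 4 ^+ n * (B (x, y) h / h ^+ 2 / 2 * hn n ^+ 2) = B (x, y) h / 2.
  have -> : 4 ^+ n = (2 ^+ n) ^+ 2 :> R by rewrite -exprM mulnC exprM; congr (_ ^+ _); ring.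
  rewrite /hn; field; rewrite expf_neq0 ?pnatr_eq0//=; exact: lt0r_neq0.
lra.
Qed.
End green.

(** * Integrals over intervals *)

Section real_integrals.
Variable R : realType.
Local Notation mu := (@lebesgue_measure R).
Local Notation C := R[i].

Lemma integrable_itv_continuous (f : R -> R) (a b : R) : continuous f ->
  mu.-integrable `[a, b] (EFin \o f).
Proof.
move=> cf; apply: continuous_compact_integrable; first exact: segment_compact.
exact: continuous_subspaceT.
Qed.

Lemma continuous_ReP (T : topologicalType) (f : T -> C) :
  (forall t, ccont f t) -> continuous (fun t => Re (f t)).
Proof.
by move=> cf t; apply: continuous_comp; [exact: (ccontP (cf t))|exact: continuous_Re].
Qed.
Lemma continuous_ImP (T : topologicalType) (f : T -> C) :
  (forall t, ccont f t) -> continuous (fun t => Im (f t)).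
Proof.
by move=> cf t; apply: continuous_comp; [exact: (ccontP (cf t))|exact: continuous_Im].
Qed.

Lemma is_derive_primitive (f : R -> R) (m t : R) : continuous f -> m < t ->
  is_derive t 1 (fun t => \int[mu]_(x in `[m, t]) f x) (f t).
Proof.
move=> cf mt.
have tt1 : t < t + 1 by rewrite ltrDl.
have [dF E] := continuous_FTC1_closed tt1 (integrable_itv_continuous m (t + 1) cf) mt (cf t).
by split; [exact: dF|rewrite -derive1E E].
Qed.

Lemma Rintegral_itv_split (f : R -> R) (m a b : R) : continuous f -> m <= a -> a <= b ->
  \int[mu]_(x in `[m, b]) f x - \int[mu]_(x in `[m, a]) f x = \int[mu]_(x in `[a, b]) f x.
Proof.
move=> cf ma ab; rewrite Rintegral_itvB ?bnd_simp//; last exact: integrable_itv_continuous.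
rewrite Rintegral_itv_obnd_cbnd//; apply: integrableS (integrable_itv_continuous a b cf) => //.
by apply: subset_itvr; rewrite bnd_simp.
Qed.

Lemma Rintegral_itv_cst (a b c : R) : a <= b -> \int[mu]_(x in `[a, b]) c = c * (b - a).
Proof.
move=> ab; rewrite Rintegral_cst//= lebesgue_measure_itv /= .
case: ifPn => //; rewrite lte_fin -leNgt => ba; have -> : a = b by apply/eqP; rewrite eq_le ab.
by rewrite subrr.
Qed.

Lemma le_Rintegral_itv (f : R -> R) (a b M : R) : a <= b -> continuous f ->
  (forall x, `|f x| <= M) -> `|\int[mu]_(x in `[a, b]) f x| <= M * (b - a).
Proof.
move=> ab cf H; apply: le_trans (le_normr_Rintegral _ _) _ => //.
  exact: integrable_itv_continuous.
rewrite -Rintegral_itv_cst//; apply: le_Rintegral => //.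
- by apply: integrable_itv_continuous => x; apply: continuous_comp; [exact: cf|exact: norm_continuous].
- by apply: integrable_itv_continuous => x; exact: cvg_cst.
Qed.
End real_integrals.

(** * Means of holomorphic functions over circles *)

Section circle_mean.
Variable R : realType.
Local Notation mu := (@lebesgue_measure R).
Local Notation C := R[i].

Lemma ccont_vert (G : C -> C) (x t : R) : ccont G (x +i* t) -> ccont (fun t => G (x +i* t)) t.
Proof.
move=> cG; apply: ccont_comp => //; apply: continuous_mkC; [exact: cvg_cst|exact: cvg_id].
Qed.
Lemma ccont_hor (G : C -> C) (y t : R) : ccont G (t +i* y) -> ccont (fun t => G (t +i* y)) t.
Proof.
move=> cG; apply: ccont_comp => //; apply: continuous_mkC; [exact: cvg_id|exact: cvg_cst].
Qed.

(** The affine part of [G] at the point cancels exactly, and four remainders of order o(h) are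
    left. *)
Lemma holomorphic_green (G : C -> C) (a b : R) (e : R) : (exists D, cderiv G (a +i* b) D) -> 0 < e ->
  exists2 dl, 0 < dl & forall x y h,
  0 < h < dl -> x <= a <= x + h -> y <= b <= y + h -> forall t, 0 <= t <= h ->
  `|(Re (G ((x + h) +i* (y + t))) - Re (G (x +i* (y + t))))
    - (Im (G ((x + t) +i* (y + h))) - Im (G ((x + t) +i* y)))| <= e * h.
Proof.
(* The four points lie within 2h of a + ib, so each remainder is at most (e / 8) 2h = e h / 4. *)
move=> [D dG] e0; have e80 : 0 < e / 8 by rewrite divr_gt0.
move/cderiv_epsP : dG => /(_ _ e80)[dl dl0 H].
exists (dl / 2) => [|x y h /andP[h0 hd] /andP[xa ax] /andP[yb yb'] t /andP[t0 th]]; first by rewrite divr_gt0.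
pose r (z : C) := G z - G (a +i* b) - D * (z - (a +i* b)).
have rP (z : C) : x <= Re z <= x + h -> y <= Im z <= y + h -> nrm (r z) <= e / 4 * h.
  move=> /andP[zx zx'] /andP[zy zy']; have zn : nrm (z - (a +i* b)) <= 2 * h.
    apply: le_trans (nrm_le _) _; rewrite cReB cImB /=.
    have : `|Re z - a| <= h by rewrite ler_norml; apply/andP; split; lra.
    have : `|Im z - b| <= h by rewrite ler_norml; apply/andP; split; lra.
    lra.
  have := H (z - (a +i* b)); rewrite [a +i* b + _]addrC subrK => /(_ _)/le_trans; apply.
    by apply: le_lt_trans zn _; lra.
  have := ler_wpM2l (ltW e80) zn; lra.
have E z : G z = G (a +i* b) + D * (z - (a +i* b)) + r z by rewrite /r; ring.
clearbody r.
have r1 := rP ((x + h) +i* (y + t)); have r2 := rP (x +i* (y + t)).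
have r3 := rP ((x + t) +i* (y + h)); have r4 := rP ((x + t) +i* y).
rewrite (E ((x + h) +i* (y + t))) (E (x +i* (y + t))) (E ((x + t) +i* (y + h))) (E ((x + t) +i* y)); move: r1 r2 r3 r4.
set r1 := r _; set r2 := r _; set r3 := r _; set r4 := r _ => /= R1 R2 R3 R4.
have {}R1 : nrm r1 <= e / 4 * h by apply: R1; apply/andP; split; lra.
have {}R2 : nrm r2 <= e / 4 * h by apply: R2; apply/andP; split; lra.
have {}R3 : nrm r3 <= e / 4 * h by apply: R3; apply/andP; split; lra.
have {}R4 : nrm r4 <= e / 4 * h by apply: R4; apply/andP; split; lra.
rewrite !(cReD, cImD, cReN, cImN, cReM, cImM) /=.
(* The terms in [D] vanish because the real part of D h equals the imaginary part of D (i h). *)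
set X := (X in `|X|); have -> : X = Re r1 - Re r2 - Im r3 + Im r4 by rewrite /X; ring.
have := le_trans (Re_le r1) R1; have := le_trans (Re_le r2) R2.
have := le_trans (Im_le r3) R3; have := le_trans (Im_le r4) R4.
rewrite !ler_norml => /andP[? ?] /andP[? ?] /andP[? ?] /andP[? ?]; apply/andP; split; lra.
Qed.

(* [G] is a function of [log z]: over a square of side [2 pi] the horizontal
   sides of the boundary cancel. *)
Lemma periodic_mean (G : C -> C) (x : R) : (forall z, exists D, cderiv G z D) ->
  (forall z, G (z + 0 +i* (2 * pi)) = G z) ->
  \int[mu]_(t in `[- pi, pi]) Re (G ((x + 2 * pi) +i* t)) =
  \int[mu]_(t in `[- pi, pi]) Re (G (x +i* t)).
Proof.
move=> dG per; have pi0 := pi_gt0 R.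
have cG z : ccont G z by have [D /cderiv_continuous] := dG z.
pose m := Num.min x (- pi) - 1.
have mx : m < x by rewrite /m ltrBlDr ltr_pwDr// ge_min lexx.
have mpi : m < - pi by rewrite /m ltrBlDr ltr_pwDr// ge_min lexx orbT.
have cp u : continuous (fun t => Re (G (u +i* t))).
  by apply: continuous_ReP => t; exact: ccont_vert.
have cq v : continuous (fun t => Im (G (t +i* v))).
  by apply: continuous_ImP => t; exact: ccont_hor.
have := @green_square R (fun u t => Re (G (u +i* t))) (fun t v => Im (G (t +i* v)))
  (fun u t => \int[mu]_(s in `[m, t]) Re (G (u +i* s)))
  (fun v t => \int[mu]_(s in `[m, t]) Im (G (s +i* v))) m
  (fun u t => is_derive_primitive (cp u)) (fun v t => is_derive_primitive (cq v))
  (fun a b e => holomorphic_green (dG _)) x (- pi) (2 * pi) mx mpi.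
have -> : - pi + 2 * pi = pi :> R by ring.
have /[swap]/[apply] : 0 < 2 * pi :> R by rewrite mulr_gt0.
have npi : - pi <= pi :> R by rewrite (le_trans _ (ltW pi0))// oppr_le0 ltW.
have xx : x <= x + 2 * pi by rewrite lerDl mulr_ge0// ltW.
rewrite !(Rintegral_itv_split (cp _) (ltW mpi) npi) !(Rintegral_itv_split (cq _) (ltW mx) xx).
have -> : (fun s => Im (G (s +i* pi))) = (fun s => Im (G (s +i* - pi))).
  apply/funext => s; rewrite -[in RHS]per; congr (Im (G _)).
  by apply: cplx_eq; rewrite ?cReD ?cImD /=; ring.
by move/eqP; rewrite subrK subr_eq0 => /eqP.
Qed.

(** The integral against dt, that is 2 pi times the mean value, and not the contour integral against
    dz. *)
Definition circle_int (g : C -> C) (r : R) : C :=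
  (\int[mu]_(t in `[- pi, pi]) Re (g (r%:C * cexp (0 +i* t)))) +i*
  (\int[mu]_(t in `[- pi, pi]) Im (g (r%:C * cexp (0 +i* t)))).

Lemma cexp_polar (x t : R) : cexp (x +i* t) = (expR x)%:C * cexp (0 +i* t).
Proof. by rewrite (_ : x +i* t = x%:C + 0 +i* t) ?cexpD//; apply: cplx_eq; rewrite ?cReM ?cImM ?cReD ?cImD /= ?expR0 ?sin0 ?cos0; ring. Qed.

Lemma cexp_2pi (z : C) : cexp (z + 0 +i* (2 * pi)) = cexp z.
Proof.
rewrite cexpD (_ : cexp (0 +i* _) = 1) ?mulr1//; apply: cplx_eq => /=.
  by rewrite expR0 mul1r mulr2n mulrDl mul1r -mulr2n -[_ *+ 2]add0r cosD2pi cos0.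
by rewrite expR0 mul1r mulr2n mulrDl mul1r -mulr2n -[_ *+ 2]add0r sinD2pi sin0.
Qed.

(** By periodicity the circles of radii e^x and e^{x - 2 pi n} have the same mean, and the latter
    tends to the value at 0 by continuity. Holomorphy off 0 with continuity at 0 is what a
    difference quotient offers, and [cauchy_bound] applies the result to one. *)
Lemma circle_mean_Re (g : C -> C) (x : R) :
  (forall z, z != 0 -> exists D, cderiv g z D) -> ccont g 0 ->
  \int[mu]_(t in `[- pi, pi]) Re (g ((expR x)%:C * cexp (0 +i* t))) = 2 * pi * Re (g 0).
Proof.
move=> dg cg; have pi0 := pi_gt0 R.
pose G z := g (cexp z).
have dG z : exists D, cderiv G z D.
  have [D H] := dg _ (cexp_neq0 z); exists (D * cexp z).
  exact: cderiv_comp (cderiv_cexp z) H.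
have cG z : ccont G z by have [D /cderiv_continuous] := dG z.
have GE : forall y, (fun t => Re (g ((expR y)%:C * cexp (0 +i* t)))) = (fun t => Re (G (y +i* t))).
  by move=> y; apply/funext => t; rewrite -cexp_polar.
have shift n : \int[mu]_(t in `[- pi, pi]) Re (G (x +i* t)) =
    \int[mu]_(t in `[- pi, pi]) Re (G ((x - (2 * pi) *+ n) +i* t)).
  elim: n => [|n ->]; first by rewrite mulr0n subr0.
  have per z : G (z + 0 +i* (2 * pi)) = G z by rewrite /G cexp_2pi.
  by rewrite -(periodic_mean (x - (2 * pi) *+ n.+1) dG per) (_ : x - (2 * pi) *+ n.+1 + 2 * pi = x - (2 * pi) *+ n)// mulrS; ring.
rewrite GE; apply/eqP; rewrite -subr_eq0 -normr_eq0; apply/negPn/negP => N0.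
set I := (X in `|X|) in N0.
have I0 : 0 < `|I| by rewrite lt_def N0 /=.
(* Over an interval of length 2 pi this gives |I| <= |I| / 2. *)
have e0 : 0 < `|I| / (4 * pi) by rewrite divr_gt0// mulr_gt0.
move/continuous_forCP : cg => /(_ _ e0)[dl dl0 H].
have [n nP] : exists n : nat, expR (x - (2 * pi) *+ n) < dl.
  exists (Num.truncn `|x - ln dl|).+1.
  rewrite -[ltRHS](@lnK _ dl) ?posrE// ltr_expR ltrBlDr -ltrBlDl.
  apply: le_lt_trans (ler_norm _) _; apply: lt_le_trans (truncnS_gt _) _.
  rewrite -[leRHS]mulr_natr ler_peMl//; have := pi_ge2 R; lra.
have : `|I| <= `|I| / (4 * pi) * (pi - - pi); last first.
  have F (c p : R) : p != 0 -> c / (4 * p) * (p - - p) = c / 2 by move=> ?; field.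
  rewrite F ?lt0r_neq0//.
  lra.
rewrite {1}/I (shift n) (_ : 2 * pi * Re (g 0) = Re (g 0) * (pi - - pi)); last ring.
have cR : continuous (fun t => Re (G ((x - 2 * pi *+ n) +i* t))).
  by apply: continuous_ReP => t; exact: ccont_vert.
have npi : - pi <= pi :> R by rewrite (le_trans _ (ltW pi0))// oppr_le0 ltW.
rewrite -Rintegral_itv_cst// -RintegralB//; [|exact: integrable_itv_continuous|]; last first.
  by apply: integrable_itv_continuous => t; exact: cvg_cst.
apply: le_Rintegral_itv => //.
  move=> t; exact: (@continuousB R R^o _ _ _ t (cR t) (@cst_continuous _ _ (Re (g 0)) t)).
move=> t; rewrite -cReB; apply: le_trans (Re_le _) _; apply/ltW.
by have := H (cexp ((x - 2 * pi *+ n) +i* t)); rewrite add0r; apply; rewrite nrm_cexp.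
Qed.

Lemma circle_mean (g : C -> C) (r : R) : 0 < r ->
  (forall z, z != 0 -> exists D, cderiv g z D) -> ccont g 0 ->
  circle_int g r = (2 * pi)%:C * g 0.
Proof.
move=> r0 dg cg; rewrite /circle_int -[r]lnK ?posrE//; apply: cplx_eq.
  by rewrite /= circle_mean_Re// cReM /= mul0r subr0.
(* The imaginary part of [g] is the real part of -i g. *)
have := @circle_mean_Re (fun z => - 'i * g z) (ln r).
rewrite cReM /= => E.
rewrite cImM /= mul0r addr0.
have -> : (fun t => Im (g ((expR (ln r))%:C * cexp (0 +i* t)))) =
  (fun t => Re ((- 'i) * g ((expR (ln r))%:C * cexp (0 +i* t)))).
  by apply/funext => t; rewrite cReM /=; ring.
rewrite E; first by ring.
- move=> z /dg[D H]; exists (0 * g z + - 'i * D); apply: cderivM => //; exact: cderiv_cst.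
- by apply: ccontM => //; exact: ccont_cst.
Qed.
End circle_mean.

(** * Cauchy estimates, Taylor remainders and mixed derivatives *)

Section cauchy_estimates.
Variable R : realType.
Local Notation C := R[i].

(** Real and imaginary parts are bounded separately, which turns 2 pi into 4 pi. *)
Lemma nrm_circle_int (g : C -> C) (r M : R) : (forall z, z != 0 -> ccont g z) -> 0 < r ->
  (forall z, nrm z = r -> nrm (g z) <= M) -> nrm (circle_int g r) <= 4 * pi * M.
Proof.
move=> cg r0 H; have pi0 := pi_gt0 R; apply: le_trans (nrm_le _) _ => /=.
have npi : - pi <= pi :> R by rewrite (le_trans _ (ltW pi0))// oppr_le0 ltW.
have nr t : nrm (r%:C * cexp (0 +i* t)) = r.
  by rewrite nrmM nrm_cexp /= expR0 mulr1 expr0n addr0 sqrtr_sqr gtr0_norm.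
have cc t : ccont (fun t : R => g (r%:C * cexp (0 +i* t))) t.
  apply: (ccont_compC (f := fun t : R => r%:C * cexp (0 +i* t))).
    apply: ccontM; first exact: ccont_cst.
    by apply: (ccont_vert (G := @cexp R)); exact: cderiv_continuous (cderiv_cexp _).
  by apply: cg; rewrite -nrm_gt0 nr.
have := le_Rintegral_itv npi (continuous_ReP cc) (fun t => le_trans (Re_le _) (H _ (nr t))).
have := le_Rintegral_itv npi (continuous_ImP cc) (fun t => le_trans (Im_le _) (H _ (nr t))).
lra.
Qed.

(** The difference quotient at [x], completed by [D] at 0, has mean [D] over the unit circle and is
    at most 2M there; the lossy constant of [nrm_circle_int] doubles this to 4M. *)
Lemma cauchy_bound (f : C -> C) x D M : (forall z, exists D, cderiv f z D) ->
  cderiv f x D -> (forall h, nrm h <= 1 -> nrm (f (x + h)) <= M) -> nrm D <= 4 * M.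
Proof.
move=> df fx H; have pi0 := pi_gt0 R; have [p [cp p0 E]] := fx.
have dp z : z != 0 -> exists D, cderiv p z D.
  move=> z0.
  have pE : forall h, h != 0 -> p h = (f (x + h) - f x) / h.
    by move=> h h0; rewrite E [f x + _]addrC addrK mulfK.
  have [D1 H1] := df (x + z).
  have Hsub : cderiv (fun h => f (x + h) - f x) z D1.
    apply/cderiv_epsP => e e0; move/cderiv_epsP : H1 => /(_ _ e0)[dl dl0 H1].
    exists dl => // h hd; rewrite [x + (z + h)]addrA.
    have -> : f (x + z + h) - f x - (f (x + z) - f x) - D1 * h =
      f (x + z + h) - f (x + z) - D1 * h by ring.
    exact: H1.
  have Hinv : cderiv (fun h => h^-1) z (- z ^- 2).
    apply/cderiv_epsP => e e0.
    have : ccont (fun h => - ((z + h) * z)^-1) 0.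
      apply: ccontN; apply: ccontV; first by rewrite addr0 mulf_neq0.
      apply: ccontM; last exact: ccont_cst.
      by apply: ccontD; [exact: ccont_cst|exact: ccont_id].
    move/continuous_forCP => /(_ _ e0)[dl dl0 K].
    have nz0 : 0 < nrm z by rewrite nrm_gt0.
    exists (Num.min dl (nrm z)) => [|h]; first by rewrite lt_min dl0.
    rewrite lt_min => /andP[hd hz]; have := K h hd; rewrite add0r addr0 => /ltW K1.
    have zh0 : z + h != 0.
      by apply: contraTN hz => /eqP zh; rewrite -leNgt -(nrmN h) (_ : - h = z)// -[LHS]add0r -zh addrK.
    have -> : (z + h)^-1 - z^-1 - - z ^- 2 * h = (- ((z + h) * z)^-1 - - (z * z)^-1) * h.
      by field; rewrite zh0 z0.
    by rewrite nrmM ler_wpM2r ?nrm_ge0.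
  have := cderivM Hsub Hinv; set D2 := (X in cderiv _ _ X) => /cderiv_epsP Hq.
  exists D2; apply/cderiv_epsP => e e0; have [dl dl0 K] := Hq _ e0.
  have nz0 : 0 < nrm z by rewrite nrm_gt0.
  exists (Num.min dl (nrm z)) => [|h]; first by rewrite lt_min dl0.
  rewrite lt_min => /andP[hd hz].
  have zh0 : z + h != 0.
    by apply: contraTN hz => /eqP zh; rewrite -leNgt -(nrmN h) (_ : - h = z)// -[LHS]add0r -zh addrK.
  by rewrite !pE//; exact: K.
have := circle_mean ltr01 dp cp; rewrite p0 => CM.
have cpz z : z != 0 -> ccont p z by move=> /dp[D1 /cderiv_continuous].
have := @nrm_circle_int p 1 (2 * M) cpz ltr01 _.
have K z : nrm z = 1 -> nrm (p z) <= 2 * M.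
  move=> z1; have -> : p z = (f (x + z) - f x) / z.
    by rewrite E [f x + _]addrC addrK mulfK// -nrm_gt0 z1.
  rewrite nrmM nrmV z1 invr1 mulr1; apply: le_trans (nrmD _ _) _; rewrite nrmN.
  have := H z; rewrite z1 => /(_ (lexx _)); have := H 0; rewrite nrm0 addr0 => /(_ ler01); lra.
move=> /(_ K); rewrite CM nrmM nrm_real gtr0_norm; last by rewrite mulr_gt0.
have -> : 4 * pi * (2 * M) = 2 * pi * (4 * M) by ring.
by rewrite ler_pM2l// mulr_gt0.
Qed.

(** The mean value theorem is applied to the real and imaginary parts along the segment, whence the
    factor 2. *)
Lemma mvt_cplx (f f' : C -> C) (x h : C) (S : R) : (forall z, cderiv f z (f' z)) ->
  (forall t : R, 0 <= t <= 1 -> nrm (f' (x + t%:C * h)) <= S) ->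
  nrm (f (x + h) - f x) <= 2 * S * nrm h.
Proof.
move=> df H.
have dl (t : R) : is_derive t 1 (fun t : R => Re (f (x + t%:C * h))) (Re (f' (x + t%:C * h) * h)) /\
  is_derive t 1 (fun t : R => Im (f (x + t%:C * h))) (Im (f' (x + t%:C * h) * h)).
  exact/cderiv_line.
have B t : 0 <= t <= 1 -> nrm (f' (x + t%:C * h) * h) <= S * nrm h.
  by move=> /H ?; rewrite nrmM ler_wpM2r ?nrm_ge0.
have := mvt_le ler01 (fun t _ => (dl t).1) (fun t ht => le_trans (Re_le _) (B t ht)).
have := mvt_le ler01 (fun t _ => (dl t).2) (fun t ht => le_trans (Im_le _) (B t ht)).
rewrite !mul1r !mul0r !addr0 !subr0 -cReB -cImB => A1 A2.
by apply: le_trans (nrm_le _) _; lra.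
Qed.

(** [cauchy_bound] for z |-> f(z + h) - f(z), which [mvt_cplx] bounds through f'. The radius 3 is
    spent as 1 for this Cauchy estimate, 1 for the segment of length |h|, and 1 for the Cauchy
    estimate of f'; the constant is 32 = 4 * 2 * 4. *)
Lemma cderiv_lipschitz (f f' : C -> C) x h (M : R) : (forall z, cderiv f z (f' z)) ->
  (forall k, nrm k <= 3 -> nrm (f (x + k)) <= M) -> nrm h <= 1 ->
  nrm (f' (x + h) - f' x) <= 32 * M * nrm h.
Proof.
move=> df H h1.
have ef z : exists D, cderiv f z D by exists (f' z).
have f'M k : nrm k <= 2 -> nrm (f' (x + k)) <= 4 * M.
  move=> k2; apply: (cauchy_bound ef (df _)) => k' k1; rewrite -addrA; apply: H.
  by apply: le_trans (nrmD _ _) _; lra.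
pose k z := f (h + z) + - 1 * f z.
have dk z : cderiv k z (f' (h + z) * (0 + 1) + (0 * f z + - 1 * f' z)).
  apply: cderivD; last by apply: cderivM => //; exact: cderiv_cst.
  apply: (cderiv_comp (f := fun z => h + z)) => //.
  apply: cderivD; [exact: cderiv_cst|exact: cderiv_id].
have ek z : exists D, cderiv k z D by eexists; exact: dk.
have := cauchy_bound ek (dk x).
have -> : f' (h + x) * (0 + 1) + (0 * f x + - 1 * f' x) = f' (x + h) - f' x.
  by rewrite [h + x]addrC; ring.
have -> : 32 * M * nrm h = 4 * (2 * (4 * M) * nrm h) by ring.
apply => k' k1.
have -> : k (x + k') = f (x + k' + h) - f (x + k') by rewrite /k [h + _]addrC; ring.
apply: mvt_cplx => // t /andP[t0 t1]; rewrite -addrA; apply: f'M.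
apply: le_trans (nrmD _ _) _; rewrite nrmM nrm_real ger0_norm//.
have := nrm_ge0 h; nra.
Qed.

(** [mvt_cplx] for z |-> f(z) - f'(x) z, whose derivative is controlled by [cderiv_lipschitz]. *)
Lemma cderiv_taylor (f f' : C -> C) x h (M : R) : (forall z, cderiv f z (f' z)) ->
  (forall k, nrm k <= 3 -> nrm (f (x + k)) <= M) -> nrm h <= 1 ->
  nrm (f (x + h) - f x - f' x * h) <= 64 * M * nrm h ^+ 2.
Proof.
move=> df H h1.
pose k z := f z + - f' x * z.
have dk z : cderiv k z (f' z + - f' x).
  apply: cderivD => //; have := cderivM (cderiv_cst (- f' x) z) (cderiv_id z).
  by rewrite mul0r add0r mulr1.
have -> : f (x + h) - f x - f' x * h = k (x + h) - k x by rewrite /k; ring.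
rewrite expr2 mulrA (_ : 64 * M * nrm h = 2 * (32 * M * nrm h)); last by ring.
apply: (mvt_cplx dk) => t /andP[t0 t1].
have th : nrm (t%:C * h) <= nrm h.
  by rewrite nrmM nrm_real ger0_norm// ler_piMl// nrm_ge0.
apply: le_trans (cderiv_lipschitz df H (le_trans th h1)) _; rewrite ler_wpM2l//.
rewrite mulr_ge0//; apply: le_trans (H 0 _); [exact: nrm_ge0|by rewrite nrm0].
Qed.

(** The lower bounds d k - c i k stay below all the upper bounds d l + c i l, so the supremum of the
    former serves as the limit. *)
Lemma real_limit (d i : nat -> R) (c : R) :
  (forall k l, d k - d l <= c * (i k + i l)) ->
  exists d0, forall k, `|d k - d0| <= c * i k.
Proof.
move=> H; pose A := range (fun k => d k - c * i k).
have ubA l : ubound A (d l + c * i l) by move=> _ [k _ <-]; have := H k l; lra.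
exists (sup A) => k; rewrite ler_norml; apply/andP; split.
  suff : sup A <= d k + c * i k by lra.
  by apply: ge_sup => //; exists (d 0%N - c * i 0%N); exists 0%N.
suff : d k - c * i k <= sup A by lra.
by apply: ub_le_sup; [exists (d 0%N + c * i 0%N); exact: (ubA 0%N)|exists k].
Qed.

(* The difference quotients in the second variable converge locally uniformly,
   hence so do their derivatives in the first one. *)
Lemma cderiv_mixed (B B1 B2 : C -> C -> C) x y (M : R) :
  (forall s t, cderiv (fun s => B s t) s (B1 s t)) ->
  (forall s t, cderiv (B s) t (B2 s t)) ->
  (forall s t, nrm s <= 3 -> nrm t <= 3 -> nrm (B (x + s) (y + t)) <= M) ->
  exists D, cderiv (fun s => B2 s y) x D.
Proof.
move=> d1 d2 bB.
have M0 : 0 <= M by apply: le_trans (bB 0 0 _ _); rewrite ?nrm0 ?nrm_ge0.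
have [i [i0 i1 ilim]] : exists i : nat -> R, [/\ forall n, 0 < i n, forall n, i n <= 1 &
    forall c ep, 0 <= c -> 0 < ep -> exists n, c * i n <= ep].
  exists (fun n => n.+1%:R^-1); split=> [n|n|c ep c0 ep0]; first by rewrite invr_gt0.
    by rewrite invf_le1// ler1n.
  exists (Num.truncn (c / ep)); rewrite ler_pdivrMr// [ep * _]mulrC -ler_pdivrMr//.
  exact/ltW/truncnS_gt.
pose e n : C := (i n)%:C.
have ne n : nrm (e n) = i n by rewrite nrm_real gtr0_norm.
have e0 n : e n != 0 by rewrite -nrm_gt0 ne.
have ne1 n : nrm (e n) <= 1 by rewrite ne.
pose q n s := (e n)^-1 * (B s (y + e n) + - 1 * B s y).
pose q' n s := (e n)^-1 * (B1 s (y + e n) + - 1 * B1 s y).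
have dq n s : cderiv (q n) s (q' n s).
  have := cderivM (cderiv_cst (e n)^-1 s) (cderivD (d1 s (y + e n)) (cderivM (cderiv_cst (- 1) s) (d1 s y))).
  by rewrite !mul0r !add0r.
have qB s n : nrm s <= 3 -> nrm (q n (x + s) - B2 (x + s) y) <= 64 * M * i n.
  move=> s3; have := cderiv_taylor (d2 (x + s)) (fun k hk => bB s k s3 hk) (ne1 n).
  have -> : q n (x + s) - B2 (x + s) y =
     (B (x + s) (y + e n) - B (x + s) y - B2 (x + s) y * e n) / e n.
    have F (u v w c : C) : c != 0 -> c^-1 * (u + - 1 * v) - w = (u - v - w * c) / c by move=> ?; field.
    exact: F.
  by rewrite nrmM nrmV ne => K; rewrite ler_pdivrMr// (le_trans K)// expr2 mulrA.
have B2B s : nrm s <= 3 -> nrm (B2 (x + s) y) <= 4 * M.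
  move=> s3; apply: cauchy_bound (d2 (x + s) y) _ => [z|h h1]; first by eexists; exact: d2.
  by apply: bB => //; lra.
have qC k l : nrm (q' k x - q' l x) <= 256 * M * (i k + i l).
  pose g s := q k s + - 1 * q l s.
  have dg s : cderiv g s (q' k s + - 1 * q' l s).
    have := cderivD (dq k s) (cderivM (cderiv_cst (- 1) s) (dq l s)).
    by rewrite mul0r add0r.
  have := @cauchy_bound g x _ (64 * M * (i k + i l)) (fun z => ex_intro _ _ (dg z)) (dg x).
  rewrite mulN1r mulrA (_ : 4 * (64 * M) = 256 * M); last by ring.
  apply => h h1; have h3 : nrm h <= 3 by lra.
  have -> : g (x + h) = (q k (x + h) - B2 (x + h) y) - (q l (x + h) - B2 (x + h) y).
    by rewrite /g; ring.
  by apply: le_trans (nrmD _ _) _; rewrite nrmN mulrDr lerD// qB.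
have [a aP] : exists a, forall k, `|Re (q' k x) - a| <= 256 * M * i k.
  apply: real_limit => k l; rewrite -cReB.
  by apply: le_trans (qC k l); apply: le_trans (ler_norm _) (Re_le _).
have [b bP] : exists b, forall k, `|Im (q' k x) - b| <= 256 * M * i k.
  apply: real_limit => k l; rewrite -cImB.
  by apply: le_trans (qC k l); apply: le_trans (ler_norm _) (Im_le _).
exists (a +i* b).
(* The quotients [q n] satisfy the Taylor estimate with a constant independent of n; for fixed [h]
   the estimate passes to the limit. *)
have K h : nrm h <= 1 ->
    nrm (B2 (x + h) y - B2 x y - (a +i* b) * h) <= 64 * (68 * M) * nrm h ^+ 2.
  move=> h1; apply/ler_addgt0Pr => ep ep0.
  (* 640 = 64 + 64 + 512: the errors of [qB] at h and at 0, and that of [E3]. *)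
  have [|n nP] := ilim (640 * M) ep _ ep0; first exact: mulr_ge0 (ler0n _ _) M0.
  have qM k : nrm k <= 3 -> nrm (q n (x + k)) <= 68 * M.
    move=> k3; have -> : q n (x + k) = (q n (x + k) - B2 (x + k) y) + B2 (x + k) y by ring.
    apply: le_trans (nrmD _ _) _; have := qB _ n k3; have := B2B _ k3.
    have : 64 * M * i n <= 64 * M by rewrite ler_piMr ?mulr_ge0// -ne ne1.
    lra.
  have T := cderiv_taylor (dq n) qM h1.
  have h3 : nrm h <= 3 by lra.
  have E1 := qB _ n h3; have := qB 0 n; rewrite addr0 nrm0 => /(_ _) E2.
  have {}E2 := E2 (ler0n _ 3).
  have E3 : nrm (q' n x - (a +i* b)) <= 512 * M * i n.
    apply: le_trans (nrm_le _) _; rewrite cReB cImB /=.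
    have := aP n; have := bP n; lra.
  have -> : B2 (x + h) y - B2 x y - (a +i* b) * h =
    (q n (x + h) - q n x - q' n x * h) + (- (q n (x + h) - B2 (x + h) y))
     + (q n x - B2 x y) + (q' n x - (a +i* b)) * h by ring.
  apply: le_trans (nrmD _ _) _; rewrite nrmM.
  have := nrmD (q n (x + h) - q n x - q' n x * h + - (q n (x + h) - B2 (x + h) y)) (q n x - B2 x y).
  have := nrmD (q n (x + h) - q n x - q' n x * h) (- (q n (x + h) - B2 (x + h) y)).
  rewrite nrmN.
  have : nrm (q' n x - (a +i* b)) * nrm h <= 512 * M * i n.
    by rewrite -[leRHS]mulr1; apply: ler_pM => //; exact: nrm_ge0.
  lra.
apply/cderiv_epsP => ep ep0.
have c0 : 0 < 64 * (68 * M) + 1 by rewrite ltr_wpDl// !mulr_ge0.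
exists (Num.min 1 (ep / (64 * (68 * M) + 1))) => [|h]; first by rewrite lt_min ltr01 divr_gt0.
rewrite lt_min ltr_pdivlMr// => /andP[/ltW h1 hd]; apply: le_trans (K _ h1) _.
have := nrm_ge0 h; nra.
Qed.

End cauchy_estimates.

(** * Measurability and invariance of Lebesgue measure *)

Section discrete_approx.
Variable R : realType.

(* [v] is a pointwise limit of maps factoring measurably through [nat]; this
   makes [f \o v] measurable for every continuous [f], without comparing the
   product sigma-algebra of the source with the topology of the target. *)
Definition discrete_approx d (T : measurableType d) (U : topologicalType) (v : T -> U) :=
  exists (c : nat -> T -> nat) (s : nat -> nat -> U),
    (forall n k, measurable (c n @^-1` [set k])) /\
    (forall t, (fun n => s n (c n t)) @ \oo --> v t).

Lemma discrete_approx_measurable d (T : measurableType d) (U : topologicalType)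
    (v : T -> U) (f : U -> R) : discrete_approx v -> continuous f ->
  measurable_fun setT (fun t => f (v t)).
Proof.
move=> [c [s [mc cv]]] cf.
apply: (@measurable_realfun.measurable_fun_cvg _ _ _ _ (fun n t => f (s n (c n t)))).
- move=> n _ Y mY; rewrite setTI.
  have -> : (fun t => f (s n (c n t))) @^-1` Y =
      \bigcup_(k in [set k | Y (f (s n k))]) (c n @^-1` [set k]).
    apply/seteqP; split=> [t Yt|t [k /= Yk ctk]]; first by exists (c n t).
    by rewrite /= ctk.
  exact: bigcup_measurable.
- move=> t _; apply: (@cvg_comp _ _ _ (fun n => s n (c n t)) f) (cf _); exact: cv.
Qed.

Lemma discrete_approx_comp d (T : measurableType d) (U V : topologicalType)
    (v : T -> U) (f : U -> V) : discrete_approx v -> continuous f ->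
  discrete_approx (fun t => f (v t)).
Proof.
move=> [c [s [mc cv]]] cf; exists c, (fun n k => f (s n k)); split=> // t.
by apply: (@cvg_comp _ _ _ (fun n => s n (c n t)) f) (cf _); exact: cv.
Qed.

Lemma discrete_approx_pair d d' (T : measurableType d) (T' : measurableType d')
    (U U' : topologicalType) (v : T -> U) (v' : T' -> U') :
  discrete_approx v -> discrete_approx v' ->
  discrete_approx (fun t : T * T' => (v t.1, v' t.2)).
Proof.
move=> [c [s [mc cv]]] [c' [s' [mc' cv']]].
(* The default serves numbers that decode to nothing. Whether [k] is really a code is tested by
   [pickle (dec k) == k]; otherwise its fibre is empty. *)
pose dec k : nat * nat := odflt (0%N, 0%N) (unpickle k).
exists (fun n t => pickle (c n t.1, c' n t.2)), (fun n k => (s n (dec k).1, s' n (dec k).2)).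
split=> [n k|t]; last first.
  rewrite /dec; under eq_fun do rewrite pickleK /=.
  exact: (@cvg_pair _ _ _ _ (nbhs (v t.1)) (nbhs (v' t.2)) _ _ _ (fun n => s n (c n t.1)) (fun n => s' n (c' n t.2)) (cv t.1) (cv' t.2)).
have -> : (fun t : T * T' => pickle (c n t.1, c' n t.2)) @^-1` [set k] =
  if pickle (dec k) == k then (c n @^-1` [set (dec k).1]) `*` (c' n @^-1` [set (dec k).2])
  else set0.
  case: eqP => [E|E]; apply/seteqP; split=> // t /=.
  - by move=> <-; rewrite /dec pickleK.
  - by case=> -> ->; rewrite -surjective_pairing.
  - by move=> tk; apply: E; rewrite -tk /dec pickleK.
by case: ifP => _; [exact: measurableX|exact: measurable0].
Qed.

Lemma discrete_approx_real : discrete_approx (fun x : measurableTypeR R => x : R).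
Proof.
pose dec k : int := odflt 0 (unpickle k).
exists (fun n x => pickle (Num.floor (n.+1%:R * x))), (fun n k => (dec k)%:~R / n.+1%:R).
have pn n : 0 < n.+1%:R :> R by rewrite ltr0n.
split=> [n k|t].
  have -> : (fun x : measurableTypeR R => pickle (Num.floor (n.+1%:R * x))) @^-1` [set k] =
    if pickle (dec k) == k then `[(dec k)%:~R / n.+1%:R, (dec k + 1)%:~R / n.+1%:R[%classic else set0.
    case: eqP => [E|E]; apply/seteqP; split=> // t /=.
    - move=> <-; rewrite /dec pickleK/= in_itv/= ler_pdivrMr// ltr_pdivlMr// [t * _]mulrC.
      exact: floor_itv.
    - rewrite in_itv/= ler_pdivrMr// ltr_pdivlMr// [t * _]mulrC => H.
      by rewrite -E; congr pickle; exact: floor_def.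
    - by move=> tk; apply: E; rewrite -tk /dec pickleK.
  by case: ifP => _; [exact: measurable_itv|exact: measurable0].
rewrite /dec; under eq_fun do rewrite pickleK /=.
apply/cvgrPdist_le => e e0; near=> n.
have /andP[fl fu] := floor_itv (n.+1%:R * t).
rewrite ler_norml; apply/andP; split.
  rewrite lerBrDl -lerBrDr ler_pdivrMr// opprK; apply: le_trans fl _.
  by rewrite mulrC ler_wpM2r// lerDl ltW.
rewrite lerBlDr -lerBlDl ler_pdivlMr//.
move: fu; rewrite intrD mulrBl [t * _]mulrC => /ltW fu.
have : 1 <= e * n.+1%:R; last lra.
rewrite mulrC -ler_pdivrMr//; near: n.
exists (Num.truncn (1 / e)) => // n /= nn; apply/ltW.
by apply: lt_le_trans (truncnS_gt _) _; rewrite ler_nat.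
Unshelve. all: by end_near. Qed.

Lemma discrete_approx_row d (T : measurableType d) (v : T -> R[i]) n :
  discrete_approx v ->
  discrete_approx (fun t : n.-tuple T => \row_j v (tnth t j)).
Proof.
move=> [c [s [mc cv]]].
pose dec k : n.-tuple nat := odflt [tuple 0%N | i < n] (unpickle k).
exists (fun m t => pickle [tuple c m (tnth t i) | i < n]),
  (fun m k => \row_j s m (tnth (dec k) j)); split=> [m k|t].
  have -> : (fun t : n.-tuple T => pickle [tuple c m (tnth t i) | i < n]) @^-1` [set k] =
    if pickle (dec k) == k then \bigcap_(i in [set: 'I_n]) ((fun t => tnth t i) @^-1` (c m @^-1` [set tnth (dec k) i]))
    else set0.
    case: eqP => [E|E]; apply/seteqP; split=> // t /=.
    - by move=> <- i _ /=; rewrite /dec pickleK/= tnth_mktuple.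
    - move=> H; rewrite -E; congr pickle; apply: eq_from_tnth => i.
      by rewrite tnth_mktuple; exact: (H i I).
    - by move=> tk; apply: E; rewrite -tk /dec pickleK.
  case: ifP => _; last exact: measurable0.
  rewrite -[X in measurable X]setCK setC_bigcap; apply: measurableC.
  apply: countable_bigcupT_measurable => // i; apply: measurableC.
  by have := measurable_tnth i measurableT (mc m (tnth (dec k) i)); rewrite setTI.
move=> A /nbhs_rVP[e e0 eA].
have H (j : 'I_n) : \forall m \near \oo, nrm (s m (c m (tnth t j)) - v (tnth t j)) < e.
  have /cv : nbhs (v (tnth t j)) [set z | nrm (z - v (tnth t j)) < e].
    by apply/nbhsCP; exists e.
  by [].
have {}H : \forall m \near \oo, forall j : 'I_n, nrm (s m (c m (tnth t j)) - v (tnth t j)) < e.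
  exact: filter_forall.
by apply: filterS H => m Hm; apply: eA => j; rewrite /= !mxE /dec pickleK /= tnth_mktuple.
Qed.
End discrete_approx.

(** * Measure-preserving maps: translations, shears and rotations *)

Section preserves.
Variable R : realType.

(** Stated on integrals of nonnegative functions rather than on sets, so that Tonelli's theorem
    carries it from factors to products. *)
Definition preserves d (T : measurableType d) (mu : {measure set T -> \bar R}) (phi : T -> T) :=
  measurable_fun setT phi /\
  forall g : T -> \bar R, measurable_fun setT g -> (forall x, 0 <= g x)%E ->
    (\int[mu]_x g (phi x) = \int[mu]_x g x)%E.

Lemma preserves_comp d (T : measurableType d) (mu : {measure set T -> \bar R}) phi psi :
  preserves mu phi -> preserves mu psi -> preserves mu (phi \o psi).
Proof.
move=> [mp ip] [mq iq]; split; first exact: measurableT_comp.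
move=> g mg g0; have mgp : measurable_fun setT (g \o phi) by exact: measurableT_comp.
have g0p x : (0 <= (g \o phi) x)%E by exact: g0.
by rewrite (iq _ mgp g0p); exact: ip.
Qed.

Lemma preserves_ext d (T : measurableType d) (mu : {measure set T -> \bar R}) phi psi :
  phi =1 psi -> preserves mu phi -> preserves mu psi.
Proof. by move=> /funext ->. Qed.

Section prod.
Context d1 d2 (T1 : measurableType d1) (T2 : measurableType d2).
Variables (m1 : {sigma_finite_measure set T1 -> \bar R})
  (m2 : {sigma_finite_measure set T2 -> \bar R}).

(** The map of one coordinate may depend on the other: this is what makes shears preserve the
    measure once translations do. *)
Lemma preserves_fiber1 (f : T2 -> T1 -> T1) :
  measurable_fun setT (fun p : T1 * T2 => f p.2 p.1) ->
  (forall y, preserves m1 (f y)) -> preserves (prod_measure m1 m2) (fun p => (f p.2 p.1, p.2)).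
Proof.
move=> mf fP.
have mphi : measurable_fun setT (fun p : T1 * T2 => (f p.2 p.1, p.2)).
  by apply: measurable_fun_pair => //; exact: measurable_snd.
split=> // g mg g0; rewrite /prod_measure !fubini_tonelli2//; last exact: (measurableT_comp mg).
apply: eq_integral => y _; rewrite /fubini_G /= ((fP y).2 (fun x => g (x, y)))//.
by apply: (measurableT_comp mg); exact: measurable_fun_pair.
Qed.

Lemma preserves_fiber2 (f : T1 -> T2 -> T2) :
  measurable_fun setT (fun p : T1 * T2 => f p.1 p.2) ->
  (forall x, preserves m2 (f x)) -> preserves (prod_measure m1 m2) (fun p => (p.1, f p.1 p.2)).
Proof.
move=> mf fP.
have mphi : measurable_fun setT (fun p : T1 * T2 => (p.1, f p.1 p.2)).
  by apply: measurable_fun_pair => //; exact: measurable_fst.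
split=> // g mg g0; rewrite /prod_measure !fubini_tonelli1//; last exact: (measurableT_comp mg).
apply: eq_integral => x _; rewrite /fubini_F /= ((fP x).2 (fun y => g (x, y)))//.
by apply: (measurableT_comp mg); exact: measurable_fun_pair.
Qed.

Lemma preserves_prod (f1 : T1 -> T1) (f2 : T2 -> T2) :
  preserves m1 f1 -> preserves m2 f2 ->
  preserves (prod_measure m1 m2) (fun p => (f1 p.1, f2 p.2)).
Proof.
move=> p1 p2; apply: (@preserves_comp _ _ _ (fun p => (f1 p.1, p.2)) (fun p => (p.1, f2 p.2))).
  apply: (@preserves_fiber1 (fun=> f1)) => //.
  exact: (measurableT_comp p1.1 measurable_fst).
apply: (@preserves_fiber2 (fun=> f2)) => //.
exact: (measurableT_comp p2.1 measurable_snd).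
Qed.
End prod.

Section tuple.
Context d (T : measurableType d) (mu : {sigma_finite_measure set T -> \bar R}).

Lemma ge0_integral_tuple0 (g : 0.-tuple T -> \bar R) : measurable_fun setT g ->
  (\int[tuple_measure mu 0]_t g t = g [tuple])%E.
Proof. by move=> mg; rewrite /= integral_dirac// diracT mul1e. Qed.

Lemma ge0_integral_tupleS n (g : n.+1.-tuple T -> \bar R) : measurable_fun setT g ->
  (forall t, 0 <= g t)%E ->
  (\int[tuple_measure mu n.+1]_t g t =
   \int[mu]_x \int[tuple_measure mu n]_t g (pair_cons (x, t)))%E.
Proof.
move=> mg g0; rewrite /= /cons_measure ge0_integral_pushforward//; last exact: measurable_pair_cons.
rewrite preimage_setT /prod_measure fubini_tonelli1//; last by move=> x; exact: g0.
by apply: measurableT_comp => //; exact: measurable_pair_cons.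
Qed.

Lemma measurable_pair_cons2 n (x : T) : measurable_fun setT (fun t : n.-tuple T => pair_cons (x, t)).
Proof.
apply: (measurableT_comp (@measurable_pair_cons _ T n)).
by apply: measurable_fun_pair => //; exact: measurable_id.
Qed.

Definition tuple_map n (phi : 'I_n -> T -> T) (t : n.-tuple T) : n.-tuple T :=
  [tuple phi i (tnth t i) | i < n].

Lemma tuple_map_cons n (phi : 'I_n.+1 -> T -> T) x (t : n.-tuple T) :
  tuple_map phi (pair_cons (x, t)) =
  pair_cons (phi ord0 x, tuple_map (fun i => phi (lift ord0 i)) t).
Proof.
apply: eq_from_tnth => i; rewrite tnth_mktuple.
case: (unliftP ord0 i) => [j ->|->]; last by rewrite !(tnth_nth x).
by rewrite /pair_cons !tnthS tnth_mktuple.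
Qed.

Lemma preserves_tuple n (phi : 'I_n -> T -> T) : (forall i, preserves mu (phi i)) ->
  preserves (tuple_measure mu n) (tuple_map phi).
Proof.
move=> phiP.
have mtm m (f : 'I_m -> T -> T) : (forall i, measurable_fun setT (f i)) ->
    measurable_fun setT (tuple_map f).
  move=> mf; apply/measurable_fun_tnthP => i.
  rewrite [X in measurable_fun _ X](_ : _ = f i \o (fun t => tnth t i)); last first.
    by apply/funext => t /=; rewrite tnth_mktuple.
  by apply: measurableT_comp => //; exact: measurable_tnth.
split; first by apply: mtm => i; case: (phiP i).
elim: n phi phiP => [|n IH] phi phiP g mg g0.
  by congr integral; apply/funext => t; congr g; rewrite [LHS]tuple0 [RHS]tuple0.
have mgt : measurable_fun setT (fun t => g (tuple_map phi t)).
  by apply: measurableT_comp => //; apply: mtm => i; case: (phiP i).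
rewrite !ge0_integral_tupleS//.
transitivity (\int[mu]_x \int[tuple_measure mu n]_t g (pair_cons (phi ord0 x, t)))%E.
  apply: eq_integral => x _.
  under eq_integral do rewrite tuple_map_cons.
  rewrite (IH (fun i => phi (lift ord0 i)) _ (fun t => g (pair_cons (phi ord0 x, t))))//.
  by apply: measurableT_comp => //; exact: measurable_pair_cons2.
rewrite ((phiP ord0).2 (fun x => \int[tuple_measure mu n]_t g (pair_cons (x, t)))%E)//.
  apply: (@measurable_fun_fubini_tonelli_F _ _ _ _ _ (tuple_measure mu n) (fun p => g (pair_cons p))) => //.
  by apply: measurableT_comp => //; exact: measurable_pair_cons.
by move=> x; exact: integral_ge0.
Qed.

Lemma measurable_prod_tuple n (h : T -> R) : measurable_fun setT h ->
  measurable_fun setT (fun t : n.-tuple T => \prod_(i < n) h (tnth t i)).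
Proof.
move=> mh; apply: measurable_prod => i _.
by apply: (measurableT_comp mh); exact: measurable_tnth.
Qed.

Lemma integral_prod_tuple n (h : T -> R) (c : R) : measurable_fun setT h ->
  (forall x, 0 <= h x) -> (\int[mu]_x (h x)%:E = c%:E)%E ->
  (\int[tuple_measure mu n]_t (\prod_(i < n) h (tnth t i))%:E = (c ^+ n)%:E)%E.
Proof.
move=> mh h0 hc; elim: n => [|n IH].
  rewrite ge0_integral_tuple0; first by rewrite big_ord0 expr0.
  by apply/measurable_EFinP; exact: measurable_prod_tuple.
rewrite ge0_integral_tupleS; last 2 first.
- by apply/measurable_EFinP; exact: measurable_prod_tuple.
- by move=> t; rewrite lee_fin prodr_ge0.
transitivity (\int[mu]_x ((h x)%:E * (c ^+ n)%:E))%E; last first.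
  have c0 : 0 <= c by rewrite -lee_fin -hc integral_ge0// => x _; rewrite lee_fin.
  rewrite ge0_integralZr//=; first by rewrite hc -EFinM -exprS.
  - exact/measurable_EFinP.
  - by move=> x _; rewrite lee_fin.
  - by rewrite lee_fin exprn_ge0.
apply: eq_integral => x _; rewrite -IH -ge0_integralZl//=; last 3 first.
- by apply/measurable_EFinP; exact: measurable_prod_tuple.
- by move=> t _; rewrite lee_fin prodr_ge0.
- by rewrite lee_fin.
apply: eq_integral => t _; rewrite -EFinM big_ord_recl; congr (_ * _)%:E.
by apply: eq_bigr => i _; rewrite tnthS.
Qed.
End tuple.

Section plane.
Local Notation mu := (@lebesgue_measure R).
Local Notation T := (measurableTypeR R * measurableTypeR R)%type.

Lemma preserves_translation (c : R) : preserves mu (fun x => x + c).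
Proof.
have m1 : measurable_fun [set: measurableTypeR R] ((fun x : R => x + c) : measurableTypeR R -> measurableTypeR R).
  by apply: measurable_funD => //; exact: measurable_cst.
split=> // g mg g0.
pose nu : {measure set (measurableTypeR R) -> \bar R} :=
  (measure_function_pushforward__canonical__measure_function_Measure mu m1).
have E : forall A, measurable A -> mu A = nu A.
  move=> A; apply: (@lebesgue_measure_unique R nu) => _ [[a b] _ <-] /=.
  rewrite /pushforward (_ : _ @^-1` _ = `]a - c, b - c]%classic); last first.
    by apply/seteqP; split => x /=; rewrite !in_itv /= ltrBlDr lerBrDr.
  by rewrite !lebesgue_measure_itv /= !lte_fin ltrD2r; case: ifP => // _; congr EFin; ring.
rewrite [RHS](eq_measure_integral nu); last by move=> A mA _; exact: E.
by rewrite /nu /= ge0_integral_pushforward// preimage_setT.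
Qed.

Lemma preserves_translationC (v : T) : preserves (@lebesgueC R) (fun p => (p.1 + v.1, p.2 + v.2)).
Proof.
by apply: (@preserves_prod _ _ _ _ mu mu (fun x => x + v.1) (fun y => y + v.2));
  exact: preserves_translation.
Qed.

Lemma preserves_shear1 (c : R) : preserves (@lebesgueC R) (fun p => (p.1 + c * p.2, p.2)).
Proof.
apply: (@preserves_fiber1 _ _ _ _ mu mu (fun y x => x + c * y)) => [|y].
  apply: measurable_funD; first exact: measurable_fst.
  by apply: measurable_funM; [exact: measurable_cst|exact: measurable_snd].
exact: preserves_translation.
Qed.
Lemma preserves_shear2 (c : R) : preserves (@lebesgueC R) (fun p => (p.1, p.2 + c * p.1)).
Proof.
apply: (@preserves_fiber2 _ _ _ _ mu mu (fun x y => y + c * x)) => [|y].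
  apply: measurable_funD; first exact: measurable_snd.
  by apply: measurable_funM; [exact: measurable_cst|exact: measurable_fst].
exact: preserves_translation.
Qed.

Definition plane_rot (c s : R) (p : T) : T := (c * p.1 - s * p.2, s * p.1 + c * p.2).

(* A product of three shears, hence the restriction on the angle. *)
Lemma preserves_rot_half (c s : R) : c ^+ 2 + s ^+ 2 = 1 -> 0 <= c ->
  preserves (@lebesgueC R) (plane_rot c s).
Proof.
move=> cs c0; have c1 : 1 + c != 0 by rewrite gt_eqF// ltr_pwDl.
(* [k] is -tan(theta / 2) for the rotation by theta. *)
pose k := - (s / (1 + c)).
apply: preserves_ext (preserves_comp (preserves_shear1 k)
  (preserves_comp (preserves_shear2 s) (preserves_shear1 k))) => -[x y].
have E1 : 1 + k * s = c.
  have -> : 1 + k * s = (1 + c - s ^+ 2) / (1 + c) by rewrite /k; field.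
  have -> : s ^+ 2 = 1 - c ^+ 2 by rewrite -cs; ring.
  by field.
have E2 : k + k * c = - s by rewrite /k; field.
rewrite /plane_rot /=; congr pair.
  have -> : x + k * y + k * (y + s * (x + k * y)) = (1 + k * s) * x + (k + k * (1 + k * s)) * y by ring.
  by rewrite E1 E2; ring.
have -> : y + s * (x + k * y) = s * x + (1 + k * s) * y by ring.
by rewrite E1.
Qed.

(** The half angle has nonnegative cosine, and the rotation by the half angle is applied twice. *)
Lemma preserves_rot (t : R) : `|t| <= pi -> preserves (@lebesgueC R) (plane_rot (cos t) (sin t)).
Proof.
move=> tpi; have H : 0 <= cos (t / 2).
  apply: cos_ge0_pihalf; move: tpi; rewrite ler_norml => /andP[? ?].
  by apply/andP; split; lra.
have P := preserves_rot_half (cos2Dsin2 (t / 2)) H.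
apply: preserves_ext (preserves_comp P P) => -[x y].
have E : t = t / 2 + t / 2 by field.
by rewrite [in RHS]E cosD sinD /plane_rot /=; congr pair; ring.
Qed.
End plane.
End preserves.

Section preserves_integral.
Context (R : realType) d (T : measurableType d) (mu : {measure set T -> \bar R}) (phi : T -> T).
Hypothesis pphi : preserves mu phi.

Lemma preserves_integral (g : T -> \bar R) : measurable_fun setT g ->
  (\int[mu]_x g (phi x) = \int[mu]_x g x)%E.
Proof.
move=> mg; rewrite integralE [RHS]integralE.
rewrite -[fun x => g (phi x)]/(g \o phi) funepos_comp funeneg_comp.
by congr (_ - _)%E; apply: pphi.2 => //; [exact: measurable_funepos|exact: measurable_funeneg].
Qed.

Lemma preserves_integrable (g : T -> \bar R) : mu.-integrable setT g ->
  mu.-integrable setT (fun x => g (phi x)).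
Proof.
move=> /integrableP[mg ig]; apply/integrableP; split.
  by apply: measurableT_comp => //; case: pphi.
rewrite (pphi.2 (fun x => `|g x|)%E)//; exact: measurableT_comp.
Qed.
End preserves_integral.

(** * Integration over [C^d] *)

Section vec.
Variables (R : realType) (d : nat).
Local Notation C := R[i].
Local Notation T := (measurableTypeR R * measurableTypeR R)%type.
Local Notation V := 'rV[C]_d.
Local Notation L := (@lebesgueCd R d).
Local Notation vec := (@vec_of_tuple R d).

Lemma discrete_approx_vec : discrete_approx (vec : d.-tuple T -> V).
Proof.
have H : discrete_approx (fun p : T => p.1 +i* p.2).
  apply: (discrete_approx_comp (v := fun p : T => (p.1 : R, p.2 : R)) (f := fun p : R * R => p.1 +i* p.2)).
    exact: discrete_approx_pair (discrete_approx_real R) (discrete_approx_real R).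
  by move=> p; apply: continuous_mkC; [exact: cvg_fst|exact: cvg_snd].
exact: discrete_approx_row H.
Qed.

Lemma measurable_vec (f : V -> R) : continuous f -> measurable_fun setT (fun t => f (vec t)).
Proof. exact: discrete_approx_measurable discrete_approx_vec. Qed.

Lemma measurable_vec2 (f : V * V -> R) : continuous f ->
  measurable_fun setT (fun p : d.-tuple T * d.-tuple T => f (vec p.1, vec p.2)).
Proof.
exact: discrete_approx_measurable (discrete_approx_pair discrete_approx_vec discrete_approx_vec).
Qed.

Lemma measurable_vecR (f : R * V -> R) : continuous f ->
  measurable_fun setT (fun p : measurableTypeR R * d.-tuple T => f (p.1 : R, vec p.2)).
Proof.
exact: discrete_approx_measurable (discrete_approx_pair (discrete_approx_real R) discrete_approx_vec).
Qed.

Definition translate (v : V) : d.-tuple T -> d.-tuple T :=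
  tuple_map (fun (i : 'I_d) (p : T) => (p.1 + Re (v 0 i), p.2 + Im (v 0 i)) : T).

Lemma vec_translate v t : vec (translate v t) = vec t + v.
Proof.
apply/rowP => j; rewrite !mxE tnth_mktuple; apply: cplx_eq; rewrite ?cReD ?cImD //.
Qed.

Lemma preserves_translate v : preserves L (translate v).
Proof. by apply: preserves_tuple => i; exact: (preserves_translationC (Re (v 0 i), Im (v 0 i))). Qed.

Definition rotate (t : R) : d.-tuple T -> d.-tuple T :=
  tuple_map (fun _ : 'I_d => plane_rot (cos t) (sin t)).

Lemma cexp_i (t : R) : cexp (0 +i* t) = cos t +i* sin t.
Proof. by apply: cplx_eq; rewrite /= expR0 mul1r. Qed.

Lemma vec_rotate a t : vec (rotate a t) = cexp (0 +i* a) *: vec t.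
Proof.
apply/rowP => j; rewrite !mxE tnth_mktuple cexp_i.
by apply: cplx_eq; rewrite ?cReM ?cImM /=; ring.
Qed.

Lemma preserves_rotate a : `|a| <= pi -> preserves L (rotate a).
Proof. by move=> api; apply: preserves_tuple => i; exact: preserves_rot. Qed.

Lemma integral_plane (h : R -> R) (c : R) : measurable_fun setT h -> (forall x, 0 <= h x) ->
  (\int[@lebesgue_measure R]_x (h x)%:E = c%:E)%E ->
  (\int[@lebesgueC R]_p (h p.1 * h p.2)%:E = (c ^+ 2)%:E)%E.
Proof.
move=> mh h0 hc; rewrite /lebesgueC /= /prod_measure fubini_tonelli1/=; last 2 first.
- apply/measurable_EFinP; apply: measurable_funM.
    exact: (measurableT_comp mh measurable_fst).
  exact: (measurableT_comp mh measurable_snd).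
- by move=> x; rewrite lee_fin mulr_ge0.
have c0 : 0 <= c by rewrite -lee_fin -hc integral_ge0// => x _; rewrite lee_fin.
transitivity (\int[@lebesgue_measure R]_x ((h x)%:E * c%:E))%E.
  apply: eq_integral => x _; rewrite /fubini_F -hc -ge0_integralZl//.
  - by apply/measurable_EFinP.
  - by move=> ? _; rewrite lee_fin.
  - by rewrite lee_fin.
rewrite ge0_integralZr//; first by rewrite hc -EFinM expr2.
- by apply/measurable_EFinP.
- by move=> ? _; rewrite lee_fin.
Qed.

Lemma integral_vec (h : R -> R) (c : R) : measurable_fun setT h -> (forall x, 0 <= h x) ->
  (\int[@lebesgue_measure R]_x (h x)%:E = c%:E)%E ->
  (\int[L]_t (\prod_(j < d) (h (Re (vec t 0 j)) * h (Im (vec t 0 j))))%:E = ((c ^+ 2) ^+ d)%:E)%E.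
Proof.
move=> mh h0 hc; have := integral_plane mh h0 hc.
move/(@integral_prod_tuple R _ _ (@lebesgueC R) d (fun p => h p.1 * h p.2)) => <-.
- apply: eq_integral => t _; congr EFin; apply: eq_bigr => j _; by rewrite !mxE.
- apply: measurable_funM.
    exact: (measurableT_comp mh measurable_fst).
  exact: (measurableT_comp mh measurable_snd).
- by move=> p; rewrite mulr_ge0.
Qed.

Lemma sqnormE (z : V) : sqnorm z = \sum_j (Re (z 0 j) ^+ 2 + Im (z 0 j) ^+ 2).
Proof. by apply: eq_bigr => j _; rewrite nrm_sqr. Qed.

Lemma integral_gauss_vec : (\int[L]_t (expR (- sqnorm (vec t)))%:E = (pi ^+ d)%:E)%E.
Proof.
have := @integral_vec gauss_fun (Num.sqrt pi) (@measurable_gauss_fun R) (@gauss_fun_ge0 R) (@integralT_gauss R).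
rewrite sqr_sqrtr ?pi_ge0// => <-; apply: eq_integral => t _; congr EFin.
rewrite sqnormE -sumrN expR_sum; apply: eq_bigr => j _.
by rewrite /gauss_fun -expRD opprD.
Qed.

(** A product of factors 1 / (1 + x^2) over the 2d real coordinates. It stands in for a negative
    power of <z>, and being a product it has the explicit integral pi^{2d}. *)
Definition decay (z : V) : R :=
  \prod_(j < d) ((oneDsqr (Re (z 0 j)))^-1 * (oneDsqr (Im (z 0 j)))^-1).

Lemma decay_ge0 z : 0 <= decay z.
Proof. by apply: prodr_ge0 => j _; rewrite mulr_ge0 ?invr_ge0. Qed.

Lemma integral_oneDsqrV : (\int[@lebesgue_measure R]_x ((oneDsqr x)^-1)%:E = pi%:E)%E.
Proof.
rewrite ge0_symfun_integralT//=.
- rewrite (_ : [set x | _] = `[0, +oo[%classic); last first.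
    by apply/seteqP; split => x/=; rewrite in_itv/= andbT.
  by rewrite integral0y_oneDsqr -EFinM mulrCA divff// mulr1.
- exact: continuous_oneDsqrV.
- by move=> x; rewrite /= /oneDsqr sqrrN.
Qed.

Lemma integral_decay : (\int[L]_t (decay (vec t))%:E = ((pi ^+ 2) ^+ d)%:E)%E.
Proof.
apply: (@integral_vec (fun x => (oneDsqr x)^-1)) integral_oneDsqrV.
- by apply: continuous_measurable_fun; exact: continuous_oneDsqrV.
- by move=> x; rewrite invr_ge0.
Qed.

(** Each of the 2d factors 1 + x^2 is at most 1 + |z|^2. Through this lemma polynomial decay of
    order 2d in 1 + |z|^2 becomes a bound by [decay]. *)
Lemma decay_ge z : (1 + sqnorm z) ^- (2 * d) <= decay z.
Proof.
have s0 : 0 < 1 + sqnorm z by rewrite ltr_wpDr// sumr_ge0// => j _; rewrite sqr_ge0.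
rewrite /decay exprM -exprVn.
have -> : ((1 + sqnorm z) ^+ 2)^-1 ^+ d = \prod_(j < d) ((1 + sqnorm z) ^+ 2)^-1.
  by rewrite prodr_const card_ord.
apply: ler_prod => j _; rewrite invr_ge0 sqr_ge0 /= expr2 invfM.
have le1 : oneDsqr (Re (z 0 j)) <= 1 + sqnorm z /\ oneDsqr (Im (z 0 j)) <= 1 + sqnorm z.
  rewrite /oneDsqr !lerD2l sqnormE (bigD1 j)//=.
  have : 0 <= \sum_(i < d | i != j) (Re (z 0 i) ^+ 2 + Im (z 0 i) ^+ 2).
    by apply: sumr_ge0 => i _; rewrite addr_ge0 ?sqr_ge0.
  have := sqr_ge0 (Re (z 0 j)); have := sqr_ge0 (Im (z 0 j)).
  by split; lra.
have p1 x : 0 < oneDsqr x by apply: lt_le_trans (oneDsqr_ge1 x).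
apply: ler_pM; [by rewrite invr_ge0 ltW|by rewrite invr_ge0 ltW|by rewrite lef_pV2 ?posrE// le1.1|by rewrite lef_pV2 ?posrE// le1.2].
Qed.
End vec.

(** * Rules of continuity *)

Record rcont (R : realType) (T : topologicalType) (f : T -> R) (t : T) : Prop :=
  RCont { rcontP : {for t, continuous f} }.

Section continuity_rules.
Variables (R : realType) (T : topologicalType).
Implicit Types (f g : T -> R) (h k : T -> R[i]) (t : T).

Lemma rcont_cst (c : R) t : rcont (fun _ : T => c) t.
Proof. by split; exact: cvg_cst. Qed.
Lemma rcontD f g t : rcont f t -> rcont g t -> rcont (fun t => f t + g t) t.
Proof. exact (fun cf cg => RCont (@continuousD R R^o T f g t (rcontP cf) (rcontP cg))). Qed.
Lemma rcontN f t : rcont f t -> rcont (fun t => - f t) t.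
Proof. exact (fun cf => RCont (@continuousN R R^o T f t (rcontP cf))). Qed.
Lemma rcontM f g t : rcont f t -> rcont g t -> rcont (fun t => f t * g t) t.
Proof. exact (fun cf cg => RCont (@continuousM R T f g t (rcontP cf) (rcontP cg))). Qed.
Lemma rcont_comp (e : R -> R) f t : rcont f t -> {for f t, continuous e} -> rcont (fun t => e (f t)) t.
Proof. by move=> [cf] ce; split; exact: continuous_comp. Qed.
Lemma rcont_compT (U : topologicalType) (e : U -> R) (u : T -> U) t :
  {for t, continuous u} -> rcont e (u t) -> rcont (fun t => e (u t)) t.
Proof. by move=> cu [ce]; split; exact: continuous_comp. Qed.
Lemma rcont_Re h t : ccont h t -> rcont (fun t => Re (h t)) t.
Proof. by move=> [ch]; split; apply: continuous_comp => //; exact: continuous_Re. Qed.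
Lemma rcont_Im h t : ccont h t -> rcont (fun t => Im (h t)) t.
Proof. by move=> [ch]; split; apply: continuous_comp => //; exact: continuous_Im. Qed.
Lemma rcont_nrm h t : ccont h t -> rcont (fun t => nrm (h t)) t.
Proof. by move=> [ch]; split; apply: continuous_comp => //; exact: continuous_nrm. Qed.
Lemma rcont_expR f t : rcont f t -> rcont (fun t => expR (f t)) t.
Proof. by move=> cf; apply: rcont_comp => //; exact: continuous_expR. Qed.
Lemma rcont_sum n (f : 'I_n -> T -> R) t : (forall i, rcont (f i) t) -> rcont (fun t => \sum_i f i t) t.
Proof.
elim: n f => [|n IH] f cf.
  by rewrite (_ : (fun _ => _) = (fun=> 0)); [exact: rcont_cst|apply/funext => x; rewrite big_ord0].
rewrite (_ : (fun _ => _) = (fun t => f ord0 t + \sum_i f (lift ord0 i) t)); last first.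
  by apply/funext => x; rewrite big_ord_recl.
by apply: rcontD => //; exact: IH.
Qed.
Lemma ccont_sum n (h : 'I_n -> T -> R[i]) t : (forall i, ccont (h i) t) -> ccont (fun t => \sum_i h i t) t.
Proof.
elim: n h => [|n IH] h cf.
  by rewrite (_ : (fun _ => _) = (fun=> 0)); [exact: ccont_cst|apply/funext => x; rewrite big_ord0].
rewrite (_ : (fun _ => _) = (fun t => h ord0 t + \sum_i h (lift ord0 i) t)); last first.
  by apply/funext => x; rewrite big_ord_recl.
by apply: ccontD => //; exact: IH.
Qed.
Lemma ccont_real f t : rcont f t -> ccont (fun t => (f t)%:C) t.
Proof. by move=> [cf]; apply: ccont_comp cf _; split; exact: continuous_real. Qed.
Lemma ccont_conj h t : ccont h t -> ccont (fun t => conjc (h t)) t.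
Proof. by move=> ch; apply: ccont_compC => //; split; exact: continuous_conjc. Qed.
Lemma ccont_cexp h t : ccont h t -> ccont (fun t => cexp (h t)) t.
Proof. by move=> ch; apply: ccont_compC => //; exact: cderiv_continuous (cderiv_cexp _). Qed.
Lemma ccont_coord d (u : T -> 'rV[R[i]]_d) j t : {for t, continuous u} -> ccont (fun t => u t 0 j) t.
Proof.
move=> cu; apply: (ccont_comp (g := fun v : 'rV[R[i]]_d => v 0 j)) => //; split.
exact: coord_continuous.
Qed.
Lemma rcont_sqnorm d (u : T -> 'rV[R[i]]_d) t : {for t, continuous u} -> rcont (fun t => sqnorm (u t)) t.
Proof.
move=> cu; apply: rcont_sum => j; have cj := rcont_nrm (ccont_coord j cu).
by rewrite (_ : (fun _ => _) = (fun t => nrm (u t 0 j) * nrm (u t 0 j))); [exact: rcontM|].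
Qed.
Lemma ccont_herm d (u v : T -> 'rV[R[i]]_d) t : {for t, continuous u} -> {for t, continuous v} ->
  ccont (fun t => herm (u t) (v t)) t.
Proof.
move=> cu cv; apply: ccont_sum => j; apply: ccontM; first exact: ccont_coord.
by apply: ccont_conj; exact: ccont_coord.
Qed.
End continuity_rules.

Lemma rcont_continuous (R : realType) (T : topologicalType) (f : T -> R) :
  (forall t, rcont f t) -> continuous f.
Proof. by move=> cf t; exact: rcontP (cf t). Qed.

(** * The reproducing formula *)

Section gauss_mean.
Variables (R : realType) (d : nat).
Local Notation C := R[i].
Local Notation V := 'rV[C]_d.
Local Notation L := (@lebesgueCd R d).
Local Notation vec := (@vec_of_tuple R d).
Local Notation mu := (@lebesgue_measure R).

Lemma integral_indicM (D : set (measurableTypeR R)) (k : R -> R) :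
  (\int[mu]_x (\1_D x * k x)%:E = \int[mu]_(x in D) (k x)%:E)%E.
Proof.
rewrite [RHS]integral_mkcond; apply: eq_integral => x _.
by rewrite patchE indicE; case: ifPn => xD; rewrite ?mul1r// mul0r.
Qed.

Lemma sqnormZ (c : C) (u : V) : sqnorm (c *: u) = nrm c ^+ 2 * sqnorm u.
Proof. by rewrite /sqnorm mulr_sumr; apply: eq_bigr => j _; rewrite mxE nrmM exprMn. Qed.

Lemma sqnorm_ge0 (u : V) : 0 <= sqnorm u.
Proof. by apply: sumr_ge0 => j _; rewrite sqr_ge0. Qed.

(** The Gaussian is constant on the circles e^{it} u, and on every complex line through 0 the circle
    mean of [h] is the same number h(0), which then leaves the integral over u. *)
Lemma gauss_mean_Re (h : V -> C) : (forall u, ccont h u) ->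
  (forall u l, exists D, cderiv (fun l => h (l *: u)) l D) ->
  L.-integrable setT (fun t => (nrm (h (vec t)) * expR (- sqnorm (vec t)))%:E) ->
  \int[L]_t (Re (h (vec t)) * expR (- sqnorm (vec t))) = pi ^+ d * Re (h 0).
Proof.
move=> ch eh ih; have pi0 := pi_gt0 R.
have npi : - pi <= pi :> R by rewrite (le_trans _ (ltW pi0))// oppr_le0 ltW.
pose D : set (measurableTypeR R) := `[- pi, pi]%classic.
have mD : measurable D by exact: measurable_itv.
have muD : (mu D = (2 * pi)%:E)%E.
  rewrite /D lebesgue_measure_itv /= lte_fin.
  have -> : - pi < pi :> R by rewrite (lt_trans _ pi0)// oppr_lt0.
  by congr EFin; ring.
pose phi u := Re (h u) * expR (- sqnorm u).
have cphi u : rcont phi u.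
  apply: rcontM; first exact: rcont_Re.
  by apply: rcont_expR; apply: rcontN; apply: (rcont_sqnorm (u := id)); exact: cvg_id.
have mphi : measurable_fun setT (fun t => phi (vec t)).
  exact: measurable_vec (rcont_continuous cphi).
have iphi : L.-integrable setT (fun t => (phi (vec t))%:E).
  apply: le_integrable ih => //; first exact/measurable_EFinP.
  move=> t _; rewrite !abse_EFin lee_fin normrM [`|expR _|]ger0_norm ?expR_ge0// [leRHS]ger0_norm; last first.
    by rewrite mulr_ge0 ?nrm_ge0 ?expR_ge0.
  by rewrite ler_wpM2r ?expR_ge0// Re_le.
(* The rotated integrand, with the angle restricted by an indicator so that Fubini's theorem is
   applied on a full product. *)
pose F (p : measurableTypeR R * d.-tuple (measurableTypeR R * measurableTypeR R)%type) : \bar R :=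
  (\1_D p.1 * phi (cexp (0 +i* p.1) *: vec p.2))%:E.
have mF : measurable_fun setT F.
  apply/measurable_EFinP; apply: measurable_funM.
    by apply: measurableT_comp measurable_fst; exact: measurable_indic.
  apply: (measurable_vecR (f := fun q : R * V => phi (cexp (0 +i* q.1) *: q.2))).
  apply: rcont_continuous => q.
  apply: (rcont_compT (e := phi) (u := fun q : R * V => cexp (0 +i* q.1) *: q.2)); last exact: cphi.
  have c1 : ccont (fun q : R * V => cexp (0 +i* q.1)) q.
    by apply: ccont_cexp; split; apply: continuous_mkC; [exact: cvg_cst|exact: cvg_fst].
  have c2 := @scale_continuous C V (cexp (0 +i* q.1), q.2).
  apply: (continuous_comp (f := fun q : R * V => (cexp (0 +i* q.1), q.2))) c2.
  exact: (@cvg_pair _ _ _ _ (nbhs _) (nbhs _) _ _ _ _ _ (ccontP c1) cvg_snd).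
have Din x : D x -> `|x| <= pi by rewrite /D /= in_itv/= ler_norml.
have phirot x : D x -> forall t, phi (cexp (0 +i* x) *: vec t) = phi (vec (rotate x t)).
  by move=> _ t; rewrite vec_rotate.
pose A := (\int[L]_t `|(phi (vec t))%:E|)%E.
have A0 : (0 <= A)%E by apply: integral_ge0.
have Aoo : (A < +oo)%E by move/integrableP : iphi => [].
(* Rotation invariance makes the slice at every angle in [D] contribute the same finite amount
   [A]. *)
have iF : (\int[mu]_x \int[L]_t `|F (x, t)| < +oo)%E.
  have -> : (\int[mu]_x \int[L]_t `|F (x, t)| = \int[mu]_(x in D) A)%E.
    rewrite [RHS]integral_mkcond; apply: eq_integral => x _; rewrite patchE /F /=.
    case: ifPn => [/set_mem xD|xD].
      rewrite indicE mem_set//; under eq_integral do rewrite mul1r phirot//.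
      rewrite ((preserves_rotate d (Din _ xD)).2 (fun t => `|(phi (vec t))%:E|%E))//.
      by apply: measurableT_comp => //; exact/measurable_EFinP.
    by rewrite indicE (negbTE xD); under eq_integral do rewrite mul0r normr0; rewrite integral0.
  rewrite integral_cst// [X in (_ * X)%E]muD.
  by apply: lte_mul_pinfty => //; [rewrite ge0_fin_numE|rewrite ltry].
have := Fubini ((@integrable12ltyP _ _ _ _ R mu L F mF).2 iF).
have -> : (\int[mu]_x \int[L]_t F (x, t) = (2 * pi)%:E * (\int[L]_t phi (vec t))%:E)%E.
  rewrite fineK; last exact: integrable_fin_num.
  transitivity (\int[mu]_(x in D) (\int[L]_t (phi (vec t))%:E))%E.
    rewrite [RHS]integral_mkcond; apply: eq_integral => x _; rewrite patchE /F /=.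
    case: ifPn => [/set_mem xD|xD].
      rewrite indicE mem_set//; under eq_integral do rewrite mul1r phirot//.
      rewrite (preserves_integral (preserves_rotate d (Din _ xD)) (g := fun t => (phi (vec t))%:E))//.
      exact/measurable_EFinP.
    by rewrite indicE (negbTE xD); under eq_integral do rewrite mul0r; rewrite integral0.
  by rewrite integral_cst// [X in (_ * X)%E]muD muleC.
(* In this order the angle is integrated along the unit circle of the line l |-> l u, where
   [circle_mean_Re] applies with log-radius 0. *)
have -> : (\int[L]_t \int[mu]_x F (x, t) =
    (2 * pi * Re (h 0))%:E * \int[L]_t (expR (- sqnorm (vec t)))%:E)%E.
  rewrite -integralZl//; last first.
    apply/integrableP; split.
      apply/measurable_EFinP; apply: (measurable_vec (f := fun u => expR (- sqnorm u))).
      apply: rcont_continuous => u.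
      by apply: rcont_expR; apply: rcontN; apply: (rcont_sqnorm (u := id)); exact: cvg_id.
    under eq_integral do rewrite abse_EFin ger0_norm ?expR_ge0//.
    by rewrite integral_gauss_vec ltry.
  apply: eq_integral => t _; rewrite /F /= integral_indicM.
  under eq_integral do rewrite /phi sqnormZ nrm_cexp /= expR0 expr1n mul1r.
  have c0 : ccont (fun l : C => h (l *: vec t)) 0 by have [E /cderiv_continuous] := eh (vec t) 0.
  have CM := @circle_mean_Re R (fun l : C => h (l *: vec t)) 0 (fun l _ => eh (vec t) l) c0.
  rewrite expR0 scale0r in CM.
  have cc : continuous (fun x : R => Re (h (cexp (0 +i* x) *: vec t))).
    apply: rcont_continuous => x; apply: rcont_Re.
    apply: (ccont_compC (f := fun x : R => cexp (0 +i* x)) (g := fun l => h (l *: vec t))).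
      by apply: ccont_cexp; split; apply: continuous_mkC; [exact: cvg_cst|exact: cvg_id].
    by have [E /cderiv_continuous] := eh (vec t) (cexp (0 +i* x)).
  have ic : mu.-integrable D (EFin \o (fun x : R => Re (h (cexp (0 +i* x) *: vec t)))).
    exact: integrable_itv_continuous.
  under eq_integral do rewrite EFinM.
  rewrite integralZr// EFinM; congr (_ * _)%E.
  rewrite -[LHS]fineK; last exact: integrable_fin_num.
  congr EFin; rewrite -CM.
  by apply: eq_Rintegral => x _; rewrite mul1r.
rewrite integral_gauss_vec -!EFinM => -[] E.
have p2 : 2 * pi != 0 :> R by rewrite mulf_neq0// gt_eqF.
apply: (mulfI p2); rewrite E; ring.
Qed.
End gauss_mean.

Lemma continuous_pair_fun (X U U' : topologicalType) (u : X -> U) (v : X -> U') t :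
  {for t, continuous u} -> {for t, continuous v} -> {for t, continuous (fun t => (u t, v t))}.
Proof.
exact (fun cu cv => @cvg_pair _ _ _ _ (nbhs (u t)) (nbhs (v t)) _ _ _ u v cu cv).
Qed.

(** * Domination by the weight, Fubini's theorem and Schur's test *)

Section decay_integrals.
Variables (R : realType) (d : nat).
Local Notation C := R[i].
Local Notation V := 'rV[C]_d.
Local Notation L := (@lebesgueCd R d).
Local Notation vec := (@vec_of_tuple R d).
Local Notation T := (d.-tuple (measurableTypeR R * measurableTypeR R)%type).

Lemma continuous_subV (X : topologicalType) (u v : X -> V) t :
  {for t, continuous u} -> {for t, continuous v} -> {for t, continuous (fun t => u t - v t)}.
Proof. exact (fun cu cv => @continuousB C V X u v t cu cv). Qed.

Lemma rcont_prod (X : topologicalType) n (f : 'I_n -> X -> R) (t : X) :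
  (forall i, rcont (f i) t) -> rcont (fun t => \prod_i f i t) t.
Proof.
elim: n f => [|n IH] f cf.
  by rewrite (_ : (fun _ => _) = (fun=> 1)); [exact: rcont_cst|apply/funext => x; rewrite big_ord0].
rewrite (_ : (fun _ => _) = (fun t => f ord0 t * \prod_i f (lift ord0 i) t)); last first.
  by apply/funext => x; rewrite big_ord_recl.
by apply: rcontM => //; exact: IH.
Qed.

Lemma rcont_decay (X : topologicalType) (u : X -> V) t : {for t, continuous u} ->
  rcont (fun t => decay (u t)) t.
Proof.
move=> cu; apply: rcont_prod => j; have cj := ccont_coord j cu.
apply: rcontM; (apply: (rcont_comp (e := fun x => (oneDsqr x)^-1)); [|exact: continuous_oneDsqrV]).
- exact: rcont_Re.
- exact: rcont_Im.
Qed.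

Lemma continuous_decay : continuous (@decay R d).
Proof. by apply: rcont_continuous => z; apply: (rcont_decay (u := id)); exact: cvg_id. Qed.

Lemma measurable_decay : measurable_fun setT (fun t : T => decay (vec t)).
Proof. exact: measurable_vec continuous_decay. Qed.

Lemma integrable_decay (M : R) : L.-integrable setT (fun t : T => (M * decay (vec t))%:E).
Proof.
apply: (eq_integrable _ (fun t : T => M%:E * (decay (vec t))%:E)%E) => //.
apply: integrableZl => //; apply/integrableP; split.
  by apply/measurable_EFinP; exact: measurable_decay.
under eq_integral do rewrite abse_EFin ger0_norm ?decay_ge0//.
by rewrite integral_decay ltry.
Qed.

Lemma le_decay_integrable (f : V -> R) (M : R) : continuous f ->
  (forall z, `|f z| <= M * decay z) -> L.-integrable setT (fun t : T => (f (vec t))%:E).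
Proof.
move=> cf H; apply: le_integrable (integrable_decay M) => //.
  by apply/measurable_EFinP; exact: measurable_vec.
by move=> t _; rewrite !abse_EFin lee_fin (le_trans (H _))// ler_norm.
Qed.

Section double.
Variables (f : V * V -> R) (M : R).
Hypotheses (cf : continuous f) (fM : forall z w, `|f (z, w)| <= M * decay z * decay w).

Let fvec (p : T * T) := (f (vec p.1, vec p.2))%:E.
Let mf : measurable_fun setT fvec.
Proof. by apply/measurable_EFinP; exact: measurable_vec2. Qed.

Lemma slice1_integrable z : L.-integrable setT (fun t : T => (f (z, vec t))%:E).
Proof.
apply: (le_decay_integrable (f := fun w => f (z, w)) (M := M * decay z)) => // w.
apply: rcontP; apply: (rcont_compT (e := f) (u := fun w => (z, w))); last by split; exact: cf.
by apply: (@continuous_pair_fun _ _ _ (fun=> z) id); [exact: (@cst_continuous _ _ z)|exact: cvg_id].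
Qed.

Lemma slice2_integrable w : L.-integrable setT (fun t : T => (f (vec t, w))%:E).
Proof.
apply: (le_decay_integrable (f := fun z => f (z, w)) (M := M * decay w)) => [z|z].
  apply: rcontP; apply: (rcont_compT (e := f) (u := fun z => (z, w))); last by split; exact: cf.
  by apply: (@continuous_pair_fun _ _ _ id (fun=> w)); [exact: cvg_id|exact: (@cst_continuous _ _ w)].
by rewrite mulrAC.
Qed.

Lemma double_integrable : (L \x L)%E.-integrable setT fvec.
Proof.
apply/integrable12ltyP => //.
apply: (@le_lt_trans _ _ (\int[L]_s \int[L]_t (M * decay (vec s) * decay (vec t))%:E)%E).
  apply: ge0_le_integral => //.
  - by move=> s _; apply: integral_ge0.
  - apply: (measurable_fun_fubini_tonelli_F (m2 := L) (fun p => `|fvec p|%E)) => //.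
    exact: measurableT_comp.
  - apply: (measurable_fun_fubini_tonelli_F (m2 := L)
      (fun p : T * T => (M * decay (vec p.1) * decay (vec p.2))%:E)).
      apply/measurable_EFinP; apply: measurable_funM.
        apply: measurable_funM; first exact: measurable_cst.
        exact: (measurableT_comp measurable_decay measurable_fst).
      exact: (measurableT_comp measurable_decay measurable_snd).
    by move=> p; rewrite lee_fin (le_trans _ (fM _ _)).
  - move=> s _; apply: ge0_le_integral => //.
    + apply: measurableT_comp => //; exact: (measurable_int _ (slice1_integrable (vec s))).
    + apply/measurable_EFinP; apply: measurable_funM; first exact: measurable_cst.
      exact: measurable_decay.
    + by move=> t _; rewrite lee_fin fM.
have -> : (\int[L]_s \int[L]_t (M * decay (vec s) * decay (vec t))%:E =
    \int[L]_s ((M * ((pi ^+ 2) ^+ d)) * decay (vec s))%:E)%E.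
  apply: eq_integral => s _; under eq_integral do rewrite EFinM.
  rewrite integralZl//; last first.
    by have := integrable_decay 1; apply: eq_integrable => // t _; rewrite mul1r.
  by rewrite integral_decay -EFinM mulrAC.
by have /integrable_lty := integrable_decay (M * (pi ^+ 2) ^+ d); exact.
Qed.

Lemma Rintegral12 : \int[L]_s (\int[L]_t f (vec s, vec t)) =
  \int[(L \x L)%E]_p f (vec p.1, vec p.2).
Proof.
rewrite /Rintegral -(integral12_prod_meas1 double_integrable); congr fine.
apply: eq_integral => s _; rewrite /fubini_F /= fineK//.
exact: integrable_fin_num (slice1_integrable _).
Qed.

Lemma Rintegral21 : \int[L]_t (\int[L]_s f (vec s, vec t)) =
  \int[(L \x L)%E]_p f (vec p.1, vec p.2).
Proof.
rewrite /Rintegral -(integral21_prod_meas1 double_integrable); congr fine.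
apply: eq_integral => s _; rewrite /fubini_G /= fineK//.
exact: integrable_fin_num (slice2_integrable _).
Qed.
End double.

Lemma decayN (z : V) : decay (- z) = decay z.
Proof.
apply: eq_bigr => j _; rewrite !mxE cReN cImN.
by congr (_^-1 * _^-1); rewrite /oneDsqr sqrrN.
Qed.

Lemma integral_decay_shift (z : V) :
  (\int[L]_t (decay (z - vec t))%:E = ((pi ^+ 2) ^+ d)%:E)%E.
Proof.
rewrite -integral_decay -(preserves_integral (preserves_translate (- z)) (g := fun t => (decay (vec t))%:E)).
  by apply: eq_integral => t _; rewrite vec_translate -decayN opprB.
by apply/measurable_EFinP; exact: measurable_decay.
Qed.

(** From 2 f(z) f(w) <= f(z)^2 + f(w)^2: in either term one variable occurs only in decay(z - w),
    which integrates to pi^{2d} by translation invariance. *)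
Lemma schur_decay (f : V -> R) : continuous f -> (forall z, 0 <= f z) ->
  (\int[L \x L]_p (decay (vec p.1 - vec p.2) * (f (vec p.1) * f (vec p.2)))%:E <=
   ((pi ^+ 2) ^+ d)%:E * \int[L]_t (f (vec t) ^+ 2)%:E)%E.
Proof.
move=> cf f0.
have rf (X : topologicalType) (u : X -> V) t : {for t, continuous u} -> rcont (fun t => f (u t)) t.
  by move=> cu; apply: rcont_compT => //; split; exact: cf.
have cd (p : V * V) : rcont (fun p : V * V => decay (p.1 - p.2 : V)) p.
  apply: (rcont_decay (u := fun p : V * V => p.1 - p.2 : V)).
  by apply: (@continuous_subV _ fst snd); [exact: cvg_fst|exact: cvg_snd].
have rsq (X : topologicalType) (u : X -> V) t : {for t, continuous u} -> rcont (fun t => f (u t) ^+ 2) t.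
  by move=> cu; rewrite (_ : (fun _ => _) = (fun t => f (u t) * f (u t))); [apply: rcontM; exact: rf|].
have m1 : measurable_fun setT (fun p : T * T => decay (vec p.1 - vec p.2) * f (vec p.1) ^+ 2).
  apply: (measurable_vec2 (f := fun p : V * V => decay (p.1 - p.2) * f p.1 ^+ 2)).
  by apply: rcont_continuous => p; apply: rcontM => //; apply: rsq; exact: cvg_fst.
have m2 : measurable_fun setT (fun p : T * T => decay (vec p.1 - vec p.2) * f (vec p.2) ^+ 2).
  apply: (measurable_vec2 (f := fun p : V * V => decay (p.1 - p.2) * f p.2 ^+ 2)).
  by apply: rcont_continuous => p; apply: rcontM => //; apply: rsq; exact: cvg_snd.
have m3 : measurable_fun setT (fun p : T * T => decay (vec p.1 - vec p.2) * (f (vec p.1) * f (vec p.2))).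
  apply: (measurable_vec2 (f := fun p : V * V => decay (p.1 - p.2) * (f p.1 * f p.2))).
  apply: rcont_continuous => p; apply: rcontM => //; apply: rcontM; apply: rf.
    exact: cvg_fst.
  exact: cvg_snd.
have msq : measurable_fun setT (fun t : T => (f (vec t) ^+ 2)%:E).
  apply/measurable_EFinP; apply: (measurable_vec (f := fun z => f z ^+ 2)).
  by apply: rcont_continuous => z; apply: (rsq _ id); exact: cvg_id.
pose I := (\int[L]_t (f (vec t) ^+ 2)%:E)%E.
have I1 : (\int[L \x L]_p (decay (vec p.1 - vec p.2) * f (vec p.1) ^+ 2)%:E = ((pi ^+ 2) ^+ d)%:E * I)%E.
  rewrite fubini_tonelli1; last 2 first.
  - exact/measurable_EFinP.
  - by move=> p; rewrite lee_fin mulr_ge0 ?decay_ge0// sqr_ge0.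
  rewrite -ge0_integralZl//; last 2 first.
  - by move=> t _; rewrite lee_fin sqr_ge0.
  - by rewrite lee_fin !exprn_ge0// pi_ge0.
  apply: eq_integral => s _; rewrite /fubini_F /=.
  under eq_integral do rewrite EFinM.
  rewrite ge0_integralZr//; first by rewrite integral_decay_shift.
  - apply/measurable_EFinP; apply: (measurable_vec (f := fun w => decay (vec s - w))).
    apply: rcont_continuous => w; apply: (rcont_decay (u := fun w : V => vec s - w : V)).
    by apply: (@continuous_subV _ (fun=> vec s) id); [exact: (@cst_continuous _ _ (vec s))|exact: cvg_id].
  - by move=> t _; rewrite lee_fin decay_ge0.
  - by rewrite lee_fin sqr_ge0.
have I2 : (\int[L \x L]_p (decay (vec p.1 - vec p.2) * f (vec p.2) ^+ 2)%:E = ((pi ^+ 2) ^+ d)%:E * I)%E.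
  rewrite fubini_tonelli2; last 2 first.
  - exact/measurable_EFinP.
  - by move=> p; rewrite lee_fin mulr_ge0 ?decay_ge0// sqr_ge0.
  rewrite -ge0_integralZl//; last 2 first.
  - by move=> t _; rewrite lee_fin sqr_ge0.
  - by rewrite lee_fin !exprn_ge0// pi_ge0.
  apply: eq_integral => s _; rewrite /fubini_G /=.
  under eq_integral do rewrite -opprB decayN EFinM.
  rewrite ge0_integralZr//; first by rewrite integral_decay_shift.
  - apply/measurable_EFinP; apply: (measurable_vec (f := fun w => decay (vec s - w))).
    apply: rcont_continuous => w; apply: (rcont_decay (u := fun w : V => vec s - w : V)).
    by apply: (@continuous_subV _ (fun=> vec s) id); [exact: (@cst_continuous _ _ (vec s))|exact: cvg_id].
  - by move=> t _; rewrite lee_fin decay_ge0.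
  - by rewrite lee_fin sqr_ge0.
apply: (@le_trans _ _ (\int[L \x L]_p ((2^-1)%:E * ((decay (vec p.1 - vec p.2) * f (vec p.1) ^+ 2)%:E
   + (decay (vec p.1 - vec p.2) * f (vec p.2) ^+ 2)%:E)))%E).
  apply: ge0_le_integral => //.
  - by move=> p _; rewrite lee_fin !mulr_ge0 ?decay_ge0.
  - exact/measurable_EFinP.
  - apply: measurable_funeM; apply: emeasurable_funD; exact/measurable_EFinP.
  - move=> p _; rewrite -EFinD -EFinM lee_fin.
    have := decay_ge0 (vec p.1 - vec p.2).
    set D := decay _; set x := f _; set y := f _ => D0.
    have -> : 2^-1 * (D * x ^+ 2 + D * y ^+ 2) = D * (x * y) + 2^-1 * (D * (x - y) ^+ 2) by field.
    by rewrite lerDl mulr_ge0// mulr_ge0// sqr_ge0.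
rewrite ge0_integralZl//; last 2 first.
- by apply: emeasurable_funD; exact/measurable_EFinP.
- by move=> p _; rewrite adde_ge0// lee_fin mulr_ge0 ?decay_ge0// sqr_ge0.
rewrite ge0_integralD//; last 4 first.
- by move=> p _; rewrite lee_fin mulr_ge0 ?decay_ge0// sqr_ge0.
- exact/measurable_EFinP.
- by move=> p _; rewrite lee_fin mulr_ge0 ?decay_ge0// sqr_ge0.
- exact/measurable_EFinP.
rewrite I1 I2 -/I.
have : (0 <= ((pi ^+ 2) ^+ d)%:E * I)%E.
  apply: mule_ge0; first by rewrite lee_fin !exprn_ge0// pi_ge0.
  by apply: integral_ge0 => t _; rewrite lee_fin sqr_ge0.
by case: (_ * I)%E => [r| |]// _; rewrite ?leey// -EFinD -EFinM lee_fin; lra.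
Qed.
End decay_integrals.

(** * Integration against the Wick kernel *)

Section reproducing.
Variables (R : realType) (d : nat).
Local Notation C := R[i].
Local Notation V := 'rV[C]_d.
Local Notation L := (@lebesgueCd R d).
Local Notation vec := (@vec_of_tuple R d).
Local Notation T := (d.-tuple (measurableTypeR R * measurableTypeR R)%type).

(** Continuity gives measurability on tuples and the weight gives integrability, so both components
    of [integralCd] are genuine integrals. *)
Definition dominated (k : V -> C) :=
  (forall u, ccont k u) /\ exists M : R, forall u, nrm (k u) <= M * decay u.

Lemma dominated_Re k : dominated k -> L.-integrable setT (fun t : T => (Re (k (vec t)))%:E).
Proof.
move=> [ck [M kM]]; apply: (le_decay_integrable (f := fun u => Re (k u)) (M := M)).
  exact: continuous_ReP.
by move=> z; apply: le_trans (Re_le _) _.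
Qed.

Lemma dominated_Im k : dominated k -> L.-integrable setT (fun t : T => (Im (k (vec t)))%:E).
Proof.
move=> [ck [M kM]]; apply: (le_decay_integrable (f := fun u => Im (k u)) (M := M)).
  exact: continuous_ImP.
by move=> z; apply: le_trans (Im_le _) _.
Qed.

Lemma integralCdZ (c : C) k : dominated k -> integralCd (fun u => c * k u) = c * integralCd k.
Proof.
move=> dk; have ir := dominated_Re dk; have ii := dominated_Im dk.
have ZE (r : R) (g : T -> R) : L.-integrable setT (fun t => (g t)%:E) ->
    L.-integrable setT (fun t => (r * g t)%:E).
  by move=> ig; apply: (eq_integrable _ (fun t => r%:E * (g t)%:E)%E) => //; exact: integrableZl.
rewrite /integralCd; apply: cplx_eq; rewrite ?cReM ?cImM /=.
  under eq_Rintegral do rewrite cReM.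
  by rewrite RintegralB//; [rewrite !RintegralZl|exact: ZE|exact: ZE].
under eq_Rintegral do rewrite cImM.
by rewrite RintegralD//; [rewrite !RintegralZl|exact: ZE|exact: ZE].
Qed.

Lemma integralCd_conj k : dominated k -> integralCd (fun u => conjc (k u)) = conjc (integralCd k).
Proof.
move=> dk; have ii := dominated_Im dk.
rewrite /integralCd; apply: cplx_eq => /=.
  by apply: eq_Rintegral => t _; rewrite cReJ.
under eq_Rintegral do rewrite cImJ -mulN1r.
by rewrite RintegralZl// mulN1r.
Qed.

Lemma gauss_mean (h : V -> C) : (forall u, ccont h u) ->
  (forall u l, exists D, cderiv (fun l => h (l *: u)) l D) ->
  L.-integrable setT (fun t => (nrm (h (vec t)) * expR (- sqnorm (vec t)))%:E) ->
  integralCd (fun u => h u * (expR (- sqnorm u))%:C) = (pi ^+ d)%:C * h 0.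
Proof.
move=> ch eh ih; rewrite /integralCd; apply: cplx_eq; rewrite ?cReM ?cImM /= mul0r ?subr0 ?addr0.
  rewrite -gauss_mean_Re//; apply: eq_Rintegral => t _.
  by rewrite cReM /= mulr0 subr0.
have := @gauss_mean_Re R d (fun u => - 'i * h u).
rewrite cReM /= => H; have -> : Im (h 0) = - 0 * Re (h 0) - - 1 * Im (h 0) by ring.
rewrite -H.
- by apply: eq_Rintegral => t _; rewrite cImM cReM /=; ring.
- by move=> u; apply: ccontM; [exact: ccont_cst|exact: ch].
- move=> u l; have [D H1] := eh u l.
  exists (0 * h (l *: u) + - 'i * D); apply: (cderivM (f := fun=> - 'i)) H1; exact: cderiv_cst.
- apply: eq_integrable ih => // t _.
  by rewrite nrmM (_ : nrm (- 'i) = 1) ?mul1r// nrmN /= expr0n expr1n add0r sqrtr1.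
Qed.

Lemma hermDl (x y w : V) : herm (x + y) w = herm x w + herm y w.
Proof. by rewrite /herm -big_split; apply: eq_bigr => j _; rewrite mxE mulrDl. Qed.
Lemma hermDr (x y w : V) : herm w (x + y) = herm w x + herm w y.
Proof. by rewrite /herm -big_split; apply: eq_bigr => j _; rewrite mxE rmorphD mulrDr. Qed.
Lemma hermZl (c : C) (x w : V) : herm (c *: x) w = c * herm x w.
Proof. by rewrite /herm mulr_sumr; apply: eq_bigr => j _; rewrite mxE mulrA. Qed.
Lemma hermNl (x w : V) : herm (- x) w = - herm x w.
Proof. by rewrite -scaleN1r hermZl mulN1r. Qed.
Lemma hermJ (x w : V) : conjc (herm x w) = herm w x.
Proof.
by rewrite /herm rmorph_sum; apply: eq_bigr => j _; rewrite rmorphM /= conjcK mulrC.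
Qed.
Lemma hermNr (x w : V) : herm x (- w) = - herm x w.
Proof. by rewrite -[LHS]hermJ hermNl rmorphN /= hermJ. Qed.
Lemma herm_sqnorm (x : V) : herm x x = (sqnorm x)%:C.
Proof.
rewrite /herm /sqnorm rmorph_sum; apply: eq_bigr => j _.
by rewrite nrm_sqr; apply: cplx_eq; rewrite ?cReM ?cImM cReJ cImJ /=; ring.
Qed.
Lemma sqnormN (x : V) : sqnorm (- x) = sqnorm x.
Proof. by apply: eq_bigr => j _; rewrite mxE nrmN. Qed.
Lemma sqnormD (x y : V) : sqnorm (x + y) = sqnorm x + sqnorm y + 2 * Re (herm x y).
Proof.
suff : Re (herm (x + y) (x + y)) = sqnorm x + sqnorm y + 2 * Re (herm x y).
  by rewrite herm_sqnorm.
rewrite hermDl !hermDr !herm_sqnorm !cReD /= -(hermJ x y) cReJ; ring.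
Qed.
(** Polarization of the exponent of the Wick kernel: the source of the off-diagonal factor
    e^{-|z-w|^2/2}. *)
Lemma Re_herm (z w : V) : Re (herm (z - w) w) = (sqnorm z - sqnorm w - sqnorm (z - w)) / 2.
Proof. by have := sqnormD (z - w) w; rewrite subrK => ->; field. Qed.

Definition entire_on_lines (G : V -> C) := forall u v l, exists D, cderiv (fun l => G (u + l *: v)) l D.

Lemma continuous_addV (X : topologicalType) (u v : X -> V) t :
  {for t, continuous u} -> {for t, continuous v} -> {for t, continuous (fun t => u t + v t)}.
Proof. exact (fun cu cv => @continuousD C V X u v t cu cv). Qed.

Lemma ccont_wick_kernel (X : topologicalType) (z w : X -> V) t :
  {for t, continuous z} -> {for t, continuous w} -> ccont (fun t => cexp (herm (z t - w t) (w t))) t.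
Proof.
by move=> cz cw; apply: ccont_cexp; exact (ccont_herm (u := fun t => z t - w t) (continuous_subV cz cw) cw).
Qed.

(* The translation [w = z + u] turns the kernel into [e^{-(u,z)} e^{-|u|^2}]. *)
Lemma reproducing (G : V -> C) (z : V) (M : R) : (forall u, ccont G u) -> entire_on_lines G ->
  (forall w, nrm (G w) * expR (Re (herm (z - w) w)) <= M * decay w) ->
  integralCd (fun w => G w * cexp (herm (z - w) w)) = (pi ^+ d)%:C * G z.
Proof.
move=> cG eG HM.
have Hz u : herm (z - (u + z)) (u + z) = - herm u z + (- sqnorm u)%:C.
  by rewrite (_ : z - (u + z) = - u) ?hermNl ?hermDr ?herm_sqnorm; [rewrite rmorphN /=; ring|rewrite opprD addrCA subrr addr0].
pose k w := G w * cexp (herm (z - w) w).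
have ck w : ccont k w.
  apply: ccontM => //; apply: (@ccont_wick_kernel _ (fun=> z) id); last exact: cvg_id.
  exact: (@cst_continuous _ _ z).
have kM w : nrm (k w) <= M * decay w by rewrite nrmM nrm_cexp.
pose h u := G (z + 1 *: u) * cexp (- herm u z).
have kh u : k (u + z) = h u * (expR (- sqnorm u))%:C.
  rewrite /k /h Hz cexpD scale1r [z + u]addrC mulrA; congr (_ * _).
  by apply: cplx_eq; rewrite /= ?cos0 ?sin0 ?mulr1 ?mulr0.
have mRe : measurable_fun setT (fun t : T => Re (k (vec t))).
  by apply: (measurable_vec (f := fun w => Re (k w))); exact: continuous_ReP.
have mIm : measurable_fun setT (fun t : T => Im (k (vec t))).
  by apply: (measurable_vec (f := fun w => Im (k w))); exact: continuous_ImP.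
have -> : integralCd k = integralCd (fun u => h u * (expR (- sqnorm u))%:C).
  rewrite /integralCd; congr (_ +i* _); rewrite /Rintegral.
    rewrite -(preserves_integral (preserves_translate z) (g := fun t : T => (Re (k (vec t)))%:E)); last exact/measurable_EFinP.
    by congr fine; apply: eq_integral => t _; rewrite vec_translate kh.
  rewrite -(preserves_integral (preserves_translate z) (g := fun t : T => (Im (k (vec t)))%:E)); last exact/measurable_EFinP.
  by congr fine; apply: eq_integral => t _; rewrite vec_translate kh.
have z0 : herm 0 z = 0 by rewrite -(scale0r z) hermZl mul0r.
have h0 : h 0 = G z by rewrite /h scaler0 addr0 z0 oppr0 cexp0 mulr1.
rewrite gauss_mean ?h0//.
- move=> u; apply: ccontM.
    apply: (ccont_comp (g := G) (f := fun u : V => z + (1 : C) *: u : V)) => //.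
    rewrite (_ : (fun u : V => _) = (fun u : V => z + u)); last by apply/funext => v; rewrite scale1r.
    by apply: (@continuous_addV _ (fun=> z) id); [exact: (@cst_continuous _ _ z)|exact: cvg_id].
  apply: ccont_cexp; apply: ccontN; apply: (@ccont_herm _ _ _ id (fun=> z)); first exact: cvg_id.
  exact: (@cst_continuous _ _ z).
- move=> u l.
  have [D H1] := eG z u l; rewrite /h.
  have H2 : cderiv (fun l => cexp (0 + - herm u z * l)) l (cexp (0 + - herm u z * l) * - herm u z).
    exact: (cderiv_comp (cderiv_affine 0 (- herm u z) l) (cderiv_cexp _)).
  have := cderivM H1 H2; set D' := (X in cderiv _ _ X) => H3; exists D'.
  by apply: cderiv_ext H3 => y; rewrite hermZl scale1r add0r mulNr [_ * y]mulrC.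
- have ik : L.-integrable setT (fun t : T => (nrm (k (vec t)))%:E).
    apply: (le_decay_integrable (f := fun w => nrm (k w)) (M := M)).
      by apply: rcont_continuous => w; exact: rcont_nrm.
    by move=> w; rewrite ger0_norm ?nrm_ge0.
  have := preserves_integrable (preserves_translate z) ik.
  apply: eq_integrable => // t _; rewrite vec_translate kh nrmM.
  by rewrite nrm_real ger0_norm ?expR_ge0.
Qed.
End reproducing.

(** * Estimates on symbols *)

Section weights.
Variables (R : realType) (d : nat).
Local Notation C := R[i].
Local Notation V := 'rV[C]_d.

Lemma japanese_sqr (z : V) : japanese z ^+ 2 = 1 + sqnorm z.
Proof. by rewrite sqr_sqrtr// addr_ge0// sqnorm_ge0. Qed.

Lemma japanese_ge1 (z : V) : 1 <= japanese z.
Proof.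
by rewrite -(ler_pXn2r (n := 2)) ?nnegrE ?sqrtr_ge0// japanese_sqr expr1n lerDl sqnorm_ge0.
Qed.

Lemma japanese_gt0 (z : V) : 0 < japanese z.
Proof. exact: lt_le_trans (japanese_ge1 z). Qed.

Lemma japanese_powR2n (z : V) n : japanese z `^ (2 * n%:R) = (1 + sqnorm z) ^+ n.
Proof.
by rewrite -natrM powR_mulrn ?ltW ?japanese_gt0// exprM japanese_sqr.
Qed.

Lemma powR_le_sqr (x r : R) : 1 <= x -> r <= 1 -> x `^ (2 * r) <= x ^+ 2.
Proof.
move=> x1 r1; rewrite -powR_mulrn; last by apply: le_trans x1.
by rewrite ler_powR//; lra.
Qed.

Lemma sqnormDB (x y : V) : sqnorm (x + y) + sqnorm (x - y) = 2 * sqnorm x + 2 * sqnorm y.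
Proof. by rewrite !sqnormD sqnormN hermNr cReN; ring. Qed.

Lemma sqnorm_conjv (z : V) : sqnorm (conjv z) = sqnorm z.
Proof. by apply: eq_bigr => j _; rewrite mxE nrmJ. Qed.

Lemma sqnorm_sqrt2 (z : V) : sqnorm ((Num.sqrt 2)%:C *: conjv z) = 2 * sqnorm z.
Proof.
by rewrite sqnormZ sqnorm_conjv nrm_real ger0_norm ?sqrtr_ge0// sqr_sqrtr.
Qed.

(** Writing 2z = (z + w) + (z - w) gives 2|z|^2 <= |z+w|^2 + |z-w|^2, which also accounts for the
    factor sqrt 2 in the weight. *)
Lemma peetre (z w : V) :
  japanese ((Num.sqrt 2)%:C *: conjv z) <= japanese (z + w) * japanese (z - w).
Proof.
rewrite -(ler_pXn2r (n := 2)) ?nnegrE ?mulr_ge0 ?sqrtr_ge0// exprMn !japanese_sqr sqnorm_sqrt2.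
have E : 2 * (2 * sqnorm z) <= 2 * sqnorm (z + w) + 2 * sqnorm (z - w).
  rewrite -sqnormDB; have -> : z + w + (z - w) = 2%:R *: z.
    by rewrite addrACA subrr addr0 scaler_nat mulr2n.
  have -> : sqnorm (2%:R *: z) = 2 * (2 * sqnorm z).
    have c2 : (2%:R : C) = (2 : R)%:C by rewrite rmorph_nat.
    by rewrite sqnormZ c2 nrm_real ger0_norm//; ring.
  by rewrite lerDl sqnorm_ge0.
have := mulr_ge0 (sqnorm_ge0 (z + w)) (sqnorm_ge0 (z - w)); lra.
Qed.

(** The left side is the weight of the symbol class for two derivatives. What remains is <z-w>^{2r},
    at most <z-w>^2 since [r <= 1]. *)
Lemma peetre_powR (z w : V) (r : R) : 0 < r -> r <= 1 ->
  japanese ((Num.sqrt 2)%:C *: conjv z) `^ (2 * r) * japanese (z + w) `^ (- (r * 2%:R)) <= 1 + sqnorm (z - w).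
Proof.
move=> r0 r1; have j0 := japanese_gt0 (z + w).
have -> : - (r * 2%:R) = - (2 * r) by ring.
rewrite powRN -ler_pdivlMr ?invrK ?invr_gt0 ?powR_gt0//.
apply: (@le_trans _ _ ((japanese (z + w) * japanese (z - w)) `^ (2 * r))).
  by apply: ge0_ler_powR; rewrite ?nnegrE ?mulr_ge0 ?sqrtr_ge0 ?peetre// ltW.
rewrite powRM ?sqrtr_ge0// mulrC ler_wpM2r ?powR_ge0// -japanese_sqr.
exact: powR_le_sqr (japanese_ge1 _) r1.
Qed.

(** Write e^{v/2} as the (m+1)-th power of e^{v/(2(m+1))} and use e^x >= 1 + x; m+1 in place of m
    keeps the divisor nonzero. *)
Lemma expR_half_ge (v : R) m : 0 <= v -> (1 + v) ^+ m <= (2 * m.+1%:R) ^+ m.+1 * expR (v / 2).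
Proof.
move=> v0; have m0 : 0 < 2 * m.+1%:R :> R by rewrite mulr_gt0.
have E : expR (v / 2) = expR (v / (2 * m.+1%:R)) ^+ m.+1.
  rewrite -expRM_natl; congr expR; have : m.+1%:R != 0 :> R by rewrite pnatr_eq0.
  by set n := _%:R => n0; field.
rewrite E -exprMn; apply: (@le_trans _ _ ((1 + v) ^+ m.+1)).
  by rewrite ler_weXn2l// lerDl.
apply: lerXn2r; [by rewrite nnegrE addr_ge0|by rewrite nnegrE mulr_ge0 ?expR_ge0// ltW|].
apply: (@le_trans _ _ (2 * m.+1%:R * (1 + v / (2 * m.+1%:R)))).
  rewrite mulrDr mulr1 mulrCA divff ?gt_eqF// mulr1 lerD2r.
  have : 1 <= m.+1%:R :> R by rewrite ler1n.
  by set n := _%:R; lra.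
by apply: ler_wpM2l; [exact: ltW|exact: expR_ge1Dx].
Qed.

(** The function e^{x/2} (1+x)^{-m} is increasing up to a constant, because 1 + y <= (1 + (y - x))
    (1 + x) and the first factor is paid by e^{(y-x)/2}. It moves derivative bounds from
    intermediate points to the pair (z, w). *)
Lemma gauss_decay_mono (x y : R) m : 0 <= x -> x <= y ->
  expR (x / 2) * (1 + x) ^- m <= (2 * m.+1%:R) ^+ m.+1 * (expR (y / 2) * (1 + y) ^- m).
Proof.
move=> x0 xy; have x1 : 0 < 1 + x by rewrite ltr_pwDl.
have y1 : 0 < 1 + y by rewrite ltr_pwDl// (le_trans x0).
rewrite ler_pdivrMr ?exprn_gt0// !mulrA mulrAC ler_pdivlMr ?exprn_gt0//.
have -> : expR (y / 2) = expR (x / 2) * expR ((y - x) / 2).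
  by rewrite -expRD; congr expR; field.
have H := expR_half_ge m (_ : 0 <= y - x).
have {}H : (1 + (y - x)) ^+ m <= (2 * m.+1%:R) ^+ m.+1 * expR ((y - x) / 2) by apply: H; rewrite subr_ge0.
apply: (@le_trans _ _ (expR (x / 2) * ((1 + (y - x)) * (1 + x)) ^+ m)).
  rewrite ler_wpM2l ?expR_ge0//; apply: lerXn2r.
  - by rewrite nnegrE ltW.
  - by rewrite nnegrE mulr_ge0 ?(ltW x1)// addr_ge0// subr_ge0.
  have : 0 <= (y - x) * x by rewrite mulr_ge0// subr_ge0.
  lra.
rewrite exprMn.
have -> : (2 * m.+1%:R) ^+ m.+1 * (expR (x / 2) * expR ((y - x) / 2)) * (1 + x) ^+ m =
  expR (x / 2) * ((2 * m.+1%:R) ^+ m.+1 * expR ((y - x) / 2) * (1 + x) ^+ m) by ring.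
by rewrite ler_wpM2l ?expR_ge0// ler_wpM2r// exprn_ge0// ltW.
Qed.
End weights.

Lemma cderiv_recenter (R : realType) (f g : R[i] -> R[i]) x y D : cderiv f x D ->
  (forall h, g (y + h) = f (x + h)) -> cderiv g y D.
Proof.
move=> [p [cp p0 E]] fg; exists p; split=> // h.
by rewrite fg E -[in RHS](addr0 y) fg addr0.
Qed.

(** * Wirtinger derivatives as complex derivatives along coordinates *)

Section wirtinger_derivatives.
Variables (R : realType) (d : nat).
Local Notation C := R[i].
Local Notation V := 'rV[C]_d.
Local Notation ev j := (delta_mx 0 j : V).

Lemma conjvK (z : V) : conjv (conjv z) = z.
Proof. by apply/rowP => j; rewrite !mxE conjcK. Qed.
Lemma conjvD (z w : V) : conjv (z + w) = conjv z + conjv w.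
Proof. by apply/rowP => j; rewrite !mxE rmorphD. Qed.
Lemma conjvZ (c : C) (z : V) : conjv (c *: z) = conjc c *: conjv z.
Proof. by apply/rowP => j; rewrite !mxE rmorphM. Qed.
Lemma conjv_ev j : conjv (ev j) = ev j.
Proof. by apply/rowP => k; rewrite !mxE; case: (_ && _); rewrite /= oppr0. Qed.

Lemma multi_delta (D : 'I_d -> (V -> C) -> V -> C) j F :
  multi D (fun i => (i == j) : nat) F = D j F.
Proof.
rewrite /multi; have : j \in enum 'I_d by rewrite mem_enum.
have := enum_uniq 'I_d.
have notin (s : seq 'I_d) : j \notin s ->
    foldr (fun i G => iter (i == j) (D i) G) F s = F.
  elim: s => //= i s IH; rewrite inE negb_or eq_sym => /andP[/negbTE -> /IH ->] //.
elim: (enum 'I_d) => //= i s IH /andP[iNs us]; rewrite inE => /orP[/eqP ji|js].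
  by rewrite -ji notin ?ji// -ji eqxx.
have -> : (i == j) = false by apply: contraNF iNs => /eqP ->.
exact: IH.
Qed.

Lemma multi_zero (D : 'I_d -> (V -> C) -> V -> C) F : multi D (fun=> 0%N) F = F.
Proof. by rewrite /multi; elim: (enum 'I_d). Qed.

Lemma rderive_cderiv (f : C -> C) (F : V -> C) z v (c : C) D : cderiv f 0 D ->
  (forall t : R, F (z + t%:C *: v) = f (0 + t%:C * c)) -> rderive v F z = D * c.
Proof.
move=> df E; have [|dR dI] := @cderiv_line R f 0 c D 0; first by rewrite mul0r addr0.
rewrite /rderive !derive1E.
have -> : (fun t : R => Re (F (z + t%:C *: v))) = (fun t : R => Re (f (0 + t%:C * c))).
  by apply/funext => t; rewrite E.
have -> : (fun t : R => Im (F (z + t%:C *: v))) = (fun t : R => Im (f (0 + t%:C * c))).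
  by apply/funext => t; rewrite E.
by rewrite !derive_val; case: (D * c).
Qed.

Lemma imag2 : (imag : C) * imag = -1.
Proof. by apply: cplx_eq; rewrite ?cReM ?cImM /=; ring. Qed.

(** For a holomorphic function the derivatives along e_j and i e_j are D and iD, and (D - i (iD)) /
    2 = D. *)
Lemma wirtinger_cderiv (F : V -> C) z j D :
  cderiv (fun t => F (z + t *: ev j)) 0 D -> wirtinger j F z = D.
Proof.
move=> dF; rewrite /wirtinger.
rewrite (@rderive_cderiv _ F z (ev j) 1 D dF); last by move=> t; rewrite mulr1 add0r.
rewrite (@rderive_cderiv _ F z (imag *: ev j) imag D dF); last by move=> t; rewrite scalerA add0r.
have -> : D * 1 - imag * (D * imag) = D * 1 - D * (imag * imag) by ring.
by rewrite imag2; field.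
Qed.

(** Here [F] is holomorphic in the conjugate variable, in which the direction i e_k is seen as
    -i. *)
Lemma wirtinger_bar_cderiv (F : V -> C) w k D :
  cderiv (fun t => F (conjv (conjv w + t *: ev k))) 0 D -> wirtinger_bar k F w = D.
Proof.
move=> dF; rewrite /wirtinger_bar.
have cE (t : C) : conjv (conjv w + t *: ev k) = w + conjc t *: ev k.
  by rewrite conjvD conjvK conjvZ conjv_ev.
rewrite (@rderive_cderiv _ F w (ev k) 1 D dF); last first.
  by move=> t; rewrite cE mulr1 add0r conjc_real.
rewrite (@rderive_cderiv _ F w (imag *: ev k) (- imag) D dF); last first.
  move=> t; rewrite cE scalerA add0r; congr (F (_ + _ *: _)).
  by apply: cplx_eq; rewrite ?cReJ ?cImJ ?cReM ?cImM /=; ring.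
have -> : D * 1 + imag * (D * - imag) = D * 1 - D * (imag * imag) by ring.
by rewrite imag2; field.
Qed.
End wirtinger_derivatives.

(** * Second differences of a symbol *)

Section symbol.
Variables (R : realType) (d : nat).
Local Notation C := R[i].
Local Notation V := 'rV[C]_d.
Local Notation ev j := (delta_mx 0 j : V).
Variable a : V -> V -> C.
Hypothesis ea : entire2 (fun p => a p.1 (conjv p.2)).

Lemma symbol_line1 (z v w : V) l : exists D, cderiv (fun l => a (z + l *: v) w) l D.
Proof.
have := @differentiable_cderiv R _ _ _ (v, 0 : V) (ea (z + l *: v, conjv w)).
set D := (X in cderiv _ _ X) => H; exists D; apply: (cderiv_recenter H) => h.
by rewrite add0r /= scaler0 addr0 conjvK scalerDl addrA.
Qed.

Lemma symbol_line2 (z x v : V) l : exists D, cderiv (fun l => a z (conjv (x + l *: v))) l D.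
Proof.
have := @differentiable_cderiv R _ _ _ (0 : V, v) (ea (z, x + l *: v)).
set D := (X in cderiv _ _ X) => H; exists D; apply: (cderiv_recenter H) => h.
by rewrite add0r /= scaler0 addr0 scalerDl addrA.
Qed.

Lemma continuous_conjv : continuous (@conjv R d).
Proof.
move=> z A /nbhs_rVP[e e0 eA]; apply/nbhs_rVP; exists e => // y yz.
by apply: eA => j; rewrite !mxE -rmorphB nrmJ.
Qed.

Lemma symbol_ccont (X : topologicalType) (u v : X -> V) t :
  {for t, continuous u} -> {for t, continuous v} -> ccont (fun t => a (u t) (v t)) t.
Proof.
move=> cu cv.
have cb p : ccont (fun p : V * V => a p.1 (conjv p.2)) p.
  by split; exact: differentiable_continuous (ea p).
have cv' : {for t, continuous (fun t => conjv (v t))}.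
  by apply: (continuous_comp cv); exact: continuous_conjv.
have := ccont_comp (continuous_pair_fun cu cv') (cb (u t, conjv (v t))).
by rewrite (_ : (fun t => a (u t) (v t)) = (fun t => a (u t) (conjv (conjv (v t)))))// ; apply/funext => x; rewrite conjvK.
Qed.

Lemma dbar_cderiv k (z x : V) l :
  cderiv (fun l => a z (conjv (x + l *: ev k))) l (wirtinger_bar k (a z) (conjv (x + l *: ev k))).
Proof.
have [D H] := symbol_line2 z x (ev k) l.
have -> : wirtinger_bar k (a z) (conjv (x + l *: ev k)) = D; last exact: H.
apply: wirtinger_bar_cderiv; apply: (cderiv_recenter H) => h.
by rewrite conjvK add0r scalerDl addrA.
Qed.

(** Local boundedness feeds the Cauchy estimates of [cderiv_mixed]; 9 is the square of the radius 3
    used there. *)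
Hypothesis bounded_a : forall z w : V, exists M : R, forall x y : V,
  sqnorm x <= 9 -> sqnorm y <= 9 -> nrm (a (z + x) (w + y)) <= M.

Lemma sqnorm_ev j (c : C) : sqnorm (c *: ev j) = nrm c ^+ 2.
Proof.
rewrite sqnormZ /sqnorm (bigD1 j)//= big1 ?addr0.
  by rewrite mxE !eqxx /= expr0n addr0 expr1n sqrtr1 expr1n mulr1.
by move=> i ij; rewrite mxE (negbTE ij) andbF nrm0 expr0n.
Qed.

(** That the derivative in the conjugate of w_k is again holomorphic in z_j is the content of
    [cderiv_mixed]. *)
Lemma d_dbar_cderiv j k (z w : V) l :
  cderiv (fun l => wirtinger_bar k (a (z + l *: ev j)) w) l
    (wirtinger j (fun z' => wirtinger_bar k (a z') w) (z + l *: ev j)).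
Proof.
pose B s t := a (z + s *: ev j) (conjv (conjv w + t *: ev k)).
have /choice[B1 dB1] : forall st : C * C, exists D, cderiv (fun s => B s st.2) st.1 D.
  by move=> [s t]; exact: symbol_line1.
pose B2 s t := wirtinger_bar k (a (z + s *: ev j)) (conjv (conjv w + t *: ev k)).
have dB2 s t : cderiv (B s) t (B2 s t) by exact: dbar_cderiv.
have [M bM] := bounded_a (z + l *: ev j) w.
have [||D HD] := @cderiv_mixed R B (fun s t => B1 (s, t)) B2 l 0 M _ dB2.
- by move=> s t; exact: (dB1 (s, t)).
- move=> s t s3 t3; rewrite /B scalerDl addrA add0r conjvD conjvK.
  have sq (c : C) : nrm c <= 3 -> nrm c ^+ 2 <= 9.
    by move=> c3; have := nrm_ge0 c; nra.
  by apply: bM; rewrite ?sqnorm_conjv sqnorm_ev sq.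
have {}HD : cderiv (fun l => wirtinger_bar k (a (z + l *: ev j)) w) l D.
  by apply: cderiv_ext HD => s; rewrite /B2 scale0r addr0 conjvK.
have E : wirtinger j (fun z' => wirtinger_bar k (a z') w) (z + l *: ev j) = D.
  apply: wirtinger_cderiv; apply: (cderiv_recenter HD) => h.
  by rewrite add0r scalerDl addrA.
by rewrite E.
Qed.

(** [mvt_cplx] is applied once in each variable, so the constant is 4 = 2 * 2. *)
Lemma second_difference j k (z w : V) (p q : C) (S : R) :
  (forall s t : R, 0 <= s <= 1 -> 0 <= t <= 1 ->
    nrm (wirtinger j (fun z' => wirtinger_bar k (a z') (w + (t%:C * q) *: ev k)) (z + (s%:C * p) *: ev j)) <= S) ->
  nrm (a (z + p *: ev j) (w + q *: ev k) - a z (w + q *: ev k)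
       - a (z + p *: ev j) w + a z w) <= 4 * (nrm p * nrm q) * S.
Proof.
move=> HS.
pose f l := a (z + p *: ev j) (conjv (conjv w + l *: ev k)) + - 1 * a z (conjv (conjv w + l *: ev k)).
pose f' l := wirtinger_bar k (a (z + p *: ev j)) (conjv (conjv w + l *: ev k))
  + - 1 * wirtinger_bar k (a z) (conjv (conjv w + l *: ev k)).
have df l : cderiv f l (f' l).
  have := cderivD (dbar_cderiv k (z + p *: ev j) (conjv w) l)
    (cderivM (cderiv_cst (- 1) l) (dbar_cderiv k z (conjv w) l)).
  by rewrite mul0r add0r.
have cE (t : C) : conjv (conjv w + t *: ev k) = w + conjc t *: ev k.
  by rewrite conjvD conjvK conjvZ conjv_ev.
(* The variable of [f] is conjugate: the increment [conjc q] moves [w] by [q]. *)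
have := @mvt_cplx R f f' 0 (conjc q) (2 * S * nrm p) df.
have -> : f (0 + conjc q) - f 0 = a (z + p *: ev j) (w + q *: ev k) - a z (w + q *: ev k)
       - a (z + p *: ev j) w + a z w.
  by rewrite /f !cE add0r conjcK conjc0 scale0r addr0; ring.
rewrite nrmJ (_ : 4 * (nrm p * nrm q) * S = 2 * (2 * S * nrm p) * nrm q); last by ring.
have cC (t : R) : conjc (t%:C * conjc q) = t%:C * q by rewrite rmorphM /= oppr0 conjcK.
apply=> t ht; rewrite add0r /f' cE cC mulN1r.
pose W := w + (t%:C * q) *: ev k.
have := @mvt_cplx R (fun l => wirtinger_bar k (a (z + l *: ev j)) W) _ 0 p S (fun l => d_dbar_cderiv j k z W l).
rewrite !add0r scale0r addr0. apply=> s hs; rewrite add0r; exact: HS.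
Qed.

(* Passing from [y] to [x] one coordinate at a time, so that each second
   difference only involves one pair of coordinates. *)
Definition mix (x y : V) (i : nat) : V := \row_l (if (l < i)%N then x 0 l else y 0 l).

Lemma mix0 x y : mix x y 0 = y.
Proof. by apply/rowP => l; rewrite mxE ltn0. Qed.
Lemma mixd x y : mix x y d = x.
Proof. by apply/rowP => l; rewrite mxE ltn_ord. Qed.
Lemma mixS x y (j : 'I_d) : mix x y j.+1 = mix x y j + (x 0 j - y 0 j) *: ev j.
Proof.
apply/rowP => l; rewrite !mxE eqxx /= ltnS leq_eqVlt -(inj_eq val_inj) /=.
case: eqP => [lj|lj] /=; last by rewrite mulr0 addr0.
by rewrite (val_inj lj) ltnn mulr1 addrC subrK.
Qed.

Lemma mix_segment x y (j l : 'I_d) (s : R) : 0 <= s <= 1 ->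
  exists2 c : R, 0 <= c <= 1 &
    (mix x y j + (s%:C * (x 0 j - y 0 j)) *: ev j) 0 l = y 0 l + c%:C * (x 0 l - y 0 l).
Proof.
move=> hs; rewrite !mxE eqxx /=; case: (ltngtP l j) => lj.
- exists 1; first by rewrite lexx ler01.
  rewrite (_ : (l == j) = false) ?mulr0 ?addr0; last by apply/eqP => E; rewrite E ltnn in lj.
  have -> : (1 : R)%:C = 1 by [].
  by rewrite mul1r addrC subrK.
- exists 0; first by rewrite lexx ler01.
  rewrite (_ : (l == j) = false) ?mulr0 ?addr0; last by apply/eqP => E; rewrite E ltnn in lj.
  have -> : (0 : R)%:C = 0 by [].
  by rewrite mul0r addr0.
- by exists s => //; rewrite (val_inj lj) eqxx mulr1.
Qed.

(** The two arguments move in opposite directions, so with parameters c, e in [0, 1] the l-th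
    coordinate of their difference is (c + e - 1)(z_l - w_l), and |c + e - 1| <= 1. This keeps the
    exponential growth of the derivatives under control. *)
Lemma sqnorm_mix z w (j k : 'I_d) (s t : R) : 0 <= s <= 1 -> 0 <= t <= 1 ->
  sqnorm (mix z w j + (s%:C * (z 0 j - w 0 j)) *: ev j
    - (mix w z k + (t%:C * (w 0 k - z 0 k)) *: ev k)) <= sqnorm (z - w).
Proof.
move=> hs ht; rewrite /sqnorm; apply: ler_sum => l _.
have [c /andP[c0 c1] Ec] := mix_segment z w j l hs.
have [e /andP[e0 e1] Ee] := mix_segment w z k l ht.
have sub (x y : V) : (x - y) 0 l = x 0 l - y 0 l by rewrite !mxE.
rewrite !sub Ec Ee.
have -> : w 0 l + c%:C * (z 0 l - w 0 l) - (z 0 l + e%:C * (w 0 l - z 0 l)) =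
   (c + e - 1)%:C * (z 0 l - w 0 l) by rewrite rmorphB rmorphD rmorph1 /=; ring.
rewrite nrmM nrm_real exprMn -[leRHS]mul1r ler_wpM2r ?sqr_ge0//.
by rewrite real_normK ?num_real//; nra.
Qed.

Lemma second_difference_total (z w : V) (S : R) : 0 <= S ->
  (forall (j k : 'I_d) x y, sqnorm (x - y) <= sqnorm (z - w) ->
    nrm (wirtinger j (fun z' => wirtinger_bar k (a z') y) x) <= S) ->
  nrm (a z w - a w w - a z z + a w z) <= 4 * d%:R ^+ 2 * sqnorm (z - w) * S.
Proof.
move=> S0 HS.
(* A grid whose corners g d d, g 0 d, g d 0, g 0 0 are a(z,w), a(w,w), a(z,z), a(w,z); the sum over
   its d^2 cells telescopes in both indices. *)
pose g i l := a (mix z w i) (mix w z l).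
have tel : a z w - a w w - a z z + a w z =
    \sum_(j < d) \sum_(k < d) (g j.+1 k.+1 - g j k.+1 - g j.+1 k + g j k).
  have inner (j : nat) : \sum_(k < d) (g j.+1 k.+1 - g j k.+1 - g j.+1 k + g j k) =
      (g j.+1 d - g j.+1 0%N) - (g j d - g j 0%N).
    rewrite -(big_mkord xpredT (fun k => g j.+1 k.+1 - g j k.+1 - g j.+1 k + g j k)).
    rewrite (eq_bigr (fun k => (g j.+1 k.+1 - g j k.+1) - (g j.+1 k - g j k))); last by move=> k _; ring.
    by rewrite (telescope_sumr (fun k => g j.+1 k - g j k))//; ring.
  under eq_bigr do rewrite inner.
  rewrite -(big_mkord xpredT (fun j => (g j.+1 d - g j.+1 0%N) - (g j d - g j 0%N))).
  rewrite (telescope_sumr (fun j => g j d - g j 0%N))// /g !mixd !mix0; ring.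
have nsum n (F : 'I_n -> C) (B : R) : (forall i, nrm (F i) <= B) -> nrm (\sum_i F i) <= n%:R * B.
  move=> FB; apply: (@le_trans _ _ (\sum_(i < n) B)); last by rewrite sumr_const card_ord mulr_natl.
  elim/big_ind2 : _ => //; first by rewrite nrm0.
  by move=> x1 x2 y1 y2 H1 H2; apply: le_trans (nrmD _ _) _; rewrite lerD.
rewrite tel; have -> : 4 * d%:R ^+ 2 * sqnorm (z - w) * S = d%:R * (d%:R * (4 * sqnorm (z - w) * S)) by ring.
apply: (nsum d) => j; apply: (nsum d) => k.
rewrite /g (mixS z w j) (mixS w z k).
have coord (i : 'I_d) : nrm (z 0 i - w 0 i) ^+ 2 <= sqnorm (z - w).
  rewrite /sqnorm (bigD1 i)//= !mxE lerDl; apply: sumr_ge0 => l _; exact: sqr_ge0.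
apply: le_trans (second_difference (S := S) _) _.
  by move=> s t hs ht; apply: HS; exact: sqnorm_mix.
rewrite ler_wpM2r// ler_wpM2l// [nrm (w 0 k - _)]nrmB.
have := coord j; have := coord k; set x := nrm _; set y := nrm _ => Hx Hy.
by have := sqr_ge0 (x - y); nra.
Qed.
End symbol.

(** * Estimates from the symbol class *)

Section symbol_bounds.
Variables (R : realType) (d : nat) (rho : R).
Local Notation C := R[i].
Local Notation V := 'rV[C]_d.
Variable a : V -> V -> C.
Hypotheses (rho_gt0 : 0 < rho) (rho_le1 : rho <= 1).
Hypothesis a_symbol : shubin_wick_symbol (fun z => japanese z `^ (2 * rho)) rho a.

Lemma sqnormD_le (x y : V) : sqnorm (x + y) <= 2 * sqnorm x + 2 * sqnorm y.
Proof. by have := sqnormDB x y; have := sqnorm_ge0 (x - y); lra. Qed.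

Lemma symbol_bound0 : exists2 K : R, 0 <= K & forall z w,
  nrm (a z w) <= K * (expR (sqnorm (z - w) / 2) * (1 + sqnorm z)).
Proof.
have [_ /(_ (fun=> 0%N) (fun=> 0%N) 0 (lexx 0))[K HK]] := a_symbol.
(* The sign of [K] is unknown, hence the absolute value; the 2 absorbs the sqrt 2 inside the
   weight. *)
exists (2 * `|K|) => [|z w]; first by rewrite mulr_ge0.
have := HK z w; rewrite /mixed_derivative !multi_zero.
rewrite [\sum_j _]big1// mulr0 oppr0 !powRr0 !mulr1 => /le_trans; apply.
set u := _ `^ _; have u0 : 0 <= u by exact: powR_ge0.
have e0 := expR_ge0 (sqnorm (z - w) / 2).
have uz : u <= 2 * (1 + sqnorm z).
  apply: le_trans (powR_le_sqr (japanese_ge1 _) rho_le1) _.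
  by rewrite japanese_sqr sqnorm_sqrt2; lra.
apply: (@le_trans _ _ (`|K| * (expR (sqnorm (z - w) / 2) * u))).
  by rewrite ler_wpM2r ?mulr_ge0// ler_norm.
have -> : 2 * `|K| * (expR (sqnorm (z - w) / 2) * (1 + sqnorm z)) =
  `|K| * (expR (sqnorm (z - w) / 2) * (2 * (1 + sqnorm z))) by ring.
by rewrite !ler_wpM2l.
Qed.

Lemma symbol_bounded (z w : V) : exists M : R, forall x y : V,
  sqnorm x <= 9 -> sqnorm y <= 9 -> nrm (a (z + x) (w + y)) <= M.
Proof.
have [K K0 HK] := symbol_bound0.
(* By |x + y|^2 <= 2|x|^2 + 2|y|^2: 72 = 2 (2 * 9 + 2 * 9) and 18 = 2 * 9. *)
exists (K * (expR ((2 * sqnorm (z - w) + 72) / 2) * (1 + (2 * sqnorm z + 18)))) => x y x9 y9.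
apply: le_trans (HK _ _) _; rewrite ler_wpM2l//; apply: ler_pM.
- exact: expR_ge0.
- by rewrite addr_ge0 ?sqnorm_ge0.
- rewrite ler_expR ler_wpM2r//.
  have -> : z + x - (w + y) = (z - w) + (x - y) by rewrite opprD addrACA.
  apply: le_trans (sqnormD_le _ _) _.
  by have := sqnormD_le x (- y); rewrite sqnormN; lra.
- by rewrite lerD2l; apply: le_trans (sqnormD_le _ _) _; lra.
Qed.

Lemma symbol_bound2 m : exists2 K : R, 0 <= K & forall (j k : 'I_d) (x y : V),
  nrm (wirtinger j (fun z' => wirtinger_bar k (a z') y) x) <=
  K * (expR (sqnorm (x - y) / 2) * (1 + sqnorm (x - y)) ^- m).
Proof.
have [_ H] := a_symbol.
have /choice[K HK] : forall jk : 'I_d * 'I_d, exists K : R, forall (x y : V),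
    nrm (wirtinger jk.1 (fun z' => wirtinger_bar jk.2 (a z') y) x) <=
    K * (expR (sqnorm (x - y) / 2) * (1 + sqnorm (x - y)) ^- m).
  move=> [j k] /=.
  (* N = 2(m+1) gives m+1 powers of 1 + |x-y|^2; one of them pays for [peetre_powR]. *)
  have N0 : 0 <= 2 * m.+1%:R :> R by rewrite mulr_ge0.
  have [K HK] := H (fun i => (i == j) : nat) (fun i => (i == k) : nat) _ N0.
  exists `|K| => x y; have := HK x y.
  rewrite /mixed_derivative multi_delta.
  have -> : (fun z' => multi wirtinger_bar (fun i => (i == k) : nat) (a z') y) =
      (fun z' => wirtinger_bar k (a z') y).
    by apply/funext => z'; rewrite multi_delta.
  move=> /le_trans; apply.
  have -> : (\sum_(i < d) ((i == j) + (i == k)))%N = 2%N.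
    have s1 (l : 'I_d) : (\sum_(i < d) (i == l))%N = 1%N.
      by rewrite (bigD1 l)//= eqxx big1// => i /negbTE ->.
    by rewrite big_split /= !s1.
  set u := japanese _ `^ _; set v := japanese _ `^ _; set q := sqnorm (x - y).
  have q0 : 0 <= q by exact: sqnorm_ge0.
  have uv : u * v <= 1 + q by exact: peetre_powR.
  have u0 : 0 <= u by exact: powR_ge0.
  have v0 : 0 <= v by exact: powR_ge0.
  rewrite powRN japanese_powR2n -/q.
  have q1 : 0 < 1 + q by rewrite ltr_pwDl.
  have qm : 0 <= (1 + q) ^- m.+1 by rewrite invr_ge0 exprn_ge0// ltW.
  apply: (@le_trans _ _ (`|K| * (expR (q / 2) * u * v * (1 + q) ^- m.+1))).
    exact: ler_wpM2r (mulr_ge0 (mulr_ge0 (mulr_ge0 (expR_ge0 _) u0) v0) qm) _ _ (ler_norm K).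
  rewrite ler_wpM2l// -!mulrA ler_wpM2l ?expR_ge0// mulrA.
  have -> : (1 + q) ^- m = (1 + q) * (1 + q) ^- m.+1.
    by rewrite exprS invfM mulrA divff ?mul1r// gt_eqF.
  by rewrite ler_wpM2r.
exists (\sum_jk `|K jk|) => [|j k x y]; first by apply: sumr_ge0.
apply: le_trans (HK (j, k) x y) _; rewrite ler_wpM2r//.
  by rewrite mulr_ge0 ?expR_ge0// invr_ge0 exprn_ge0// addr_ge0// sqnorm_ge0.
by rewrite (bigD1 (j, k))//=; apply: le_trans (ler_norm _) _; rewrite lerDl sumr_ge0.
Qed.

Lemma symbol_second_difference : exists2 K : R, 0 <= K & forall z w : V,
  nrm (a z w - a w w - a z z + a w z) <= K * (expR (sqnorm (z - w) / 2) * decay (z - w)).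
Proof.
(* 2d powers for [decay_ge], and one more to absorb the factor |z-w|^2 of
   [second_difference_total]. *)
pose m := (2 * d).+1.
have [K K0 HK] := symbol_bound2 m.
pose c : R := (2 * m.+1%:R) ^+ m.+1.
have c0 : 0 <= c by rewrite exprn_ge0// mulr_ge0.
have Kc0 : 0 <= 4 * d%:R ^+ 2 * (K * c) by apply: mulr_ge0; apply: mulr_ge0 => //; exact: sqr_ge0.
exists (4 * d%:R ^+ 2 * (K * c)) => [|z w] //.
set y := sqnorm (z - w); have y0 : 0 <= y by exact: sqnorm_ge0.
have y1 : 0 < 1 + y by rewrite ltr_pwDl.
pose S := K * (c * (expR (y / 2) * (1 + y) ^- m)).
have S0 : 0 <= S.
  apply: mulr_ge0 => //; apply: mulr_ge0 => //; apply: mulr_ge0; first exact: expR_ge0.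
  by rewrite invr_ge0 exprn_ge0// ltW.
apply: (@le_trans _ _ (4 * d%:R ^+ 2 * y * S)).
  apply: second_difference_total => //.
  - by case: a_symbol.
  - exact: symbol_bounded.
  - move=> j k x x' xx'; apply: le_trans (HK j k x x') _; rewrite ler_wpM2l//.
    by apply: gauss_decay_mono => //; exact: sqnorm_ge0.
have H : y * (1 + y) ^- m <= decay (z - w).
  apply: le_trans (decay_ge (z - w)); rewrite -/y /m exprS invfM mulrA.
  rewrite -[leRHS]mul1r ler_wpM2r ?invr_ge0 ?exprn_ge0 ?(ltW y1)//.
  by rewrite ler_pdivrMr// mul1r lerDr.
have -> : 4 * d%:R ^+ 2 * y * S = 4 * d%:R ^+ 2 * (K * c) * (expR (y / 2) * (y * (1 + y) ^- m)).
  by rewrite /S; ring.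
by rewrite ler_wpM2l// ler_wpM2l ?expR_ge0.
Qed.
End symbol_bounds.

(** * The quadratic form of the Wick operator *)

Section double_complex.
Variables (R : realType) (d : nat).
Local Notation C := R[i].
Local Notation V := 'rV[C]_d.
Local Notation L := (@lebesgueCd R d).
Local Notation vec := (@vec_of_tuple R d).
Local Notation T := (d.-tuple (measurableTypeR R * measurableTypeR R)%type).

Definition double_int (k : V * V -> C) : C :=
  (\int[(L \x L)%E]_p Re (k (vec p.1, vec p.2))) +i*
  (\int[(L \x L)%E]_p Im (k (vec p.1, vec p.2))).

Definition dominated2 (k : V * V -> C) :=
  (forall p, ccont k p) /\ exists M : R, forall z w, nrm (k (z, w)) <= M * decay z * decay w.

Lemma dominated2_integrable (k : V * V -> C) : dominated2 k ->
  (L \x L)%E.-integrable setT (fun p : T * T => (Re (k (vec p.1, vec p.2)))%:E) /\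
  (L \x L)%E.-integrable setT (fun p : T * T => (Im (k (vec p.1, vec p.2)))%:E).
Proof.
move=> [ck [M kM]]; split.
  apply: (double_integrable (f := fun p => Re (k p)) (M := M)); first exact: continuous_ReP.
  by move=> z w; apply: le_trans (Re_le _) _.
apply: (double_integrable (f := fun p => Im (k p)) (M := M)); first exact: continuous_ImP.
by move=> z w; apply: le_trans (Im_le _) _.
Qed.

Lemma double_int12 (k : V * V -> C) : dominated2 k ->
  integralCd (fun z => integralCd (fun w => k (z, w))) = double_int k.
Proof.
move=> [ck [M kM]]; rewrite /integralCd /double_int; congr (_ +i* _) => /=.
  apply: (Rintegral12 (f := fun p => Re (k p)) (M := M)); first exact: continuous_ReP.
  by move=> z w; apply: le_trans (Re_le _) _.
apply: (Rintegral12 (f := fun p => Im (k p)) (M := M)); first exact: continuous_ImP.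
by move=> z w; apply: le_trans (Im_le _) _.
Qed.

Lemma double_int21 (k : V * V -> C) : dominated2 k ->
  integralCd (fun w => integralCd (fun z => k (z, w))) = double_int k.
Proof.
move=> [ck [M kM]]; rewrite /integralCd /double_int; congr (_ +i* _) => /=.
  apply: (Rintegral21 (f := fun p => Re (k p)) (M := M)); first exact: continuous_ReP.
  by move=> z w; apply: le_trans (Re_le _) _.
apply: (Rintegral21 (f := fun p => Im (k p)) (M := M)); first exact: continuous_ImP.
by move=> z w; apply: le_trans (Im_le _) _.
Qed.

Lemma dominated2D k l : dominated2 k -> dominated2 l -> dominated2 (fun p => k p + l p).
Proof.
move=> [ck [M kM]] [cl [N lN]]; split; first by move=> p; exact: ccontD.
by exists (M + N) => z w; apply: le_trans (nrmD _ _) _; rewrite !mulrDl lerD.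
Qed.

Lemma dominated2N k : dominated2 k -> dominated2 (fun p => - k p).
Proof.
move=> [ck [M kM]]; split; first by move=> p; exact: ccontN.
by exists M => z w; rewrite nrmN.
Qed.

Lemma double_intD k l : dominated2 k -> dominated2 l ->
  double_int (fun p => k p + l p) = double_int k + double_int l.
Proof.
move=> /dominated2_integrable[k1 k2] /dominated2_integrable[l1 l2].
rewrite /double_int; apply: cplx_eq; rewrite ?cReD ?cImD /=.
  by under eq_Rintegral do rewrite cReD; rewrite RintegralD.
by under eq_Rintegral do rewrite cImD; rewrite RintegralD.
Qed.

Lemma double_intN k : dominated2 k -> double_int (fun p => - k p) = - double_int k.
Proof.
move=> /dominated2_integrable[k1 k2].
rewrite /double_int; apply: cplx_eq; rewrite ?cReN ?cImN /=.
  by under eq_Rintegral do rewrite cReN -mulN1r; rewrite RintegralZl// mulN1r.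
by under eq_Rintegral do rewrite cImN -mulN1r; rewrite RintegralZl// mulN1r.
Qed.

Lemma double_int_schur (k : V * V -> C) (f : V -> R) (K : R) : dominated2 k ->
  0 <= K -> continuous f -> (forall z, 0 <= f z) ->
  L.-integrable setT (fun t : T => (f (vec t) ^+ 2)%:E) ->
  (forall z w, nrm (k (z, w)) <= K * (decay (z - w) * (f z * f w))) ->
  `|Re (double_int k)| <= K * (pi ^+ 2) ^+ d * \int[L]_t (f (vec t) ^+ 2) /\
  `|Im (double_int k)| <= K * (pi ^+ 2) ^+ d * \int[L]_t (f (vec t) ^+ 2).
Proof.
move=> dk K0 cf f0 fi kK; have [iR iI] := dominated2_integrable dk.
have schur := schur_decay cf f0.
have key (g : T * T -> R) : (L \x L)%E.-integrable setT (fun p => (g p)%:E) ->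
    (forall p, `|g p| <= nrm (k (vec p.1, vec p.2))) ->
    `|\int[(L \x L)%E]_p g p| <= K * (pi ^+ 2) ^+ d * \int[L]_t (f (vec t) ^+ 2).
  move=> ig gk; rewrite -lee_fin EFin_normr_Rintegral//.
  apply: le_trans (le_abse_integral _ _ (measurable_int _ ig)) _ => //.
  apply: (@le_trans _ _ (\int[(L \x L)%E]_p (K%:E * (decay (vec p.1 - vec p.2) * (f (vec p.1) * f (vec p.2)))%:E))%E).
    apply: ge0_le_integral => //.
    - exact: measurableT_comp (measurable_int _ ig).
    - apply: measurable_funeM; apply/measurable_EFinP.
      apply: (measurable_vec2 (f := fun p : V * V => decay (p.1 - p.2 : V) * (f p.1 * f p.2))).
      apply: rcont_continuous => p; apply: rcontM.
        apply: (rcont_decay (u := fun p : V * V => p.1 - p.2 : V)).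
        by apply: (@continuous_subV _ _ _ fst snd); [exact: cvg_fst|exact: cvg_snd].
      apply: rcontM; (apply: rcont_compT; last by split; exact: cf).
        exact: cvg_fst.
      exact: cvg_snd.
    - by move=> p _; rewrite abse_EFin -EFinM lee_fin; apply: le_trans (gk p) _.
  rewrite ge0_integralZl//; last 2 first.
  - apply/measurable_EFinP.
    apply: (measurable_vec2 (f := fun p : V * V => decay (p.1 - p.2 : V) * (f p.1 * f p.2))).
    apply: rcont_continuous => p; apply: rcontM.
      apply: (rcont_decay (u := fun p : V * V => p.1 - p.2 : V)).
      by apply: (@continuous_subV _ _ _ fst snd); [exact: cvg_fst|exact: cvg_snd].
    apply: rcontM; (apply: rcont_compT; last by split; exact: cf).
      exact: cvg_fst.
    exact: cvg_snd.
  - by move=> p _; rewrite lee_fin !mulr_ge0// decay_ge0.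
  rewrite -mulrA EFinM; apply: lee_wpmul2l; first by rewrite lee_fin.
  by rewrite EFinM fineK//; exact: integrable_fin_num.
split; apply: key => // p /=; [exact: Re_le|exact: Im_le].
Qed.
End double_complex.

Lemma decay_le1 (R : realType) d (z : 'rV[R[i]]_d) : decay z <= 1.
Proof.
rewrite /decay; apply: le_trans (_ : \prod_(j < d) (1 : R) <= _); last by rewrite big1.
apply: ler_prod => j _; have v1 (x : R) : 0 <= (oneDsqr x)^-1 <= 1.
  by rewrite invr_ge0 (le_trans _ (oneDsqr_ge1 x))//= oneDsqrV_le1.
have /andP[p0 p1] := v1 (Re (z 0 j)); have /andP[q0 q1] := v1 (Im (z 0 j)).
by rewrite mulr_ge0//= mulr_ile1.
Qed.

(** * Comparison with the anti-Wick form *)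

Section wick_form.
Variables (R : realType) (d : nat) (rho : R).
Local Notation C := R[i].
Local Notation V := 'rV[C]_d.
Local Notation L := (@lebesgueCd R d).
Local Notation vec := (@vec_of_tuple R d).
Local Notation T := (d.-tuple (measurableTypeR R * measurableTypeR R)%type).
Variables (a : V -> V -> C) (F : V -> C).
Hypotheses (rho_gt0 : 0 < rho) (rho_le1 : rho <= 1).
Hypothesis a_symbol : shubin_wick_symbol (fun z => japanese z `^ (2 * rho)) rho a.
Hypothesis F_schwartz : A_schwartz F.

Let f (z : V) : R := nrm (F z) * expR (- (sqnorm z / 2)).
Let c : C := (pi%:C ^+ d)^-1.

Let f_ge0 z : 0 <= f z.
Proof. by rewrite mulr_ge0 ?nrm_ge0 ?expR_ge0. Qed.

Let ccont_F z : ccont F z.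
Proof. by split; exact: differentiable_continuous (F_schwartz.1 z). Qed.

Let F_lines : entire_on_lines F.
Proof.
move=> u v l; have := @differentiable_cderiv R _ F (u + l *: v) v (F_schwartz.1 _).
set D := (X in cderiv _ _ X) => H; exists D; apply: (cderiv_recenter H) => h.
by rewrite add0r scalerDl addrA.
Qed.

Let continuous_f : continuous f.
Proof.
apply: rcont_continuous => z; apply: rcontM; first exact: rcont_nrm.
apply: rcont_expR; apply: rcontN; apply: rcontM; last exact: rcont_cst.
by apply: (rcont_sqnorm (u := id)); exact: cvg_id.
Qed.

Let f_decay : exists2 K : R, 0 <= K & forall z, (1 + sqnorm z) * f z <= K * decay z.
Proof.
(* 2d powers of 1 + |z|^2 produce [decay], and one more compensates the quadratic growth of the
   symbol. *)
have r0 : 0 < 2 * (2 * d).+1%:R :> R by rewrite mulr_gt0.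
have [K HK] := F_schwartz.2 _ r0.
have K0 : 0 <= K.
  by apply: le_trans (HK 0); rewrite !mulr_ge0 ?nrm_ge0 ?expR_ge0 ?powR_ge0.
exists K => // z; have z0 := sqnorm_ge0 z; have z1 : 0 < 1 + sqnorm z by rewrite ltr_pwDl.
have := HK z; rewrite japanese_powR2n -/(f z) exprS => H.
apply: le_trans (_ : K * (1 + sqnorm z) ^- (2 * d) <= _); last by rewrite ler_wpM2l// decay_ge.
by rewrite ler_pdivlMr ?exprn_gt0//; apply: le_trans H; rewrite -mulrA mulrCA mulrA.
Qed.

Let cpi : c * (pi ^+ d)%:C = 1.
Proof. by rewrite rmorphXn /= mulVf// expf_neq0// -nrm_gt0 nrm_real gtr0_norm ?pi_gt0. Qed.

Let cE : c = ((pi ^+ d)^-1)%:C.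
Proof. by rewrite /c fmorphV rmorphXn. Qed.

(** One of the two factors pi^{-d} is built in, so that integrating out a variable by the
    reproducing formula leaves no constant. *)
Let kernel (p : V * V) : C :=
  c * (F p.2 * conjc (F p.1) * cexp (herm (p.1 - p.2) p.2) * (expR (- sqnorm p.1))%:C).

Let nrm_kernel z w : nrm (kernel (z, w)) = nrm c * (f z * f w * expR (- (sqnorm (z - w) / 2))).
Proof.
rewrite /kernel /f !nrmM nrmJ nrm_cexp nrm_real ger0_norm ?expR_ge0//= Re_herm.
have -> : expR ((sqnorm z - sqnorm w - sqnorm (z - w)) / 2) =
   expR (- (sqnorm w / 2)) * expR (- (sqnorm (z - w) / 2)) * expR (sqnorm z / 2).
  by rewrite -!expRD; congr expR; field.
have -> : expR (- sqnorm z) = expR (- (sqnorm z / 2)) * expR (- (sqnorm z / 2)).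
  by rewrite -expRD; congr expR; field.
have E : expR (sqnorm z / 2) * expR (- (sqnorm z / 2)) = 1 by rewrite -expRD subrr expR0.
transitivity (nrm c * (nrm (F w) * nrm (F z) * (expR (- (sqnorm w / 2)) * expR (- (sqnorm (z - w) / 2)))
   * expR (- (sqnorm z / 2)) * (expR (sqnorm z / 2) * expR (- (sqnorm z / 2))))); first by ring.
by rewrite E; ring.
Qed.

Let ccont_kernel p : ccont kernel p.
Proof.
have c1 : {for p, continuous (fun p : V * V => p.1)} by exact: cvg_fst.
have c2 : {for p, continuous (fun p : V * V => p.2)} by exact: cvg_snd.
apply: ccontM; first exact: ccont_cst.
apply: ccontM.
  apply: ccontM; last exact: ccont_wick_kernel c1 c2.
  apply: ccontM; first exact: ccont_comp c2 (ccont_F _).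
  by apply: ccont_conj; exact: ccont_comp c1 (ccont_F _).
apply: ccont_real; apply: rcont_expR; apply: rcontN; exact: rcont_sqnorm c1.
Qed.

(** The exponential allowed to [s] cancels the Gaussian of the kernel exactly; the polynomial
    factors are absorbed by [f_decay], one in each variable. *)
Let dominated_mul (s : V * V -> C) (K : R) : 0 <= K -> (forall p, ccont s p) ->
  (forall z w, nrm (s (z, w)) <= K * (expR (sqnorm (z - w) / 2) * ((1 + sqnorm z) * (1 + sqnorm w)))) ->
  dominated2 (fun p => s p * kernel p).
Proof.
move=> K0 cs HK; have [Kf Kf0 Hf] := f_decay; split; first by move=> p; exact: ccontM.
exists (nrm c * K * (Kf * Kf)) => z w; rewrite nrmM nrm_kernel.
have c0 := nrm_ge0 c.
have E : expR (sqnorm (z - w) / 2) * expR (- (sqnorm (z - w) / 2)) = 1 by rewrite -expRD subrr expR0.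
apply: (@le_trans _ _ (K * (expR (sqnorm (z - w) / 2) * ((1 + sqnorm z) * (1 + sqnorm w)))
    * (nrm c * (f z * f w * expR (- (sqnorm (z - w) / 2)))))).
  rewrite ler_wpM2r//; apply: mulr_ge0 => //; apply: mulr_ge0; last exact: expR_ge0.
  by apply: mulr_ge0; exact: f_ge0.
have -> : K * (expR (sqnorm (z - w) / 2) * ((1 + sqnorm z) * (1 + sqnorm w)))
    * (nrm c * (f z * f w * expR (- (sqnorm (z - w) / 2)))) =
  nrm c * K * (((1 + sqnorm z) * f z) * ((1 + sqnorm w) * f w))
    * (expR (sqnorm (z - w) / 2) * expR (- (sqnorm (z - w) / 2))) by ring.
rewrite E mulr1.
have -> : nrm c * K * (Kf * Kf) * decay z * decay w = nrm c * K * ((Kf * decay z) * (Kf * decay w)) by ring.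
have p x : 0 <= (1 + sqnorm x) * f x.
  by apply: mulr_ge0; [rewrite addr_ge0// sqnorm_ge0|exact: f_ge0].
by rewrite ler_wpM2l ?mulr_ge0//; apply: ler_pM.
Qed.

Let k1 (p : V * V) := a p.1 p.2 * kernel p.
Let k2 (p : V * V) := a p.2 p.2 * kernel p.
Let k3 (p : V * V) := a p.1 p.1 * kernel p.
Let k4 (p : V * V) := a p.2 p.1 * kernel p.

Let a_cont (X : topologicalType) (u v : X -> V) t :
  {for t, continuous u} -> {for t, continuous v} -> ccont (fun t => a (u t) (v t)) t.
Proof. exact (symbol_ccont a_symbol.1 (u := u) (v := v) (t := t)). Qed.

Let dominated_ks : [/\ dominated2 k1, dominated2 k2, dominated2 k3 & dominated2 k4].
Proof.
have [K K0 HK] := symbol_bound0 rho_le1 a_symbol.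
have c1 p : {for p, continuous (fun p : V * V => p.1)} by exact: cvg_fst.
have c2 p : {for p, continuous (fun p : V * V => p.2)} by exact: cvg_snd.
have e1 (x : V) : 1 <= expR (sqnorm x / 2).
  by rewrite -expR0 ler_expR divr_ge0// sqnorm_ge0.
have e0 (x : V) : 0 <= expR (sqnorm x / 2) by exact: expR_ge0.
have s0 (x : V) := sqnorm_ge0 x.
(* One estimate for all four choices of the arguments (x, y) among z and w: they are never further
   apart than z and w. *)
have H z w x y : sqnorm (x - y) <= sqnorm (z - w) -> sqnorm x <= sqnorm z + sqnorm w + sqnorm z * sqnorm w ->
    nrm (a x y) <= K * (expR (sqnorm (z - w) / 2) * ((1 + sqnorm z) * (1 + sqnorm w))).
  move=> xy xz; apply: le_trans (HK x y) _; rewrite ler_wpM2l//; apply: ler_pM => //.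
  - by rewrite addr_ge0 ?sqnorm_ge0.
  - by rewrite ler_expR ler_wpM2r.
  - rewrite (_ : (1 + sqnorm z) * (1 + sqnorm w) = 1 + (sqnorm z + sqnorm w + sqnorm z * sqnorm w)); last by ring.
    by rewrite lerD2l.
have zw (z w : V) : 0 <= sqnorm z * sqnorm w by rewrite mulr_ge0 ?sqnorm_ge0.
have n0 : sqnorm (0 : V) = 0 by rewrite /sqnorm big1// => i _; rewrite mxE nrm0 expr0n.
split.
- apply: (dominated_mul (s := fun p => a p.1 p.2) K0) => [p|z w /=].
    exact (a_cont (c1 p) (c2 p)).
  by apply: H => //; have := zw z w; have := s0 w; lra.
- apply: (dominated_mul (s := fun p => a p.2 p.2) K0) => [p|z w /=].
    exact (a_cont (c2 p) (c2 p)).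
  by apply: H; rewrite ?subrr ?n0 ?sqnorm_ge0//; have := zw z w; have := s0 z; lra.
- apply: (dominated_mul (s := fun p => a p.1 p.1) K0) => [p|z w /=].
    exact (a_cont (c1 p) (c1 p)).
  by apply: H; rewrite ?subrr ?n0 ?sqnorm_ge0//; have := zw z w; have := s0 w; lra.
- apply: (dominated_mul (s := fun p => a p.2 p.1) K0) => [p|z w /=].
    exact (a_cont (c2 p) (c1 p)).
  apply: H; first by rewrite -sqnormN opprB.
  by have := zw z w; have := s0 z; lra.
Qed.

Let anti_wick : C :=
  integralCd (fun z => a z z * (nrm (F z) ^+ 2)%:C * (expR (- sqnorm z))%:C).

Let anti_wick_dominated :
  dominated (fun z => a z z * (nrm (F z) ^+ 2)%:C * (expR (- sqnorm z))%:C).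
Proof.
have [K K0 HK] := symbol_bound0 rho_le1 a_symbol; have [Kf Kf0 Hf] := f_decay.
split=> [z|].
  apply: ccontM; last first.
    apply: ccont_real; apply: rcont_expR; apply: rcontN; apply: (rcont_sqnorm (u := id)); exact: cvg_id.
  apply: ccontM; first by apply: (@a_cont _ id id); exact: cvg_id.
  apply: ccont_real; rewrite (_ : (fun _ => _) = (fun z => nrm (F z) * nrm (F z)))//.
  by apply: rcontM; exact: rcont_nrm.
exists (K * (Kf * Kf)) => z; have z0 := sqnorm_ge0 z.
have E : nrm (a z z * (nrm (F z) ^+ 2)%:C * (expR (- sqnorm z))%:C) = nrm (a z z) * (f z * f z).
  rewrite !nrmM !nrm_real !ger0_norm ?sqr_ge0 ?expR_ge0// /f.
  have -> : expR (- sqnorm z) = expR (- (sqnorm z / 2)) * expR (- (sqnorm z / 2)).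
    by rewrite -expRD; congr expR; field.
  by ring.
have H : nrm (a z z) <= K * (1 + sqnorm z).
  apply: le_trans (HK z z) _.
  by rewrite subrr /sqnorm big1 ?mul0r ?expR0 ?mul1r// => i _; rewrite mxE nrm0 expr0n.
have fK : f z <= Kf.
  apply: (@le_trans _ _ ((1 + sqnorm z) * f z)); first by rewrite ler_peMl// lerDl.
  by apply: le_trans (Hf z) _; rewrite ler_piMr// decay_le1.
rewrite E; apply: le_trans (ler_wpM2r _ H) _; first by apply: mulr_ge0; exact: f_ge0.
have -> : K * (1 + sqnorm z) * (f z * f z) = K * (f z * ((1 + sqnorm z) * f z)) by ring.
rewrite (_ : K * (Kf * Kf) * decay z = K * (Kf * (Kf * decay z))); last by ring.
apply: ler_wpM2l => //; apply: ler_pM; [exact: f_ge0| |exact: fK|exact: Hf].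
by apply: mulr_ge0; [rewrite addr_ge0|exact: f_ge0].
Qed.

Let FJ z : F z * conjc (F z) = (nrm (F z) ^+ 2)%:C.
Proof. by rewrite nrm_sqr; apply: cplx_eq; rewrite ?cReM ?cImM cReJ cImJ /=; ring. Qed.

(** Supplies, at a fixed point z, the domination required by [reproducing]. *)
Let wick_dominated (s : V -> C) z (K : R) : 0 <= K ->
  (forall w, nrm (s w) <= K * (expR (sqnorm (z - w) / 2) * (1 + sqnorm w))) ->
  exists M : R, forall w, nrm (s w * F w) * expR (Re (herm (z - w) w)) <= M * decay w.
Proof.
move=> K0 HK; have [Kf Kf0 Hf] := f_decay.
exists (K * Kf * expR (sqnorm z / 2)) => w; rewrite nrmM Re_herm.
have -> : expR ((sqnorm z - sqnorm w - sqnorm (z - w)) / 2) =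
   expR (- (sqnorm w / 2)) * expR (- (sqnorm (z - w) / 2)) * expR (sqnorm z / 2).
  by rewrite -!expRD; congr expR; field.
have E : expR (sqnorm (z - w) / 2) * expR (- (sqnorm (z - w) / 2)) = 1 by rewrite -expRD subrr expR0.
set q := expR (- (sqnorm (z - w) / 2)) in E *; have q0 : 0 <= q by exact: expR_ge0.
set e := expR (sqnorm z / 2); have e0 : 0 <= e by exact: expR_ge0.
have -> : nrm (s w) * nrm (F w) * (expR (- (sqnorm w / 2)) * q * e) = nrm (s w) * (f w * q * e).
  by rewrite /f; ring.
apply: (@le_trans _ _ (K * (expR (sqnorm (z - w) / 2) * (1 + sqnorm w)) * (f w * q * e))).
  by rewrite ler_wpM2r//; apply: mulr_ge0 => //; apply: mulr_ge0 => //; exact: f_ge0.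
have -> : K * (expR (sqnorm (z - w) / 2) * (1 + sqnorm w)) * (f w * q * e) =
  K * e * ((1 + sqnorm w) * f w) * (expR (sqnorm (z - w) / 2) * q) by ring.
rewrite E mulr1 (_ : K * Kf * e * decay w = K * e * (Kf * decay w)); last by ring.
by rewrite ler_wpM2l// mulr_ge0.
Qed.

Let wick_dominatedP (G : V -> C) z : (forall u, ccont G u) ->
  (exists M : R, forall w, nrm (G w) * expR (Re (herm (z - w) w)) <= M * decay w) ->
  dominated (fun w => G w * cexp (herm (z - w) w)).
Proof.
move=> cG [M HM]; split; last by exists M => w; rewrite nrmM nrm_cexp.
move=> w; apply: ccontM => //; apply: (@ccont_wick_kernel _ _ _ (fun=> z) id); last exact: cvg_id.
exact: (@cst_continuous _ _ z).
Qed.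

Let a_dom1 z : exists M : R, forall w, nrm (1 * F w) * expR (Re (herm (z - w) w)) <= M * decay w.
Proof.
apply: (wick_dominated (s := fun=> 1) (K := 1)) => // w; rewrite mul1r nrm1.
rewrite -[leLHS]mulr1; apply: ler_pM => //; last by rewrite lerDl sqnorm_ge0.
by rewrite -expR0 ler_expR divr_ge0// sqnorm_ge0.
Qed.

(** For fixed z the factor a(z,z) is constant in w, and F alone is reproduced. *)
Let double_k3 : double_int k3 = anti_wick.
Proof.
have [_ _ d3 _] := dominated_ks; rewrite -(double_int12 d3); congr integralCd; apply/funext => z.
have [M HM] := a_dom1 z.
have cG u : ccont (fun w => 1 * F w) u by apply: ccontM => //; exact: ccont_cst.
have eG : entire_on_lines (fun w => 1 * F w).
  by move=> u v l; have [D H] := F_lines u v l; exists D; apply: cderiv_ext H => y; rewrite mul1r.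
have -> : (fun w => k3 (z, w)) = (fun w => (a z z * c * conjc (F z) * (expR (- sqnorm z))%:C) *
    (1 * F w * cexp (herm (z - w) w))).
  by apply/funext => w; rewrite /k3 /kernel /=; ring.
rewrite integralCdZ; last by apply: wick_dominatedP => //; exists M.
rewrite (reproducing cG eG HM) -FJ.
transitivity (a z z * (F z * conjc (F z)) * (expR (- sqnorm z))%:C * (c * (pi ^+ d)%:C)); first by ring.
by rewrite cpi mulr1.
Qed.

(** a(w,z) is holomorphic in w, so the product a(w,z) F(w) is reproduced at w = z. *)
Let double_k4 : double_int k4 = anti_wick.
Proof.
have [_ _ _ d4] := dominated_ks; rewrite -(double_int12 d4); congr integralCd; apply/funext => z.
have [K K0 HK] := symbol_bound0 rho_le1 a_symbol.
have [|M HM] := @wick_dominated (fun w => a w z) z K K0.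
  by move=> w; rewrite -(sqnormN (z - w)) opprB; exact: HK.
have ca u : ccont (fun w => a w z) u.
  apply: (@a_cont _ id (fun=> z)); first exact: cvg_id.
  exact: (@cst_continuous _ _ z).
have cG u : ccont (fun w => a w z * F w) u by apply: ccontM.
have eG : entire_on_lines (fun w => a w z * F w).
  move=> u v l; have [D H] := F_lines u v l.
  have [D' H'] := symbol_line1 a_symbol.1 u v z l.
  by eexists; exact: cderivM H' H.
have -> : (fun w => k4 (z, w)) = (fun w => (c * conjc (F z) * (expR (- sqnorm z))%:C) *
    (a w z * F w * cexp (herm (z - w) w))).
  by apply/funext => w; rewrite /k4 /kernel /=; ring.
rewrite integralCdZ; last by apply: wick_dominatedP => //; exists M.
rewrite (reproducing cG eG HM) -FJ.
transitivity (a z z * (F z * conjc (F z)) * (expR (- sqnorm z))%:C * (c * (pi ^+ d)%:C)); first by ring.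
by rewrite cpi mulr1.
Qed.

Let conjc_cexp (x : C) : conjc (cexp x) = cexp (conjc x).
Proof. by case: x => u v; apply: cplx_eq; rewrite ?cReJ ?cImJ /= ?cosN ?sinN ?mulrN. Qed.

(** Here a(w,w) is neither holomorphic nor antiholomorphic in w, so z is integrated first; the
    integrand being antiholomorphic in z up to the kernel, F is reproduced at w after
    conjugation. *)
Let double_k2 : double_int k2 = anti_wick.
Proof.
have [_ d2 _ _] := dominated_ks; rewrite -(double_int21 d2); congr integralCd; apply/funext => w.
have [M HM] := a_dom1 w.
have cG u : ccont (fun w => 1 * F w) u by apply: ccontM => //; exact: ccont_cst.
have eG : entire_on_lines (fun w => 1 * F w).
  by move=> u v l; have [D H] := F_lines u v l; exists D; apply: cderiv_ext H => y; rewrite mul1r.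
have dG : dominated (fun z => 1 * F z * cexp (herm (w - z) z)).
  by apply: wick_dominatedP => //; exists M.
have dJ : dominated (fun z => conjc (1 * F z * cexp (herm (w - z) z))).
  split=> [u|]; first by apply: ccont_conj; exact: dG.1.
  by have [_ [N HN]] := dG; exists N => u; rewrite nrmJ.
have cJ (x y : C) : conjc (x * y) = conjc x * conjc y by exact: rmorphM.
have -> : (fun z => k2 (z, w)) = (fun z => (a w w * c * F w * (expR (- sqnorm w))%:C) *
    conjc (1 * F z * cexp (herm (w - z) z))).
  apply/funext => z; rewrite mul1r cJ conjc_cexp hermJ /k2 /kernel -![(z, w).1]/z -![(z, w).2]/w.
  have er (x : R) : (expR x)%:C = cexp x%:C.
    by apply: cplx_eq; rewrite /= ?cos0 ?sin0 ?mulr1 ?mulr0.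
  transitivity (a w w * c * F w * conjc (F z) * (cexp (herm (z - w) w) * (expR (- sqnorm z))%:C)); first by ring.
  transitivity (a w w * c * F w * conjc (F z) * ((expR (- sqnorm w))%:C * cexp (herm z (w - z)))); last by ring.
  congr (_ * _); rewrite !er -!cexpD; congr cexp.
  (* Both exponents equal (z,w) - |z|^2 - |w|^2. *)
  rewrite hermDl hermNl hermDr hermNr !herm_sqnorm !rmorphN /=; ring.
rewrite integralCdZ// integralCd_conj// (reproducing cG eG HM) cJ conjc_real mul1r -FJ.
transitivity (a w w * (F w * conjc (F w)) * (expR (- sqnorm w))%:C * (c * (pi ^+ d)%:C)); last by rewrite cpi mulr1.
ring.
Qed.

Let wick_innerE : A2_inner (wick_op a F) F = c * double_int k1.
Proof.
have [d1 _ _ _] := dominated_ks; rewrite -(double_int12 d1) /A2_inner -/c; congr (_ * _).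
congr integralCd; apply/funext => z; rewrite /wick_op -/c.
have [K K0 HK] := symbol_bound0 rho_le1 a_symbol.
have [||M HM] := @wick_dominated (fun w => a z w) z (K * (1 + sqnorm z)).
- by rewrite mulr_ge0// addr_ge0// sqnorm_ge0.
- move=> w; apply: le_trans (HK z w) _.
  have -> : K * (1 + sqnorm z) * (expR (sqnorm (z - w) / 2) * (1 + sqnorm w)) =
    K * (expR (sqnorm (z - w) / 2) * (1 + sqnorm z)) * (1 + sqnorm w) by ring.
  rewrite ler_peMr ?lerDl ?sqnorm_ge0//.
  by rewrite !mulr_ge0 ?expR_ge0// addr_ge0// sqnorm_ge0.
have ca u : ccont (fun w => a z w) u.
  apply: (@a_cont _ (fun=> z) id); last exact: cvg_id.
  exact: (@cst_continuous _ _ z).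
have cG u : ccont (fun w => a z w * F w) u by apply: ccontM.
have -> : (fun w => k1 (z, w)) = (fun w => (c * conjc (F z) * (expR (- sqnorm z))%:C) *
    (a z w * F w * cexp (herm (z - w) w))).
  by apply/funext => w; rewrite /k1 /kernel /=; ring.
rewrite integralCdZ; first by ring.
by apply: wick_dominatedP => //; exists M.
Qed.

Let f2 z : f z ^+ 2 = nrm (F z) ^+ 2 * expR (- sqnorm z).
Proof. by rewrite /f exprMn -expRM_natl; congr (_ * expR _); field. Qed.

Let S := \int[L]_t (f (vec t) ^+ 2).

Let f2_integrable : L.-integrable setT (fun t : T => (f (vec t) ^+ 2)%:E).
Proof.
have [Kf Kf0 Hf] := f_decay.
apply: (le_decay_integrable (f := fun z => f z ^+ 2) (M := Kf * Kf)) => [z|z].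
  apply: rcontP; rewrite (_ : (fun _ => _) = (fun z => f z * f z))//.
  by apply: rcontM; split; exact: continuous_f.
have fK : f z <= Kf * decay z.
  by apply: le_trans (Hf z); rewrite ler_peMl// lerDl sqnorm_ge0.
have d1 := decay_le1 z.
rewrite ger0_norm ?sqr_ge0// expr2; have d0 := decay_ge0 z.
apply: (@le_trans _ _ ((Kf * decay z) * (Kf * decay z))); first exact: ler_pM.
have -> : Kf * decay z * (Kf * decay z) = Kf * Kf * decay z * decay z by ring.
by rewrite ler_piMr// !mulr_ge0.
Qed.

Let S_ge0 : 0 <= S.
Proof. by apply: Rintegral_ge0 => t _; rewrite sqr_ge0. Qed.

Let A2_normE : A2_norm F ^+ 2 = (pi ^+ d)^-1 * S.
Proof.
have E : complex.Re (A2_inner F F) = (pi ^+ d)^-1 * S.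
  rewrite /A2_inner -/c cE cReM /= mul0r subr0; congr (_ * _).
  by apply: eq_Rintegral => t _; rewrite FJ f2 cReM /= mulr0 subr0.
by rewrite /A2_norm E sqr_sqrtr// mulr_ge0// invr_ge0 exprn_ge0// pi_ge0.
Qed.

Lemma wick_form_bounds (C0 K : R) : 0 <= K -> (forall w : V, - C0%:C <= a w w) ->
  (forall z w : V, nrm (a z w - a w w - a z z + a w z) <= K * (expR (sqnorm (z - w) / 2) * decay (z - w))) ->
  - ((pi ^+ d)^-1 * K * (pi ^+ 2) ^+ d + C0) * A2_norm F ^+ 2 <= Re (A2_inner (wick_op a F) F) /\
  `|Im (A2_inner (wick_op a F) F)| <= (pi ^+ d)^-1 * K * (pi ^+ 2) ^+ d * A2_norm F ^+ 2.
Proof.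
move=> K0 aC0 HK; have [d1 d2 d3 d4] := dominated_ks.
have pd0 : 0 <= (pi ^+ d)^-1 :> R by rewrite invr_ge0 exprn_ge0// pi_ge0.
pose delta p := k1 p + - k2 p + (- k3 p + k4 p).
have dd : dominated2 delta.
  by apply: dominated2D; apply: dominated2D => //; exact: dominated2N.
have E : double_int k1 = double_int delta + anti_wick.
  rewrite /delta double_intD; last 2 first.
  - by apply: dominated2D => //; exact: dominated2N.
  - by apply: dominated2D => //; exact: dominated2N.
  rewrite !double_intD//; try exact: dominated2N.
  by rewrite !double_intN// double_k2 double_k3 double_k4; ring.
have nc : nrm c = (pi ^+ d)^-1 by rewrite cE nrm_real ger0_norm.
have [||DR DI] := @double_int_schur R d delta f ((pi ^+ d)^-1 * K) dd _ continuous_f f_ge0 f2_integrable.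
- by rewrite mulr_ge0.
- move=> z w; have -> : delta (z, w) = (a z w - a w w - a z z + a w z) * kernel (z, w).
    by rewrite /delta /k1 /k2 /k3 /k4 /=; ring.
  rewrite nrmM nrm_kernel nc.
  have e1 : expR (sqnorm (z - w) / 2) * expR (- (sqnorm (z - w) / 2)) = 1 by rewrite -expRD subrr expR0.
  apply: le_trans (ler_wpM2r _ (HK z w)) _.
    apply: mulr_ge0 => //; apply: mulr_ge0; last exact: expR_ge0.
    by apply: mulr_ge0; exact: f_ge0.
  rewrite le_eqVlt; apply/orP; left; apply/eqP.
  transitivity ((pi ^+ d)^-1 * K * (decay (z - w) * (f z * f w))
     * (expR (sqnorm (z - w) / 2) * expR (- (sqnorm (z - w) / 2)))); first by ring.
  by rewrite e1 mulr1.
(* The order on complex numbers compares real parts of numbers with equal imaginary parts, so the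
   lower bound contains the reality of a(z,z). *)
have aR z : Im (a z z) = 0 /\ - C0 <= Re (a z z).
  by have := aC0 z; rewrite lecE /= oppr0 => /andP[/eqP -> ->].
have AI : Im anti_wick = 0.
  rewrite /anti_wick /integralCd /=.
  have -> : (fun t : T => Im (a (vec t) (vec t) * (nrm (F (vec t)) ^+ 2)%:C * (expR (- sqnorm (vec t)))%:C)) = (fun=> 0).
    by apply/funext => t; rewrite !cImM !cReM /= (aR _).1; ring.
  by rewrite Rintegral_cst// mul0r.
have AR : - C0 * S <= Re anti_wick.
  rewrite /anti_wick /integralCd /S /= -RintegralZl//; apply: le_Rintegral => //.
  - by apply: (eq_integrable _ (fun t : T => (- C0)%:E * (f (vec t) ^+ 2)%:E)%E) => //; exact: integrableZl.
  - exact: dominated_Re anti_wick_dominated.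
  - have ReE (u : C) (x y : R) : Re (u * x%:C * y%:C) = Re u * (x * y).
      by rewrite !cReM !cImM /=; ring.
    by move=> t _; rewrite ReE -f2 ler_wpM2r ?sqr_ge0// (aR _).2.
have sRe (x : R) (y : C) : Re (x%:C * y) = x * Re y by rewrite cReM /= mul0r subr0.
have sIm (x : R) (y : C) : Im (x%:C * y) = x * Im y by rewrite cImM /= mul0r addr0.
rewrite wick_innerE E A2_normE cE sRe sIm cReD cImD AI addr0.
move: DR DI AR; rewrite -/S.
set r := (pi ^+ d)^-1; set Q := _ ^+ d; move=> DR DI AR; split.
  move: DR; rewrite ler_norml => /andP[DR _].
  have := ler_wpM2l pd0 (lerD DR AR); rewrite -/r; set X := Re (double_int _); set Y := Re _.
  by move=> H; apply: le_trans H; rewrite le_eqVlt; apply/orP; left; apply/eqP; ring.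
have := ler_wpM2l pd0 DI; rewrite -/r normrM (ger0_norm pd0) => /le_trans; apply.
by rewrite le_eqVlt; apply/orP; left; apply/eqP; ring.
Qed.
End wick_form.

Theorem theorem5p2 (R : realType) (d : nat) (rho : R)
    (a : 'rV[R[i]]_d -> 'rV[R[i]]_d -> R[i]) (C0 : R)
    (rho_gt0 : 0 < rho) (rho_le1 : rho <= 1)
    (a_symbol : shubin_wick_symbol (fun z => japanese z `^ (2 * rho)) rho a)
    (C0_ge0 : 0 <= C0)
    (a_lower : forall w : 'rV[R[i]]_d, - C0%:C <= a w w) :
  exists C : R, 0 <= C /\
    (forall F : 'rV[R[i]]_d -> R[i], A_schwartz F ->
       - C * A2_norm F ^+ 2 <= complex.Re (A2_inner (wick_op a F) F)) /\
    (forall F : 'rV[R[i]]_d -> R[i], A_schwartz F ->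
       `|complex.Im (A2_inner (wick_op a F) F)| <= C * A2_norm F ^+ 2).
Proof.
have [K K0 HK] := symbol_second_difference rho_gt0 rho_le1 a_symbol.
have c0 : 0 <= (pi ^+ d)^-1 * K * (pi ^+ 2) ^+ d.
  by rewrite !mulr_ge0 ?invr_ge0 ?exprn_ge0 ?pi_ge0.
(* The Schur bound of the remainder plus [C0] from the anti-Wick form. The latter is real, so the
   imaginary part is bounded by the first summand. *)
exists ((pi ^+ d)^-1 * K * (pi ^+ 2) ^+ d + C0); split; first by rewrite addr_ge0.
split=> F FS; have [HR HI] := wick_form_bounds rho_le1 a_symbol FS K0 a_lower HK => //.
by apply: le_trans HI _; rewrite ler_wpM2r ?sqr_ge0// lerDl.
Qed.
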